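(* For every integer $r\geq 3$, the limit $\lim_{n\to\infty} n^{-2} f^{(r)}(n;5r-8,5)$ exists and equals $\frac{1}{r^2-r-1}$.
   Context: An $r$-graph is an $r$-uniform hypergraph. For positive integers $s,k$, an $(s,k)$-configuration is an $r$-graph with exactly $k$ edges and at most $s$ vertices; an $r$-graph is $(s,k)$-free if it contains no $(s,k)$-configuration as a subgraph. For integers $r,n,s,k$, $f^{(r)}(n;s,k)$ denotes the maximum number of edges in an $n$-vertex $r$-graph that is $(s,k)$-free. *)

(* Defs.v *)
From HB Require Import structures.
From mathcomp Require Import all_boot all_order all_algebra.
Set Implicit Arguments. Unset Strict Implicit. Unset Printing Implicit Defensive.

Definition is_rgraph (r n : nat) (H : {set {set 'I_n}}) : bool :=
  [forall e in H, #|e| == r].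

Definition sk_free (n s k : nat) (H : {set {set 'I_n}}) : bool :=
  [forall F : {set {set 'I_n}},
     ((F \subset H) && (#|F| == k)) ==> (s < #|cover F|)].

Definition f_ext (r n s k : nat) : nat :=
  \max_(H : {set {set 'I_n}} | is_rgraph r H && sk_free s k H) #|H|.

(* Main.v *)
(* Put s = r - 2, so that r^2 - r - 1 is the number of pairs inside two r-edges sharing two vertices (a
   diamond), and 5 r - 8 = 5 s + 2. Call k edges dense when they cover at most s k + 2 vertices; five edges of
   a free hypergraph are never dense.

   Upper bound. A maximal family of disjoint minimal sets of two to four edges covering at most s k + 1
   vertices contains O(n) edges. Delete them and link two edges that share two vertices. A component of m
   edges then has m <= 4 and covers at least m C(r,2) - (m - 1) pairs; compared with m (r^2 - r - 1) / 2 this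
   is a surplus of 1/2 for m = 1, tight for m = 2, and a deficit of at most 1 for m = 3, 4. Credit each
   component of at least three edges with a pair joining the private parts of two linked edges. These
   pairs are distinct and lie in no edge, except that for m = 3 the pair may lie in one isolated
   edge, whose surplus then pays.

   Lower bound. We pack diamonds. In the base system they are indexed by s x s arrays, and a vertex private to
   one edge of the diamond forgets one row or one column of the array: the s^2 pairs of a diamond that lie in
   neither edge are then shared by many diamonds, and almost all pairs used lie inside edges. Copies
   x |-> a + mu_x b of the graph of used pairs, in a product of rings F_p[eps], pack a large complete graph
   almost perfectly. Finally a base diamond with vertices D x is replaced by its lifts to V x (Z_N)^C, whose
   vertex x has coordinates s_c (a_c + lam_x b_c) + kappa_c, where c runs over all bounded scalings s_c and
   all 0/1 translations kappa_c. Counting reduces five dense edges to four or five lifted diamonds with many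
   common vertices. If they lie over distinct base diamonds, a suitable scaling combines the coincidences into
   a linear relation violated by a translation; if they lie over one base diamond, the coincidences form a
   wheel whose determinant, nonzero for generic slopes lam and hence a unit modulo N, makes two of them equal.
   *)

Require Import Defs.
From HB Require Import structures.
From mathcomp Require Import all_boot all_order all_algebra.
From mathcomp Require Import zify ring lra.
Set Implicit Arguments. Unset Strict Implicit. Unset Printing Implicit Defensive.

(** * The upper bound *)

Section Dense.
Variables (V : finType) (r : nat).
Implicit Types (A B Q H : {set {set V}}) (e f : {set V}).

(** [c] is the excess over [r - 2] vertices per edge. For five edges and [c = 2] the bound is 5(r -
    2) + 2 = 5r - 8, the size excluded by the theorem. *)
Definition dense c Q := #|cover Q| <= (r - 2) * #|Q| + c.

Lemma coverU A B : cover (A :|: B) = cover A :|: cover B.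
Proof. exact: bigcup_setU. Qed.

Lemma cover1 e : cover [set e] = e.
Proof. by rewrite /cover big_set1. Qed.

Lemma cover_sup e Q : e \in Q -> e \subset cover Q.
Proof. by move=> eQ; rewrite /cover; apply: bigcup_sup. Qed.

(** Inclusion-exclusion: excesses add under disjoint union, and each common vertex lowers the sum by
    one. *)
Lemma dense_join k a b c A B : [disjoint A & B] -> dense a A -> dense b B ->
  k <= #|cover A :&: cover B| -> a + b <= c + k -> dense c (A :|: B).
Proof.
rewrite /dense => dAB dA dB kAB abc.
have -> : #|A :|: B| = #|A| + #|B|.
  by rewrite cardsU disjoint_setI0 // cards0 subn0.
rewrite coverU cardsU mulnDr; set x := (_ * #|A|) in dA *; set y := (_ * #|B|) in dB *; lia.
Qed.

Lemma dense1 e : 2 <= r -> #|e| = r -> dense 2 [set e].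
Proof. by move=> r2 er; rewrite /dense cover1 cards1 er; lia. Qed.

Lemma dense_weaken a b Q : a <= b -> dense a Q -> dense b Q.
Proof. by rewrite /dense; lia. Qed.

End Dense.

(** * Components of linked edges when no small set of edges is overdense *)

Section Clusters.
Variables (V : finType) (r : nat) (H : {set {set V}}).
Hypothesis hr : 3 <= r.
Implicit Types (e f g : {set V}) (Q K A B : {set {set V}}).
Hypothesis unif : forall e, e \in H -> #|e| = r.
Hypothesis sparse : forall Q : {set {set V}}, Q \subset H -> 2 <= #|Q| <= 4 -> ~ dense r 1 Q.
Hypothesis free5 : forall Q : {set {set V}}, Q \subset H -> #|Q| = 5 -> ~ dense r 2 Q.

Let r2 : 2 <= r. Proof. lia. Qed.

Definition adj : rel {set V} :=
  fun e f => [&& e \in H, f \in H, e != f & 2 <= #|e :&: f|].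

Lemma adj_sym : symmetric adj.
Proof. by move=> e f; rewrite /adj setIC eq_sym; case: (e \in H); case: (f \in H). Qed.

Lemma dense_add Q f k : Q \subset H -> f \in H -> f \notin Q -> dense r 2 Q ->
  k <= #|f :&: cover Q| -> dense r (4 - k) (f |: Q).
Proof.
move=> QH fH fQ dQ kf.
(* The minimum serves the truncated [4 - k]: for [k > 4] only excess 0 is claimed. *)
apply: (@dense_join _ _ (minn k 4) 2 2) => //.
- by rewrite disjoints1.
- by apply: dense1 => //; apply: unif.
- by rewrite cover1; apply: leq_trans kf; exact: geq_minl.
- lia.
Qed.

(** A third common vertex would lower the excess of [f |: Q] to 1, which [sparse] forbids for up to
    four edges. *)
Lemma inter_le2 Q f : Q \subset H -> f \in H -> f \notin Q -> dense r 2 Q ->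
  0 < #|Q| <= 3 -> #|f :&: cover Q| <= 2.
Proof.
move=> QH fH fQ dQ Q3; rewrite leqNgt; apply/negP => h.
have := dense_add QH fH fQ dQ h; apply: sparse.
  by rewrite subUset sub1set fH.
by rewrite cardsU1 fQ; lia.
Qed.

Definition comp e := [set f in H | connect adj e f].

Lemma connect_adj_sym : connect_sym adj.
Proof. by apply: sym_connect_sym; exact: adj_sym. Qed.

(** If no link left [Q], then [Q] would be closed under [adj] and contain everything reachable from
    [e]. *)
Lemma comp_step e (Q : {set {set V}}) : e \in H -> e \in Q -> Q \subset comp e ->
  Q != comp e -> exists f g, [/\ f \in Q, g \in comp e, g \notin Q & adj f g].
Proof.
move=> eH eQ sQ nQ.
have [/existsP[f /existsP[g /and4P[fQ gC gQ fg]]]|no] :=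
  boolP [exists f, exists g, [&& f \in Q, g \in comp e, g \notin Q & adj f g]].
  by exists f, g; split.
case/negP: nQ; rewrite eqEsubset sQ /=; apply/subsetP => g; rewrite inE => /andP[gH eg].
have cl : closed adj (mem Q).
  apply: intro_closed; first exact: connect_adj_sym.
  move=> x y xy xQ; apply: contraT => yQ; case/negP: no.
  apply/existsP; exists x; apply/existsP; exists y; rewrite xQ yQ xy /= andbT.
  have := subsetP sQ _ xQ; rewrite !inE => /andP[_ ex].
  by case/and4P: (xy) => _ yH _ _; rewrite yH; exact: connect_trans ex (connect1 xy).
by have <- := closed_connect cl eg.
Qed.

Definition shadow (Q : {set {set V}}) := [set p : {set V} | (#|p| == 2) && [exists e in Q, p \subset e]].

Lemma shadow1 e : #|e| = r -> #|shadow [set e]| = 'C(r, 2).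
Proof.
move=> <-; rewrite -cards_draws; apply: eq_card => p; rewrite !inE andbC; congr (_ && _).
apply/exists_inP/idP => [[f]|pe]; first by rewrite inE => /eqP->.
by exists e; rewrite ?inE.
Qed.

Lemma shadowU A B : shadow (A :|: B) = shadow A :|: shadow B.
Proof.
apply/setP => p; rewrite !inE -andb_orr; congr (_ && _).
apply/exists_inP/orP => [[f]|[]/exists_inP[f fA pf]].
- by rewrite inE => /orP[fA|fB] pf; [left|right]; apply/exists_inP; exists f.
- by exists f => //; rewrite inE fA.
- by exists f => //; rewrite inE fA orbT.
Qed.

(** A pair of [f] that is already in the shadow lies in [f :&: cover Q], which has room for one pair
    only. *)
Lemma shadow_add Q f : f \in H -> #|f :&: cover Q| <= 2 ->
  #|shadow Q| + 'C(r, 2) <= #|shadow (f |: Q)| + 1.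
Proof.
move=> fH f2; rewrite shadowU cardsU shadow1 ?unif //.
suff : #|shadow [set f] :&: shadow Q| <= 1 by lia.
have -> : 1 = 'C(2, 2) by [].
apply: leq_trans (_ : 'C(#|f :&: cover Q|, 2) <= _); last exact: leq_bin2l.
rewrite -cards_draws; apply: subset_leq_card; apply/subsetP => p.
rewrite !inE => /andP[/andP[p2 /exists_inP[g]]]; rewrite inE => /eqP-> pf /andP[_ /exists_inP[h hQ ph]].
by rewrite p2 andbT subsetI pf (subset_trans ph) // cover_sup.
Qed.

Lemma comp_grow e j : e \in H -> j < #|comp e| -> j <= 4 ->
  exists Q : {set {set V}}, [/\ e \in Q, Q \subset comp e, #|Q| = j.+1, dense r 2 Q
    & j <= 3 -> j.+1 * 'C(r, 2) <= #|shadow Q| + j].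
Proof.
move=> eH; elim: j => [|j IH] jC j4.
  exists [set e]; rewrite set11 sub1set inE eH connect0 cards1; split => //.
    by apply: dense1 => //; apply: unif.
  by rewrite shadow1 ?unif // => _; lia.
have [||Q [eQ QC cQ dQ sQ]] := IH; [lia|lia|].
have nQ : Q != comp e by apply/eqP => E; move: jC; rewrite -E cQ ltnn.
have [f [g [fQ gC gQ fg]]] := comp_step eH eQ QC nQ.
have CH : comp e \subset H by apply/subsetP => x; rewrite inE => /andP[].
have gH := subsetP CH _ gC.
have QH := subset_trans QC CH.
have fg2 : 2 <= #|g :&: cover Q|.
  case/and4P: fg => _ _ _ h; apply: leq_trans h _; apply: subset_leq_card.
  by rewrite setIC setIS // cover_sup.
exists (g |: Q); split.
- by rewrite inE eQ orbT.
- by rewrite subUset sub1set gC.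
- by rewrite cardsU1 gQ cQ.
- exact: (dense_add QH gH gQ dQ fg2).
- move=> j3; have := shadow_add gH (inter_le2 QH gH gQ dQ _); rewrite cQ.
  have := sQ _; rewrite (mulSn j.+1); lia.
Qed.

Lemma comp_le4 e : e \in H -> #|comp e| <= 4.
Proof.
move=> eH; rewrite leqNgt; apply/negP => h.
have [Q [_ QC cQ dQ _]] := comp_grow eH h (leqnn _).
apply: (free5 _ cQ dQ); apply: subset_trans QC _; apply/subsetP => x.
by rewrite inE => /andP[].
Qed.

Lemma shadow_comp e : e \in H -> #|comp e| * 'C(r, 2) <= #|shadow (comp e)| + #|comp e|.-1.
Proof.
move=> eH; have c4 := comp_le4 eH.
have c0 : 0 < #|comp e| by apply/card_gt0P; exists e; rewrite inE eH connect0.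
have [||Q [_ QC cQ _]] := comp_grow (j := #|comp e|.-1) eH; [lia|lia|].
have -> : Q = comp e by apply/eqP; rewrite eqEcard QC cQ; lia.
by rewrite prednK // => ->; lia.
Qed.

Definition comps := equivalence_partition (connect adj) H.

Lemma connect_adj_equiv : {in H & &, equivalence_rel (connect adj)}.
Proof.
move=> x y z _ _ _; split; first exact: connect0.
by move=> xy; apply: (same_connect connect_adj_sym xy).
Qed.

Lemma compsP K : K \in comps -> exists2 e, e \in H & K = comp e.
Proof. by move/imsetP => [e eH ->]; exists e. Qed.

Lemma comps_partition : partition comps H.
Proof. exact: equivalence_partitionP connect_adj_equiv. Qed.

Lemma comp_eq e f : f \in comp e -> comp f = comp e.
Proof.
rewrite inE => /andP[_ ef]; apply/setP => g; rewrite !inE.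
by rewrite (same_connect connect_adj_sym ef).
Qed.

Lemma comps_comp K e : K \in comps -> e \in K -> K = comp e.
Proof. by move=> /compsP[f fH ->] /comp_eq. Qed.

Lemma comps_sub K : K \in comps -> K \subset H.
Proof. by move=> /compsP[f fH ->]; apply/subsetP => x; rewrite inE => /andP[]. Qed.

(* A pair joining the private parts of two adjacent edges of a component with at least three edges. *)
Definition joint K (p : {set V}) := [&& #|p| == 2 &
  [exists e, exists f, exists h, [&& e \in K, f \in K, h \in K, adj e f, (h != e) && (h != f),
     adj e h || adj f h, p \subset e :|: f, ~~ (p \subset e) & ~~ (p \subset f)]]].

(** The first link leaving [e] gives [f], the next one leaving both gives [h]; edges of equal size
    have private vertices [a] and [b]. *)
Lemma joint_exists K : K \in comps -> 3 <= #|K| -> exists p, joint K p.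
Proof.
move=> /compsP[e eH ->{K}] K3.
have eC : e \in comp e by rewrite inE eH connect0.
have [||||e' [f [+ fC + ef]]] := @comp_step e [set e] => //; rewrite ?set11 ?sub1set //.
  by apply/eqP => E; move: K3; rewrite -E cards1.
rewrite !inE => /eqP E fe; subst e'.
have fH : f \in H by case/and4P: ef.
have [||||g [h [+ hC + gh]]] := @comp_step e [set e; f] => //; rewrite ?set21 //.
- by rewrite subUset !sub1set eC fC.
- by apply/eqP => E; move: K3; rewrite -E cards2; case: eqP.
rewrite !inE => gef; rewrite negb_or => hef.
have nsub x y : x \in H -> y \in H -> x != y -> exists2 a, a \in x & a \notin y.
  move=> xH yH xy; apply/subsetPn; apply: contra xy => sxy.
  by rewrite eqEcard sxy (unif xH) (unif yH) /=.
have [a ae af] : exists2 a, a \in e & a \notin f by apply: nsub => //; rewrite eq_sym.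
have [b bf be] : exists2 a, a \in f & a \notin e by apply: nsub.
exists [set a; b]; rewrite /joint cards2; apply/andP; split.
  by case: (a =P b) => // E; move: be; rewrite -E ae.
apply/existsP; exists e; apply/existsP; exists f; apply/existsP; exists h.
rewrite eC fC hC ef hef !subUset !sub1set !inE ae bf (negPf af) (negPf be) /= ?orbT ?andbT.
by case/orP: gef => /eqP <-; rewrite gh ?orbT.
Qed.

Lemma adj_dense e f : adj e f -> dense r 2 [set e; f] /\ [set e; f] \subset H.
Proof.
case/and4P=> eH fH ef h; split; last by rewrite subUset !sub1set eH fH.
apply: (@dense_add [set f] e 2); rewrite ?sub1set ?inE ?cover1 //.
by apply: dense1 => //; apply: unif.
Qed.

Lemma adj_cover e f Q : adj e f -> e \in Q -> 2 <= #|f :&: cover Q|.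
Proof.
case/and4P=> _ _ _ h eg; apply: leq_trans h _; apply: subset_leq_card.
by rewrite setIC setIS // cover_sup.
Qed.

Lemma pair_cover (p g : {set V}) Q : #|p| = 2 -> p \subset g -> p \subset cover Q -> 2 <= #|g :&: cover Q|.
Proof. by move=> <- pg pQ; apply: subset_leq_card; rewrite subsetI pg. Qed.

Lemma comp_adj K e f : K \in comps -> e \in K -> adj e f -> f \in K.
Proof.
move=> KP eK ef; rewrite (comps_comp KP eK) inE (connect1 ef) andbT.
by case/and4P: ef.
Qed.

Lemma adjacent_in_comp e : e \in H -> (forall f, ~~ adj e f) -> comp e = [set e].
Proof.
move=> eH no; apply/eqP; apply: contraT => ne.
have [||||f [g [+ _ _ fg]]] := @comp_step e [set e] => //; rewrite ?set11 ?sub1set ?inE ?eH ?connect0 //.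
  by rewrite eq_sym.
by move=> /eqP E; move: (no g); rewrite -E fg.
Qed.

(** The three edges [e], [f], [h] and [g] form four edges of excess 2, so a fifth edge sharing two
    vertices with them is excluded. Hence [g] has no link outside, and [K] has no fourth edge; links
    from [g] to [e], [f] or [h] would produce too many common vertices. *)
Lemma joint_cover K p g : K \in comps -> joint K p -> g \in H -> p \subset g ->
  comp g = [set g] /\ #|K| = 3.
Proof.
move=> KP /andP[/eqP p2 /existsP[e /existsP[f /existsP[h]]]].
case/and5P=> eK fK hK ef /and5P[/andP[he hf] ehfh pef npe npf] gH pg.
have KH := comps_sub KP.
have [eH fH hH] : [/\ e \in H, f \in H & h \in H] by split; apply: (subsetP KH).
have [dEF sEF] := adj_dense ef.
have nef : e != f by case/and4P: ef.
have hEF : h \notin [set e; f] by rewrite !inE negb_or he hf.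
have h2 : 2 <= #|h :&: cover [set e; f]|.
  by case/orP: ehfh => /adj_cover; apply; rewrite !inE eqxx ?orbT.
have d3 := dense_add sEF hH hEF dEF h2.
have s3 : h |: [set e; f] \subset H by rewrite subUset sub1set hH.
have cEF : #|[set e; f]| = 2 by rewrite cards2 nef.
have c3 : #|h |: [set e; f]| = 3 by rewrite cardsU1 hEF cEF.
have ge : g != e by apply: contra npe => /eqP<-.
have gf : g != f by apply: contra npf => /eqP<-.
have gEF : g \notin [set e; f] by rewrite !inE negb_or ge gf.
have covEF : cover [set e; f] = e :|: f by rewrite coverU !cover1.
(* An edge containing [p] and linked to [y], one of [e] and [f], meets [e :|: f] in the two vertices
   shared with [y] and in a vertex of [p] outside [y], contrary to [inter_le2]. *)
have adjEF x : x \in H -> x \notin [set e; f] -> p \subset x -> ~~ (adj e x || adj f x).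
  move=> xH xEF px; apply/negP => ax.
  have := inter_le2 sEF xH xEF dEF _; rewrite cEF => /(_ isT).
  apply/negP; rewrite -ltnNge covEF.
  have [y [yef npy ay]] : exists y : {set V}, [/\ y \subset e :|: f, ~~ (p \subset y) & adj y x].
    by case/orP: ax => ax; [exists e | exists f]; rewrite ?subsetUl ?subsetUr.
  have /subsetPn[c cp cy] := npy.
  case/and4P: ay => _ _ _; rewrite setIC => ay.
  apply: leq_ltn_trans ay _; apply: proper_card; apply/properP; split; first exact: setIS.
  by exists c; rewrite !inE ?(negPf cy) ?andbF // (subsetP px) //=; move: (subsetP pef _ cp); rewrite inE.
have gh : g != h by apply: contraTneq ehfh => <-; exact: adjEF.
have g3 : g \notin h |: [set e; f] by rewrite !inE !negb_or gh ge gf.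
have p3 : p \subset cover (h |: [set e; f]).
  by rewrite coverU covEF; apply: subset_trans pef _; exact: subsetUr.
have d4 := dense_add s3 gH g3 d3 (pair_cover p2 pg p3).
have s4 : g |: (h |: [set e; f]) \subset H by rewrite subUset sub1set gH.
have c4 : #|g |: (h |: [set e; f])| = 4 by rewrite cardsU1 g3 c3.
have alone x : x \in H -> x \notin g |: (h |: [set e; f]) ->
    2 <= #|x :&: cover (g |: (h |: [set e; f]))| -> False.
  move=> xH x4 x2; have := dense_add s4 xH x4 d4 x2; apply: free5.
    by rewrite subUset sub1set xH.
  by rewrite cardsU1 x4 c4.
have iso : forall x, ~~ adj g x.
  move=> x; apply/negP => gx.
  have xH : x \in H by case/and4P: gx.
  have [|x4] := boolP (x \in g |: (h |: [set e; f])); last first.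
    by apply: (alone _ xH x4); apply: (adj_cover gx); rewrite setU11.
  rewrite !inE => /or3P[/eqP xg|/eqP xh|xef].
  - by move: gx; rewrite xg /adj eqxx /= !andbF.
  - subst x; have := inter_le2 s3 gH g3 d3 _; rewrite c3 => /(_ isT) h3.
    have pE : p = g :&: cover (h |: [set e; f]).
      by apply/eqP; rewrite eqEcard subsetI pg p3 p2.
    have ghp : g :&: h = p.
      apply/eqP; rewrite eqEcard {1}pE setIS ?cover_sup ?setU11 //= p2.
      by case/and4P: gx.
    have ph : p \subset h by rewrite -ghp subsetIr.
    by move: (adjEF _ hH hEF ph); rewrite ehfh.
  - by have := adjEF _ gH gEF pg; rewrite (adj_sym e) (adj_sym f); case/orP: xef => /eqP <-; rewrite gx ?orbT.
split; first exact: adjacent_in_comp.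
have sK : h |: [set e; f] \subset K by rewrite !subUset !sub1set eK fK hK.
apply/eqP; rewrite eqn_leq -{2}c3 subset_leq_card // andbT leqNgt; apply/negP => K3.
have [||||y [x [y3 xK x3 yx]]] := @comp_step e (h |: [set e; f]) => //.
- by rewrite !inE eqxx orbT.
- by rewrite -(comps_comp KP eK).
- by rewrite -(comps_comp KP eK); apply/eqP => E; move: K3; rewrite -E c3.
rewrite -(comps_comp KP eK) in xK.
have xg : x != g.
  by apply: contraTneq yx => ->; rewrite adj_sym iso.
apply: (alone x); first exact: (subsetP KH).
  by rewrite in_setU1 negb_or xg.
by apply: (adj_cover yx); rewrite in_setU1 y3 orbT.
Qed.

(** Otherwise three edges of [K] and two of [K'], both of excess 2, share the two vertices of [p]:
    five dense edges. *)
Lemma joint_inj K K' p : K \in comps -> K' \in comps -> joint K p -> joint K' p -> K = K'.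
Proof.
move=> KP KP' /andP[/eqP p2 /existsP[e /existsP[f /existsP[h]]]].
case/and5P=> eK fK hK ef /and5P[/andP[he hf] ehfh pef npe npf].
move=> /andP[_ /existsP[e' /existsP[f' /existsP[h']]]].
case/and5P=> eK' fK' _ ef' /and5P[_ _ pef' _ _].
apply/eqP; apply: contraT => nK.
have /trivIsetP/(_ _ _ KP KP' nK) dK : trivIset comps by case/and3P: comps_partition.
have KH := comps_sub KP.
have [eH fH hH] : [/\ e \in H, f \in H & h \in H] by split; apply: (subsetP KH).
have [dEF sEF] := adj_dense ef.
have [dEF' sEF'] := adj_dense ef'.
have hEF : h \notin [set e; f] by rewrite !inE negb_or he hf.
have h2 : 2 <= #|h :&: cover [set e; f]|.
  by case/orP: ehfh => /adj_cover; apply; rewrite !inE eqxx ?orbT.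
have d3 := dense_add sEF hH hEF dEF h2.
have s3 : h |: [set e; f] \subset H by rewrite subUset sub1set hH.
have [nef nef'] : e != f /\ e' != f' by case/and4P: ef; case/and4P: ef'.
have dj : [disjoint h |: [set e; f] & [set e'; f']].
  apply: disjointWl (_ : _ \subset mem K) _; first by rewrite !subUset !sub1set eK fK hK.
  by apply: disjointWr (_ : _ \subset mem K') _; first by rewrite !subUset !sub1set eK' fK'.
exfalso; apply: (@free5 ((h |: [set e; f]) :|: [set e'; f'])).
- by rewrite subUset s3.
- by rewrite cardsU disjoint_setI0 // cards0 subn0 cardsU1 hEF !cards2 nef nef'.
apply: (dense_join dj d3 dEF' (k := 2)) => //; rewrite -p2; apply: subset_leq_card.
by rewrite subsetI !coverU !cover1 pef' andbT; apply: subset_trans pef _; exact: subsetUr.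
Qed.

(** Otherwise [g] shares [p] with [e], [f] and [p'] with [e'], [f'], and these five edges are
    dense. *)
Lemma joint_single K K' p p' g : K \in comps -> K' \in comps -> joint K p -> joint K' p' ->
  g \in H -> p \subset g -> p' \subset g -> K = K'.
Proof.
move=> KP KP' /andP[/eqP p2 /existsP[e /existsP[f /existsP[h]]]].
case/and5P=> eK fK hK ef /and5P[/andP[he hf] ehfh pef npe npf].
move=> /andP[/eqP p2' /existsP[e' /existsP[f' /existsP[h']]]].
case/and5P=> eK' fK' _ ef' /and5P[_ _ pef' npe' npf'] gH pg pg'.
apply/eqP; apply: contraT => nK.
have /trivIsetP/(_ _ _ KP KP' nK) dK : trivIset comps by case/and3P: comps_partition.
have [dEF sEF] := adj_dense ef.
have [dEF' sEF'] := adj_dense ef'.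
have [nef nef'] : e != f /\ e' != f' by case/and4P: ef; case/and4P: ef'.
have ge : g \notin [set e; f].
  by rewrite !inE; apply/negP => /orP[]/eqP E; move: npe npf; rewrite -E pg.
have ge' : g \notin [set e'; f'].
  by rewrite !inE; apply/negP => /orP[]/eqP E; move: npe' npf'; rewrite -E pg'.
have covEF x y : cover [set x; y] = x :|: y by rewrite coverU !cover1.
have d3 : dense r 2 (g |: [set e; f]).
  by apply: (dense_add sEF gH ge dEF (k := 2)); apply: (pair_cover p2 pg); rewrite covEF.
have dj : [disjoint g |: [set e; f] & [set e'; f']].
  rewrite disjoints_subset subUset -!disjoints_subset disjoints1 ge' /=.
  apply: disjointWl (_ : _ \subset mem K) _; first by rewrite !subUset !sub1set eK fK.
  by apply: disjointWr (_ : _ \subset mem K') _; first by rewrite !subUset !sub1set eK' fK'.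
exfalso; apply: (@free5 ((g |: [set e; f]) :|: [set e'; f'])).
- by rewrite subUset sEF' andbT subUset sEF andbT sub1set.
- by rewrite cardsU disjoint_setI0 // cards0 subn0 cardsU1 ge !cards2 nef nef'.
apply: (dense_join dj d3 dEF' (k := 2)) => //; rewrite -p2'; apply: subset_leq_card.
by rewrite subsetI covEF pef' andbT coverU cover1; apply: subset_trans pg' _; exact: subsetUl.
Qed.

Lemma shadow_disjoint K K' : K \in comps -> K' \in comps -> K != K' -> [disjoint shadow K & shadow K'].
Proof.
move=> KP KP' nK; rewrite -setI_eq0; apply/eqP/setP => p; rewrite !inE; apply/negP.
case/andP=> /andP[/eqP p2 /exists_inP[e eK pe]] /andP[_ /exists_inP[f fK pf]].
case/eqP: nK; have [ef|nef] := eqVneq e f.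
  by rewrite (comps_comp KP eK) (comps_comp KP' (e := f)) // ef.
have af : adj e f.
  rewrite /adj (subsetP (comps_sub KP)) // (subsetP (comps_sub KP')) // nef /=.
  by rewrite -p2; apply: subset_leq_card; rewrite subsetI pe.
by rewrite (comps_comp KP' fK); apply: comps_comp => //; apply: comp_adj af.
Qed.

Lemma clusters_bound : (r * (r - 1) - 1) * #|H| <= #|V| * (#|V| - 1).
Proof.
pose big := [set K in comps | 3 <= #|K|].
pose jt K := odflt set0 [pick p | joint K p].
have jtP K : K \in big -> joint K (jt K).
  rewrite inE => /andP[KP K3]; rewrite /jt; case: pickP => //= no.
  by have [p] := joint_exists KP K3; rewrite no.
have bigP K : K \in big -> K \in comps by rewrite inE => /andP[].
pose Sh := \bigcup_(K in comps) shadow K.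
pose cov := [set K in big | jt K \in Sh].
pose n1 := #|[set K in comps | #|K| == 1]|.
pose n3 := #|[set K in comps | #|K| == 3]|.
have cardSh : \sum_(K in comps) #|shadow K| <= #|Sh|.
  have -> : \sum_(K in comps) #|shadow K| = \sum_p #|[set K in comps | p \in shadow K]|.
    under eq_bigr => K _ do rewrite -sum1_card big_mkcond.
    rewrite exchange_big; apply: eq_bigr => p _.
    by rewrite -sum1_card -big_mkcondr; apply: eq_bigl => K; rewrite inE.
  rewrite -sum1_card [leqRHS]big_mkcond; apply: leq_sum => p _.
  have [|no] := boolP (p \in Sh); last first.
    rewrite leqn0 cards_eq0; apply/eqP/setP => K; rewrite !inE; apply/negP => /andP[KP pK].
    by case/negP: no; apply/bigcupP; exists K => //; rewrite inE.
  move=> _; apply/card_le1_eqP => K K'; rewrite !inE => /andP[KP pK] /andP[KP' pK'].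
  apply/eqP; apply: contraT => /(shadow_disjoint KP' KP); rewrite disjoint_sym => /pred0P/(_ p) /=.
  by rewrite /shadow !inE pK pK'.
have jt_inj : {in big &, injective jt}.
  move=> K K' KB KB' E; apply: (joint_inj (bigP _ KB) (bigP _ KB') (jtP _ KB)).
  by rewrite E; apply: jtP.
have covP K : K \in cov -> exists g, [/\ g \in H, jt K \subset g, comp g = [set g] & #|K| = 3].
  rewrite inE => /andP[KB /bigcupP[K' KP']]; rewrite inE => /andP[_ /exists_inP[g gK sg]].
  have gH := subsetP (comps_sub KP') _ gK; exists g.
  by have [] := joint_cover (bigP _ KB) (jtP _ KB) gH sg.
have cov3 : #|cov| <= n3.
  apply: subset_leq_card; apply/subsetP => K Kc; have [g [_ _ _ K3]] := covP _ Kc.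
  by rewrite inE K3 eqxx andbT; move: Kc; rewrite inE => /andP[/bigP].
have cov1 : #|cov| <= n1.
  (* A covered joint is charged to an isolated edge containing it; [joint_single] makes this charge
     injective. *)
  pose gg K := odflt set0 [pick g | [&& g \in H, jt K \subset g & comp g == [set g]]].
  have ggP K : K \in cov -> [/\ gg K \in H, jt K \subset gg K & comp (gg K) = [set gg K]].
    move=> /covP[g [gH sg cg _]]; rewrite /gg; case: pickP => [x /and3P[xH sx /eqP cx]|] //=.
    by move/(_ g); rewrite gH sg cg eqxx.
  have inj : {in cov &, injective (fun K => [set gg K])}.
    move=> K K' Kc Kc' /set1_inj E; have [gH sg _] := ggP _ Kc; have [_ sg' _] := ggP _ Kc'.
    have [KB KB'] : K \in big /\ K' \in big by split; [move: Kc|move: Kc']; rewrite [_ \in cov]inE => /andP[].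
    by apply: (joint_single (bigP _ KB) (bigP _ KB') (jtP _ KB) (jtP _ KB') gH sg); rewrite E.
  rewrite -(card_in_imset inj); apply: subset_leq_card; apply/subsetP => _ /imsetP[K Kc ->].
  have [gH _ <-] := ggP _ Kc; rewrite inE; apply/andP; split; first by apply/imsetP; exists (gg K).
  by have [_ _ ->] := ggP _ Kc; rewrite cards1.
(* Joints are distinct pairs of vertices, so the shadows and the joints together count twice only
   the joints of [cov]. *)
have total : #|Sh| + #|big| <= 'C(#|V|, 2) + #|cov|.
  have -> : 'C(#|V|, 2) = #|[set p : {set V} | #|p| == 2]|.
    by rewrite -cardsT -cards_draws; apply: eq_card => p; rewrite !inE subsetT.
  rewrite -(card_in_imset jt_inj) -(card_in_imset (D := cov) (f := jt)); last first.
    by move=> K K'; rewrite ![_ \in cov]inE => /andP[KB _] /andP[KB' _]; apply: jt_inj.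
  rewrite -cardsUI; apply: leq_add; apply: subset_leq_card.
    rewrite subUset; apply/andP; split; last first.
      by apply/subsetP => _ /imsetP[K KB ->]; have /andP[] := jtP _ KB; rewrite inE.
    by apply/bigcupsP => K _; apply/subsetP => p; rewrite !inE => /andP[].
  apply/subsetP => p; rewrite inE => /andP[pS /imsetP[K KB pE]].
  by apply/imsetP; exists K => //; rewrite inE KB -pE.
have bin2E m : 2 * 'C(m, 2) = m * (m - 1).
  by have := bin_ffact m 2; rewrite ffactnS ffactn1 -subn1 => <-; rewrite mulnC.
have C2 := bin2E r; have CV := bin2E #|V|.
(* [#|K| == 1] and [#|K| == 3] are twice the surpluses left after the credit; a joint that is covered, hence
   counted twice, consumes one of each. *)
have per K : K \in comps -> (r * (r - 1) - 1) * #|K| + (#|K| == 1) + (#|K| == 3)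
    <= 2 * #|shadow K| + 2 * (3 <= #|K|).
  move=> KP; have [e eH KE] := compsP KP.
  have := comp_le4 eH; have := shadow_comp eH; rewrite -KE.
  have K0 : 0 < #|K| by apply/card_gt0P; exists e; rewrite KE inE eH connect0.
  have Cpos : 0 < 'C(r, 2) by rewrite bin_gt0.
  rewrite -C2; move: K0; move: #|K| #|shadow K| 'C(r, 2) Cpos => k sh C Cpos k0 hs k4.
  have [E|[E|[E|E]]] : k = 1 \/ k = 2 \/ k = 3 \/ k = 4 by lia.
  1-4: by subst k; move: hs => /=; lia.
have := @leq_sum _ (index_enum _) (mem comps) _ _ per.
rewrite !big_split /= -!big_distrr /= -(card_partition comps_partition).
have cnt (P : pred {set {set V}}) : \sum_(K in comps) nat_of_bool (P K) = #|[set K in comps | P K]|.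
  by rewrite -sum1_card big_mkcond [RHS]big_mkcond; apply: eq_bigr => K _; rewrite inE; case: (K \in comps); case: (P K).
rewrite (cnt (fun K => #|K| == 1)) (cnt (fun K => #|K| == 3)) (cnt (fun K => 2 < #|K|)).
rewrite -/big -/n1 -/n3 !big1_eq; move: total cov1 cov3 cardSh CV.
move: (_ * #|H|) (#|V| * _) (\sum_(i in comps) #|shadow i|) => a b c; clear; lia.
Qed.

End Clusters.

(** * Deletion of the overdense sets *)

Section Cleaning.
Variables (V : finType) (r : nat) (H : {set {set V}}).
Hypothesis hr : 3 <= r.
Hypothesis unif : forall e, e \in H -> #|e| = r.
Hypothesis free5 : forall Q : {set {set V}}, Q \subset H -> #|Q| = 5 -> ~ dense r 2 Q.

Let denseb c (Q : {set {set V}}) := #|cover Q| <= (r - 2) * #|Q| + c.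

Definition overdense (Q : {set {set V}}) := [&& Q \subset H, 2 <= #|Q| <= 4 & denseb 1 Q].

(** Let [e] be an edge through [v]. If [e] shares two vertices with another edge of [Q], these two
    edges serve. Otherwise [e] meets the other two edges in at most two vertices, and without [e]
    they still have excess 1, against minimality. *)
Lemma overdense_three Q : minset overdense Q -> #|Q| = 3 -> forall v, v \in cover Q ->
  exists Q' : {set {set V}}, [/\ Q' \subset Q, #|Q'| = 2, dense r 2 Q' & v \in cover Q'].
Proof.
move=> /minsetP[/and3P[QH _ dQ] minQ] Q3 v /bigcupP[e eQ ve].
have eH := subsetP QH _ eQ.
have [f [g [fg fe ge QE]]] : exists f g, [/\ f != g, f != e, g != e & Q = e |: [set f; g]].
  have := cardsD1 e Q; rewrite Q3 eQ => -[/esym/eqP/cards2P[f [g [fg E]]]].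
  have [fQ gQ] : f \in Q :\ e /\ g \in Q :\ e by rewrite E !inE !eqxx orbT.
  move: fQ gQ; rewrite !inE => /andP[fe _] /andP[ge _].
  by exists f, g; split; rewrite // -E setD1K.
have [fQ gQ] : f \in Q /\ g \in Q by rewrite QE !inE !eqxx !orbT.
have pairOk x : x \in Q -> x != e -> 2 <= #|x :&: e| -> exists Q' : {set {set V}},
    [/\ Q' \subset Q, #|Q'| = 2, dense r 2 Q' & v \in cover Q'].
  move=> xQ xe h; exists (x |: [set e]); split.
  - by rewrite subUset !sub1set xQ eQ.
  - by rewrite cards2 xe.
  - apply: (@dense_join _ _ 2 2 2) => //.
    + by rewrite disjoints1 inE.
    + by apply: dense1; [exact: ltnW|apply: unif; apply: (subsetP QH)].
    + by apply: dense1; [exact: ltnW|exact: unif].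
    + by rewrite !cover1.
  - by rewrite coverU !cover1 inE ve orbT.
have [hf|hf] := leqP 2 #|f :&: e|; first exact: (pairOk f).
have [hg|hg] := leqP 2 #|g :&: e|; first exact: (pairOk g).
have fgQ : [set f; g] \subset Q by rewrite subUset !sub1set fQ gQ.
have efg : e \notin [set f; g] by rewrite !inE negb_or ![e == _]eq_sym fe ge.
have : denseb 1 [set f; g].
  move: dQ; rewrite /denseb QE coverU cover1 cardsU [#|e |: _|]cardsU1 efg (unif eH) cards2 fg.
  have : #|e :&: cover [set f; g]| <= 2.
    rewrite coverU !cover1 setIUr; apply: leq_trans (leq_card_setU _ _) _.
    by rewrite ![e :&: _]setIC; lia.
  lia.
move=> d2; have := minQ [set f; g] _ fgQ; rewrite /overdense (subset_trans fgQ) // cards2 fg d2.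
by move=> /(_ isT) E; move: efg; rewrite E eQ.
Qed.

(** In every case five edges are found as a set of excess 1 and a disjoint set of excess 2 with the
    common vertex [v], so their excess is 2. A single edge has excess 2, and when both sets have
    three edges [overdense_three] cuts one of them down to two. *)
Lemma two_overdense (v : V) Q Q' : minset overdense Q -> minset overdense Q' -> [disjoint Q & Q'] ->
  v \in cover Q -> v \in cover Q' -> 3 <= #|Q| -> False.
Proof.
move=> mQ mQ' dj vQ vQ' Q3.
have sub (W : {set {set V}}) : W \subset H -> [disjoint Q & W] -> #|Q| + #|W| = 5 -> dense r 2 W -> v \in cover W -> False.
  move=> WH dW c5 d2 vW; have /minsetP[/and3P[QH _ dQ] _] := mQ.
  apply: (@free5 (Q :|: W)); first by rewrite subUset QH.
    by rewrite cardsU disjoint_setI0 // cards0 subn0.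
  apply: (dense_join dW dQ d2 (k := 1)) => //.
  by apply/card_gt0P; exists v; rewrite inE vQ.
have /minsetP[/and3P[QH Q24 dQ] _] := mQ.
have /minsetP[/and3P[QH' Q24' dQ'] _] := mQ'.
have [Q4|Q3'] : #|Q| = 4 \/ #|Q| = 3 by lia.
  have /bigcupP[e eQ' ve] := vQ'; have eH := subsetP QH' _ eQ'.
  apply: (sub [set e]); rewrite ?sub1set ?cards1 ?Q4 ?cover1 //; last by apply: dense1; [exact: ltnW|exact: unif].
  by rewrite disjoint_sym disjoints1; apply: contraTN dj => eQ; apply/pred0Pn; exists e; rewrite /= eQ.
have [Q4|[Q2|Q3'']] : #|Q'| = 4 \/ #|Q'| = 2 \/ #|Q'| = 3 by lia.
- have /bigcupP[e eQ ve] := vQ; have eH := subsetP QH _ eQ.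
  apply: (@free5 (e |: Q')); first by rewrite subUset sub1set eH.
    rewrite cardsU1 Q4; suff -> : e \notin Q' by [].
    by apply: contraTN dj => eQ'; apply/pred0Pn; exists e; rewrite /= eQ.
  apply: (@dense_join _ _ 1 2 1) => //.
  + by rewrite disjoints1; apply: contraTN dj => eQ'; apply/pred0Pn; exists e; rewrite /= eQ.
  + by apply: dense1; [exact: ltnW|exact: unif].
  + by apply/card_gt0P; exists v; rewrite inE cover1 ve.
- apply: (sub Q') => //; first by rewrite Q3' Q2.
  exact: dense_weaken dQ'.
- have [W [WQ W2 dW vW]] := overdense_three mQ' Q3'' vQ'.
  apply: (sub W) => //; first exact: subset_trans WQ QH'.
    by apply: disjointWr dj; exact: WQ.
  by rewrite Q3' W2.
Qed.

(** The two pairs join at [v] to four edges of excess 1; an edge of [Q3] through [v] is the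
    fifth. *)
Lemma three_pairs (v : V) Q1 Q2 Q3 : minset overdense Q1 -> minset overdense Q2 -> minset overdense Q3 ->
  [disjoint Q1 & Q2] -> [disjoint Q1 & Q3] -> [disjoint Q2 & Q3] ->
  v \in cover Q1 -> v \in cover Q2 -> v \in cover Q3 -> #|Q1| = 2 -> #|Q2| = 2 -> False.
Proof.
move=> /minsetP[/and3P[H1 _ d1] _] /minsetP[/and3P[H2 _ d2] _] /minsetP[/and3P[H3 _ d3] _].
move=> d12 d13 d23 v1 v2 /bigcupP[e eQ ve] c1 c2.
have eH := subsetP H3 _ eQ.
have [e1 e2] : e \notin Q1 /\ e \notin Q2.
  split; [move: d13|move: d23]; rewrite disjoint_sym => /disjointFr -> //.
have dE : dense r 2 [set e] by apply: dense1; [exact: ltnW|exact: unif].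
apply: (@free5 (e |: (Q1 :|: Q2))).
- by rewrite !subUset sub1set eH H1.
- by rewrite cardsU1 !inE negb_or e1 e2 cardsU disjoint_setI0 // cards0 c1 c2.
apply: (@dense_join _ _ 1 2 1) => //.
- by rewrite disjoints1 inE negb_or e1.
- apply: (dense_join d12 d1 d2 (k := 1)) => //.
  by apply/card_gt0P; exists v; rewrite inE v1.
- by apply/card_gt0P; exists v; rewrite coverU cover1 !inE ve v1.
Qed.

(** No vertex is covered by three members of a maximal disjoint family of minimal overdense sets.
    The family thus has at most [2 * #|V|] members of at most four edges, whence the term
    [8 * #|V|]; [clusters_bound] handles the remaining edges. *)
Lemma upper_bound : (r * (r - 1) - 1) * #|H| <=
  #|V| * (#|V| - 1) + (r * (r - 1) - 1) * (8 * #|V|).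
Proof.
pose fam (P : {set {set {set V}}}) := trivIset P && [forall Q in P, minset overdense Q].
have [|P /maxsetP[/andP[tP /forall_inP oP] maxP]] := @ex_maxset _ fam.
  exists set0; apply/andP; split; first by apply/trivIsetP => A B; rewrite inE.
  by apply/forall_inP => A; rewrite inE.
have coverP : #|cover P| <= 8 * #|V|.
  have cP : #|P| <= 2 * #|V|.
    apply: (@leq_trans (\sum_(Q in P) #|cover Q|)).
      rewrite -sum1_card; apply: leq_sum => Q QP.
      have /minsetP[/and3P[QH Q24 _] _] := oP _ QP.
      have /card_gt0P[e eQ] : 0 < #|Q| by lia.
      rewrite (leq_trans _ (subset_leq_card (cover_sup eQ))) // unif; first by lia.
      exact: (subsetP QH).
    have -> : \sum_(Q in P) #|cover Q| = \sum_v #|[set Q in P | v \in cover Q]|.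
      under eq_bigr => Q _ do rewrite -sum1_card big_mkcond.
      rewrite exchange_big; apply: eq_bigr => v _.
      by rewrite -sum1_card -big_mkcondr; apply: eq_bigl => Q; rewrite inE.
    rewrite mulnC -sum_nat_const; apply: leq_sum => v _; rewrite leqNgt; apply/negP.
    case/card_gt2P => Q1 [Q2 [Q3 [[]]]].
    rewrite !inE => /andP[P1 v1] /andP[P2 v2] /andP[P3 v3] [n12 n23 n31].
    have tr := trivIsetP tP.
    have two (Q Q' : {set {set V}}) : Q \in P -> Q' \in P -> v \in cover Q -> v \in cover Q' -> Q != Q' -> #|Q| = 2.
      move=> QP QP' vQ vQ' ne; have [//|h] : #|Q| = 2 \/ 3 <= #|Q|.
        by have /minsetP[/and3P[_ /andP[Q24 _] _] _] := oP _ QP; move: Q24; case: #|Q| => [|[|[|m]]] //; [left|right].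
      by case: (two_overdense (oP _ QP) (oP _ QP') (tr _ _ QP QP' ne) vQ vQ' h).
    apply: (three_pairs (oP _ P1) (oP _ P2) (oP _ P3) _ _ _ v1 v2 v3).
    - exact: tr.
    - by apply: tr => //; rewrite eq_sym.
    - exact: tr.
    - exact: (two Q1 Q2).
    - exact: (two Q2 Q3).
  apply: leq_trans (leq_card_cover P) _; apply: (@leq_trans (\sum_(Q in P) 4)).
    by apply: leq_sum => Q /oP /minsetP[/and3P[_ Q24 _] _]; lia.
  by rewrite sum_nat_const; lia.
pose H' := H :\: cover P.
have cH : #|H| <= #|H'| + #|cover P|.
  by rewrite -(cardsID (cover P) H) addnC leq_add2l subset_leq_card // subsetIr.
apply: (@leq_trans ((r * (r - 1) - 1) * (#|H'| + #|cover P|))); first by rewrite leq_mul2l cH orbT.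
rewrite mulnDr leq_add //; last by rewrite leq_mul2l coverP orbT.
have HH : H' \subset H by exact: subsetDl.
apply: clusters_bound => //.
- by move=> e /(subsetP HH) /unif.
- move=> Q QH Q24 dQ.
  have bQ : overdense Q by rewrite /overdense (subset_trans QH HH) Q24.
  have [Q0 mQ0 Q0Q] := minset_exists bQ.
  have Q0H := subset_trans Q0Q QH.
  have /minsetP[/and3P[_ Q024 _] _] := mQ0.
  have /card_gt0P[e eQ0] : 0 < #|Q0| by lia.
  have : e \notin cover P by have := subsetP Q0H _ eQ0; rewrite inE => /andP[].
  case/negP; apply/bigcupP; exists Q0 => //.
  (* No edge of [Q0] is covered by the family, so [Q0] could be added; maximality then puts it into
     [P], although its edge [e] is uncovered. *)
  suff /maxP/(_ (subsetUr _ _)) <- : fam (Q0 |: P) by rewrite setU11.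
  apply/andP; split; last first.
    by apply/forall_inP => Q'; rewrite !inE => /predU1P[->|/oP].
  apply/trivIsetP => A B; rewrite !inE.
  have dj (B' : {set {set V}}) : B' \in P -> [disjoint Q0 & B'].
    move=> BP; rewrite disjoint_subset; apply/subsetP => x /(subsetP Q0H).
    by rewrite !inE => /andP[+ _]; apply: contra => xB; apply/bigcupP; exists B'.
  move=> /predU1P[->|AP] /predU1P[->|BP]; rewrite ?eqxx //; first by move=> _; exact: dj.
    by move=> _; rewrite disjoint_sym; exact: dj.
  by apply: (trivIsetP tP).
- by move=> Q QH; apply: free5; exact: subset_trans QH HH.
Qed.

End Cleaning.

Lemma f_ext_upper (r n : nat) : 3 <= r ->
  (r * (r - 1) - 1) * f_ext r n (5 * r - 8) 5 <= n * n + (r * (r - 1) - 1) * (8 * n).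
Proof.
move=> hr; rewrite /f_ext.
have [H /andP[/forall_inP unif /forallP free] ->] :
    {H : {set {set 'I_n}} | is_rgraph r H && sk_free (5 * r - 8) 5 H &
      \max_(H : {set {set 'I_n}} | is_rgraph r H && sk_free (5 * r - 8) 5 H) #|H| = #|H|}.
  apply: eq_bigmax_cond; apply/card_gt0P; exists set0; apply/andP; split.
    by apply/forall_inP => e; rewrite in_set0.
  apply/forallP => F; apply/implyP => /andP[]; rewrite subset0 => /eqP->.
  by rewrite cards0.
have := @upper_bound _ r H hr (fun e eH => eqP (unif e eH)); rewrite card_ord.
have h : forall Q : {set {set 'I_n}}, Q \subset H -> #|Q| = 5 -> ~ dense r 2 Q.
  move=> Q QH Q5; have := free Q; rewrite QH Q5 eqxx /= /dense Q5 => lt le; clear - hr lt le; set x := #|_| in lt le; lia.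
move=> /(_ h) le; apply: leq_trans le _; rewrite leq_add2r leq_mul2l leq_subr orbT //.
Qed.

(** * Packing a complete graph with copies of a graph *)

Import GRing.Theory.

Section Packing.
Variables (X : finType) (J : rel X).
Hypothesis symJ : symmetric J.
Hypothesis irrJ : irreflexive J.

Definition oriented := [set g : X * X | J g.1 g.2 && (enum_rank g.1 < enum_rank g.2)].
Let e := #|oriented|.
Hypothesis e_gt0 : 0 < e.

Definition orient (x y : X) := if enum_rank x < enum_rank y then (x, y) else (y, x).

Lemma orientC x y : orient x y = orient y x.
Proof.
rewrite /orient; case: (ltngtP (enum_rank x) (enum_rank y)) => //.
by move=> /ord_inj/enum_rank_inj ->.
Qed.

Lemma orientP x y : J x y -> orient x y \in oriented.
Proof.
move=> xy; rewrite /orient inE; case: (ltngtP (enum_rank x) (enum_rank y)) => /=.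
- by move=> h; rewrite xy h.
- by move=> h; rewrite symJ xy h.
- by move=> /ord_inj/enum_rank_inj E; move: xy; rewrite E irrJ.
Qed.

Lemma orient_eq x y x' y' : orient x y = orient x' y' ->
  (x = x' /\ y = y') \/ (x = y' /\ y = x').
Proof. by rewrite /orient; do 2!case: ifP => _; case=> -> ->; auto. Qed.

Definition pairidx x y := index (orient x y) (enum oriented).

Lemma pairidxC x y : pairidx x y = pairidx y x.
Proof. by rewrite /pairidx orientC. Qed.

Lemma pairidx_lt x y : J x y -> pairidx x y < e.
Proof. by move=> /orientP xy; rewrite /pairidx /e cardE index_mem mem_enum. Qed.

Lemma pairidx_eq x y x' y' : J x y -> J x' y' -> pairidx x y = pairidx x' y' ->
  (x = x' /\ y = y') \/ (x = y' /\ y = x').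
Proof.
move=> /orientP h /orientP h' E; apply: orient_eq.
by rewrite -(nth_index (x, y) (s := enum oriented) (x := orient x y)) ?mem_enum //
  -/(pairidx x y) E nth_index ?mem_enum.
Qed.

Variable p : nat.
Hypothesis pr : prime p.
Hypothesis pX : #|X| < p.
Hypothesis pe : e < p.
Hypothesis p_odd : odd p.

Let q := p %/ e.

Lemma natF_inj m n : m < p -> n < p -> (m%:R = n%:R :> 'F_p)%R -> m = n.
Proof. by move=> mp np /(congr1 val); rewrite /= !val_Fp_nat // !modn_small. Qed.

Local Open Scope ring_scope.

Definition ix (x : X) : 'F_p := (enum_rank x)%:R.

Lemma ix_inj : injective ix.
Proof.
move=> x y /natF_inj h; apply/enum_rank_inj/ord_inj/h; apply: ltn_trans (ltn_ord _) pX.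
Qed.

Lemma ix_top x : ix x != #|X|%:R.
Proof.
apply/eqP => /natF_inj h; have := ltn_ord (enum_rank x).
by rewrite h ?ltnn //; apply: ltn_trans (ltn_ord _) pX.
Qed.

(* One family of coordinates per ordered pair k.1: for a non-edge the two slopes coincide there,
   for an edge the two coordinates k = (_, true), (_, false) differ only by the slope of k.1.2, so that
   opposite values of [nuf] at k.1.1 contribute to the slope invariant of that edge alone. *)
Definition muf (k : X * X * bool) (x : X) : 'F_p :=
  if x == k.1.2 then (if J k.1.1 k.1.2 then (if k.2 then #|X|%:R else ix x) else ix k.1.1)
  else ix x.

(** Edges receive distinct multiples of [q]. With the shift [t < q] they remain below [p], so that
    the residue of [target + t] reveals both the edge and [t]. *)
Definition target (x y : X) : 'F_p := (pairidx x y * q)%:R.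

(** The factor with which [tau x y] enters the slope invariant of the edge: the two coordinates of
    index [(x, y)] carry opposite values and have the denominators [ix x - ix y] and
    [ix x - #|X|]. *)
Definition gain (x y : X) : 'F_p := (ix x - ix y)^-1 - (ix x - #|X|%:R)^-1.

Definition tau (x y : X) : 'F_p :=
  if (enum_rank x < enum_rank y)%N then target x y / gain x y else 0.

Definition nuf (k : X * X * bool) (x : X) : 'F_p :=
  if (x == k.1.1) && J k.1.1 k.1.2 then (if k.2 then - tau k.1.1 k.1.2 else tau k.1.1 k.1.2) else 0.

Lemma gain_neq0 x y : x != y -> gain x y != 0.
Proof.
move=> xy; rewrite subr_eq0; apply/eqP => /invr_inj /addrI /oppr_inj E.
by move: (ix_top y); rewrite E eqxx.
Qed.

Lemma muf_edge k x y : J x y -> muf k x != muf k y.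
Proof.
move=> xy; have nxy : x != y by apply: contraTneq xy => ->; rewrite irrJ.
case: k => [[a b] c]; rewrite /muf /=.
case: (eqVneq x b) => [E|nx]; case: (eqVneq y b) => [E'|ny].
- by move: nxy; rewrite E E' eqxx.
- subst b; have [ax|nax] := boolP (J a x).
    by case: c; [rewrite eq_sym ix_top|rewrite (inj_eq ix_inj)].
  by rewrite (inj_eq ix_inj); apply: contra nax => /eqP->; rewrite symJ.
- subst b; have [ay|nay] := boolP (J a y).
    by case: c; [rewrite ix_top|rewrite (inj_eq ix_inj)].
  by rewrite (inj_eq ix_inj); apply: contra nay => /eqP<-.
- by rewrite (inj_eq ix_inj).
Qed.

Lemma muf_nonedge x y : x != y -> ~~ J x y -> muf ((x, y), true) x = muf ((x, y), true) y.
Proof. by move=> xy nJ; rewrite /muf /= (negPf xy) (negPf nJ) eqxx. Qed.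

(** In the coordinates of index [(a, b')] with [b'] different from [b] the denominators agree and
    the opposite values of [nuf] at [a] cancel; index [(a, b)] leaves [tau * gain], and [tau] is
    zero for one of the two orders of the edge. *)
Lemma slope_sum x y : J x y ->
  \sum_k (nuf k x - nuf k y) / (muf k x - muf k y) = target x y.
Proof.
have half a b : J a b -> \sum_k nuf k a / (muf k a - muf k b) = tau a b * gain a b.
  move=> ab; have nab : a != b by apply: contraTneq ab => ->; rewrite irrJ.
  rewrite -(pair_bigA _ (fun (g : X * X) c => nuf (g, c) a / (muf (g, c) a - muf (g, c) b))) /=.
  rewrite (bigD1 (a, b)) //= [X in _ + X]big1 ?addr0.
    rewrite big_bool /nuf /muf /= eqxx ab (negPf nab) eqxx /= /gain; ring.
  move=> [a' b'] ne; rewrite big_bool /nuf /=; have [E|] := eqVneq a a'; last by rewrite !mul0r addr0.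
  subst a'; have [ab'|] := boolP (J a b'); last by rewrite !mul0r addr0.
  have nab' : a != b' by apply: contraTneq ab' => ->; rewrite irrJ.
  have nbb' : b != b' by apply: contraNneq ne => ->.
  by rewrite /muf /= (negPf nab') (negPf nbb') -mulrDl addNr mul0r.
move=> xy; have nxy : x != y by apply: contraTneq xy => ->; rewrite irrJ.
transitivity (\sum_k nuf k x / (muf k x - muf k y) + \sum_k nuf k y / (muf k y - muf k x)).
  rewrite -big_split /=; apply: eq_bigr => k _.
  by rewrite -[muf k y - muf k x]opprB invrN mulrN mulrBl.
rewrite !half //; last by rewrite symJ.
rewrite /tau; case: (ltngtP (enum_rank x) (enum_rank y)) => [h|h|/ord_inj/enum_rank_inj E].
- by rewrite mul0r addr0 mulfVK ?gain_neq0.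
- by rewrite mul0r add0r mulfVK ?gain_neq0 1?eq_sym // /target pairidxC.
- by rewrite E eqxx in nxy.
Qed.

Let kt := (X * X * bool)%type.
Variable k0 : kt.

(** One residue from each pair of opposite nonzero ones; this prevents two copies from tracing an
    edge in opposite directions. *)
Definition lower_half : {pred 'F_p} := [pred x : 'F_p | (0 < x <= p./2)%N].

Lemma card_lower_half : #|lower_half| = p./2.
Proof.
have hp : (p./2 < p)%N by have := prime_gt1 pr; lia.
pose f (i : 'I_(p./2)) : 'F_p := i.+1%:R.
have fi : injective f.
  move=> i j /natF_inj E; apply: ord_inj; apply: succn_inj; apply: E; apply: leq_ltn_trans hp; exact: ltn_ord.
rewrite -[RHS]card_ord -(card_image fi); apply: eq_card => x; rewrite inE.
apply/andP/imageP => [[x0 xp]|[i _ ->]]; last first.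
  by rewrite /f /= val_Fp_nat // modn_small //; apply: leq_ltn_trans hp; exact: ltn_ord.
have xlt : (x.-1 < p./2)%N by lia.
by exists (Ordinal xlt) => //; rewrite /f /= prednK // natr_Zp.
Qed.

Definition mult_fam (k : kt) : {pred 'F_p} := if k == k0 then lower_half else predC1 0.
Definition slope_fam (k : kt) : {pred 'F_p} := if k == k0 then pred1 0 else predT.

(* A unit b of the ring (F_p[eps])^kt is stored as its components beta_k (1 + g_k eps); the entry g_k0 is
   replaced by the value t < q of the invariant \sum_k g_k. *)
Definition pack_index : finType :=
  ({ffun kt -> 'F_p * 'F_p} * {b : {ffun kt -> 'F_p} | b \in family mult_fam} *
   {g : {ffun kt -> 'F_p} | g \in family slope_fam} * 'I_q)%type.

Definition slope (i : pack_index) (k : kt) : 'F_p :=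
  (val i.1.2) k + (if k == k0 then (i.2 : nat)%:R - \sum_l (val i.1.2) l else 0).

(** A pair [(u, v)] stands for u + v eps, and the coordinate is a + ([muf] + [nuf] eps) b (1 +
    [slope] eps) with eps^2 = 0. *)
Definition copy (i : pack_index) (x : X) : {ffun kt -> 'F_p * 'F_p} :=
  let: (a, b) := (i.1.1.1, val i.1.1.2) in
  [ffun k => ((a k).1 + muf k x * b k, (a k).2 + (muf k x * slope i k + nuf k x) * b k)].

Lemma slope_total (i : pack_index) : \sum_k slope i k = (i.2 : nat)%:R.
Proof.
rewrite /slope big_split /= -big_mkcond /= big_pred1_eq addrC subrK //.
Qed.

Lemma mult_neq0 (i : pack_index) k : (val i.1.1.2) k != 0.
Proof.
have /familyP/(_ k) := valP i.1.1.2; rewrite /mult_fam; case: (k == k0) => //.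
by rewrite inE => /andP[h _]; apply: contraTneq h => ->.
Qed.

Lemma mult_half (i j : pack_index) : (val i.1.1.2) k0 = - (val j.1.1.2) k0 -> False.
Proof.
have /familyP/(_ k0) := valP i.1.1.2; have /familyP/(_ k0) := valP j.1.1.2.
rewrite /mult_fam eqxx !inE.
move: (val j.1.1.2 k0) (val i.1.1.2 k0) => y x /andP[y0 yp] /andP[x0 xp] E.
have : (x + y)%:R = 0%:R :> 'F_p by rewrite natrD !natr_Zp E addNr.
move=> /natF_inj h; have := odd_double_half p; rewrite p_odd -addnn.
have : (x + y = 0)%N by apply: h; have := odd_double_half p; rewrite p_odd -addnn; lia.
lia.
Qed.

Lemma copy_diff (i : pack_index) k x y :
  (copy i x k).1 - (copy i y k).1 = (muf k x - muf k y) * (val i.1.1.2) k /\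
  (copy i x k).2 - (copy i y k).2 =
    ((muf k x - muf k y) * slope i k + (nuf k x - nuf k y)) * (val i.1.1.2) k.
Proof. by rewrite /copy !ffunE /=; split; ring. Qed.

(** The difference of the two vertices is a unit at an edge, so [x'], [y'] is an edge too. Dividing
    the eps-parts by the leading parts and summing over the coordinates gives [t] plus the target,
    hence the same [t] and the same edge; [mult_half] fixes its direction, and the remaining
    parameters follow coordinatewise. *)
Lemma copy_inj_edge (i j : pack_index) x y x' y' : J x y -> copy i x = copy j x' -> copy i y = copy j y' -> i = j.
Proof.
move=> xy Ex Ey.
have d1 k : (muf k x - muf k y) * (val i.1.1.2) k = (muf k x' - muf k y') * (val j.1.1.2) k.
  by have [<- _] := copy_diff i k x y; have [<- _] := copy_diff j k x' y'; rewrite Ex Ey.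
have d2 k : ((muf k x - muf k y) * slope i k + (nuf k x - nuf k y)) * (val i.1.1.2) k =
    ((muf k x' - muf k y') * slope j k + (nuf k x' - nuf k y')) * (val j.1.1.2) k.
  by have [_ <-] := copy_diff i k x y; have [_ <-] := copy_diff j k x' y'; rewrite Ex Ey.
have D0 k : muf k x - muf k y != 0 by rewrite subr_eq0 muf_edge.
have D0' k : muf k x' - muf k y' != 0.
  have : (muf k x' - muf k y') * (val j.1.1.2) k != 0 by rewrite -d1 mulf_neq0 ?mult_neq0.
  by rewrite mulf_eq0 negb_or => /andP[].
have xy' : J x' y'.
  apply: contraT => nJ; have [E|ne] := eqVneq x' y'.
    by move: (D0' k0); rewrite E subrr eqxx.
  by move: (D0' ((x', y'), true)); rewrite (muf_nonedge ne nJ) subrr eqxx.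
have s k : slope i k + (nuf k x - nuf k y) / (muf k x - muf k y) =
    slope j k + (nuf k x' - nuf k y') / (muf k x' - muf k y').
  have b0 := mult_neq0 i k; have b0' := mult_neq0 j k.
  apply: (mulfI (mulf_neq0 (D0 k) b0)); rewrite [in RHS]d1.
  transitivity (((muf k x - muf k y) * slope i k + (nuf k x - nuf k y)) * (val i.1.1.2) k).
    by field; exact: D0.
  by rewrite d2; field; exact: D0'.
have : \sum_k (slope i k + (nuf k x - nuf k y) / (muf k x - muf k y)) =
    \sum_k (slope j k + (nuf k x' - nuf k y') / (muf k x' - muf k y')).
  by apply: eq_bigr => k _; exact: s.
rewrite big_split [X in _ = X -> _]big_split /= !slope_total !slope_sum // /target -!natrD => E.
(* Below [p] equality modulo [p] is equality of naturals, and remainder and quotient by [q] separate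
   [t] from the edge. *)
have lt u v (t : 'I_q) : J u v -> (t + pairidx u v * q < p)%N.
  move=> /pairidx_lt h; apply: (@leq_trans (e * q)); last by rewrite mulnC leq_divM.
  apply: (@leq_trans ((pairidx u v).+1 * q)); first by rewrite mulSn ltn_add2r ltn_ord.
  by rewrite leq_mul2r h orbT.
have q0 : (0 < q)%N by apply: leq_ltn_trans (ltn_ord i.2).
have {}E := natF_inj (lt _ _ _ xy) (lt _ _ _ xy') E.
have Et : i.2 = j.2.
  by apply: ord_inj; move: (congr1 (modn^~ q) E); rewrite /= !(addnC _ (_ * q)%N) !modnMDl !modn_small.
have Ep : pairidx x y = pairidx x' y'.
  by move: (congr1 (divn^~ q) E); rewrite /= !(addnC _ (_ * q)%N) !divnMDl // !divn_small // !addn0.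
have [[Exx Eyy]|[Exy Eyx]] := pairidx_eq xy xy' Ep; last first.
  case: (@mult_half i j); apply: (mulfI (D0 k0)); rewrite d1 -Exy -Eyx; ring.
subst x' y'.
have Eb : i.1.1.2 = j.1.1.2.
  by apply/val_inj/ffunP => k; apply: (mulfI (D0 k)); rewrite d1.
have Es k : slope i k = slope j k by apply: addIr (s k).
have Eg : i.1.2 = j.1.2.
  apply/val_inj/ffunP => k; move: (Es k); rewrite /slope.
  case: eqP => [->|_]; last by rewrite !addr0.
  have /familyP/(_ k0) := valP i.1.2; have /familyP/(_ k0) := valP j.1.2.
  by rewrite /slope_fam eqxx !inE => /eqP-> /eqP->.
have Ea : i.1.1.1 = j.1.1.1.
  apply/ffunP => k; apply/eqP; rewrite -[_ == _]/((_ == _) && (_ == _)).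
  have /= := congr1 (fun f : {ffun kt -> 'F_p * 'F_p} => (f k).1) Ex.
  have /= := congr1 (fun f : {ffun kt -> 'F_p * 'F_p} => (f k).2) Ex.
  by rewrite !ffunE Eb Es => /addIr -> /addIr ->; rewrite !eqxx.
by move: i j {Ex Ey d1 d2 s Es E} Eb Eg Ea Et => [[[? ?] ?] ?] [[[? ?] ?] ?] /= -> -> -> ->.
Qed.

Lemma copy_inj (i : pack_index) : injective (copy i).
Proof.
move=> x y E; apply/eqP; apply: contraT => xy.
have [d _] := copy_diff i ((x, x), true) x y.
move: d; rewrite E subrr => /esym/eqP; rewrite mulf_eq0 (negPf (mult_neq0 _ _)) orbF.
by rewrite /muf /= irrJ eqxx [y == x]eq_sym (negPf xy) subr_eq0 (inj_eq ix_inj) (negPf xy).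
Qed.

Lemma card_pack_index : (#|{: pack_index}| = p ^ (2 * #|{: kt}|) *
   (p./2 * p.-1 ^ #|{: kt}|.-1) * p ^ #|{: kt}|.-1 * q)%N.
Proof.
have prodC m (F : kt -> nat) : (forall k, k != k0 -> F k = m) ->
    (\prod_(k : kt) F k = F k0 * m ^ #|{: kt}|.-1)%N.
  move=> h; rewrite (bigD1 k0) //=; congr (_ * _)%N.
  by rewrite (eq_bigr (fun=> m)) // prod_nat_const cardC1.
have c1 : (#|{: {b : {ffun kt -> 'F_p} | b \in family mult_fam}}| = p./2 * p.-1 ^ #|{: kt}|.-1)%N.
  rewrite card_sub (eq_card (B := family mult_fam)) // card_family foldrE big_map big_enum /=.
  rewrite (prodC p.-1); first by rewrite /mult_fam eqxx card_lower_half.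
  by move=> k ne; rewrite /mult_fam (negPf ne) cardC1 card_Fp.
have c2 : (#|{: {g : {ffun kt -> 'F_p} | g \in family slope_fam}}| = p ^ #|{: kt}|.-1)%N.
  rewrite card_sub (eq_card (B := family slope_fam)) // card_family foldrE big_map big_enum /=.
  rewrite (prodC p); first by rewrite /slope_fam eqxx card1 mul1n.
  by move=> k ne; rewrite /slope_fam (negPf ne) card_Fp.
by rewrite /pack_index !card_prod card_ord card_ffun card_prod !card_Fp // mulnn -expnM c1 c2 !card_prod.
Qed.

End Packing.

(** Bernoulli's inequality for 1 - d/p, cleared of denominators. *)
Lemma expn_sub_lb p d m : d <= p -> p ^ m.+1 <= (p - d) ^ m.+1 + m.+1 * d * p ^ m.
Proof.
move=> dp; elim: m => [|m IH]; first by rewrite !expn1 expn0; lia.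
have h : (p - d) ^ m.+1 <= p ^ m.+1 by rewrite leq_exp2r // leq_subr.
rewrite expnS (expnS (p - d)) (expnS p m).
move: IH h; rewrite !(expnS p m); move: ((p - d) ^ m.+1) (p ^ m) => a b IH h.
apply: (@leq_trans (p * (a + m.+1 * d * b))); first by rewrite leq_mul2l IH orbT.
rewrite mulnDr -{1}(subnK dp) mulnDl; nia.
Qed.

(* The pair (x', y') need not be an edge: not only are the copies of J edge-disjoint, but no edge of a copy is
   contained in the vertex set of another copy. *)
Lemma packing (X : finType) (J : rel X) (K : nat) : symmetric J -> irreflexive J ->
  (exists x y, J x y) ->
  exists (V I : finType) (T : I -> X -> V),
  [/\ forall i, injective (T i),
      forall i j x y x' y', J x y -> T i x = T j x' -> T i y = T j y' -> i = j,
      0 < #|V| &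
      K * #|V| ^ 2 <= K.+1 * (2 * #|oriented J| * #|I|)].
Proof.
move=> symJ irrJ [x0 [y0 xy0]].
have e0 : 0 < #|oriented J| by apply/card_gt0P; exists (orient x0 y0); exact: orientP.
set e := #|oriented J| in e0 *.
pose m := #|{: X * X * bool}|.
(* The last summand makes the Bernoulli loss, multiplied by [K.+1], at most [p ^ m.+1]. *)
have [p pbig pr] := prime_above (#|X| + e + 2 + K.+1 * (m.+1 * e)).
have pX : #|X| < p by lia.
have pe : e < p by lia.
have podd : odd p by case: (even_prime pr) => // p2; lia.
pose k0 : X * X * bool := (x0, x0, true).
exists {ffun X * X * bool -> 'F_p * 'F_p}, (pack_index J p k0), (copy (k0 := k0)).
split.
- exact: copy_inj.
- move=> i j x y x' y'; exact: copy_inj_edge.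
- apply/card_gt0P; by exists [ffun=> (0%R, 0%R)].
have m0 : 0 < m by apply/card_gt0P; exists k0.
rewrite (card_pack_index e0) // -/m -/e card_ffun card_prod card_Fp // -/m.
have lb := @expn_sub_lb p e m (ltnW pe).
have qe : p - e <= e * (p %/ e) by have := divn_eq p e; have := ltn_pmod p e0; lia.
have p2 : 2 * p./2 = p.-1 by have := odd_double_half p; rewrite podd -mul2n; lia.
have key : K * p ^ m.+1 <= K.+1 * (p.-1 ^ m * (e * (p %/ e))).
  apply: (@leq_trans (K.+1 * (p - e) ^ m.+1)); last first.
    by rewrite leq_mul2l /= expnSr leq_mul // leq_exp2r //; lia.
  have : K.+1 * (m.+1 * e) * p ^ m <= p ^ m.+1 by rewrite expnS leq_mul2r; apply/orP; right; lia.
  move: lb; move: (p ^ m.+1) (p ^ m) ((p - e) ^ m.+1) => a b c; nia.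
have -> : ((p * p) ^ m) ^ 2 = p ^ (2 * m) * p ^ m.-1 * p ^ m.+1.
  by rewrite mulnn -!expnM -!expnD; congr (p ^ _); lia.
have -> : K.+1 * (2 * e * (p ^ (2 * m) * (p./2 * p.-1 ^ m.-1) * p ^ m.-1 * (p %/ e))) =
  p ^ (2 * m) * p ^ m.-1 * (K.+1 * (2 * p./2 * p.-1 ^ m.-1 * (e * (p %/ e)))) by ring.
rewrite p2 -expnS prednK //.
by rewrite mulnCA leq_mul2l key orbT.
Qed.

(** * Diamonds *)

(* The 2r - 2 vertices of two r-edges sharing two vertices, r = s + 2: [inl (u, h)] is private to the
   edge h, [inr _] is common to both edges. *)
Definition role (s : nat) : finType := ('I_s * bool + bool)%type.

Definition in_edge s (h : bool) (x : role s) : bool :=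
  if x is inl (_, h') then h' == h else true.

(* Two distinct members share at most one vertex of any edge; an edge of a third member does not join two
   members that share two vertices. *)
Definition diamond_system s (V I : finType) (D : I -> role s -> V) : Prop :=
  [/\ forall i, injective (D i),
      forall i j h x y x' y', i != j -> x != y -> in_edge h x -> in_edge h y ->
        D i x = D j x' -> D i y = D j y' -> False &
      forall i j k h x y x' y' z w a b, i != j -> i != k -> j != k ->
        x != y -> D i x = D j x' -> D i y = D j y' ->
        z != w -> in_edge h z -> in_edge h w -> D k z = D i a -> D k w = D j b -> False].

(** * Diamonds indexed by arrays *)

Section Book.
Variables (s M : nat).
Let Zt : finType := {ffun 'I_s * 'I_s -> 'I_M.+1}.

Definition line (h : bool) (q : 'I_s * 'I_s) : 'I_s := if h then q.2 else q.1.

(* For an array [Z : Zt], a private vertex of the edge [h] forgets a column ([h = true]) or a row. *)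
Definition erase (x : role s) (Z : Zt) : Zt :=
  if x is inl (u, h) then [ffun q => if line h q == u then ord0 else Z q] else Z.

Definition bvert (x : role s) (Z : Zt) : role s * Zt := (x, erase x Z).

Definition bpair : rel (role s * Zt) :=
  fun x y => (x != y) && [exists Z, (x == bvert x.1 Z) && (y == bvert y.1 Z)].

Lemma bpair_sym : symmetric bpair.
Proof.
by move=> x y; rewrite /bpair eq_sym; congr (_ && _); apply: eq_existsb => Z; rewrite andbC.
Qed.

Lemma bpair_irr : irreflexive bpair.
Proof. by move=> x; rewrite /bpair eqxx. Qed.

Lemma bpairP x y Z : x != y -> bpair (bvert x Z) (bvert y Z).
Proof.
move=> xy; apply/andP; split; first by apply: contra xy => /eqP[->].
by apply/existsP; exists Z; rewrite !eqxx.
Qed.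

Lemma erase_eq u h Z Z' : erase (inl (u, h)) Z = erase (inl (u, h)) Z' ->
  forall q, line h q != u -> Z q = Z' q.
Proof. by move=> /ffunP E q /negPf nq; have := E q; rewrite !ffunE nq. Qed.

(** Two private vertices of one edge forget different parallel lines, so each entry survives in one
    of them; a common vertex forgets nothing. *)
Lemma erase_edge h x y Z Z' : x != y -> in_edge h x -> in_edge h y ->
  erase x Z = erase x Z' -> erase y Z = erase y Z' -> Z = Z'.
Proof.
case: x => [[u h1]|b] //; case: y => [[v h2]|b'] // uv /= /eqP E1 /eqP E2; subst h1 h2.
move=> /erase_eq E /erase_eq E'; apply/ffunP => q.
have [Eu|/E //] := eqVneq (line h q) u.
by apply: E'; rewrite Eu; apply: contra uv => /eqP->.
Qed.

(** Unless [Z = Z'], the vertices [x] and [y] are private to different edges, so one of them is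
    private to [h] and the arrays [Z], [Z'] differ only on one line [u] of direction [h]. Likewise
    [Z''] differs from [Z] and from [Z'] only on the lines [u1] and [u2]; comparing [u] with these
    two decides which arrays agree. *)
Lemma erase_third h x y z w Z Z' Z'' : x != y -> erase x Z = erase x Z' -> erase y Z = erase y Z' ->
  z != w -> in_edge h z -> in_edge h w -> erase z Z'' = erase z Z -> erase w Z'' = erase w Z' ->
  [\/ Z = Z', Z'' = Z | Z'' = Z'].
Proof.
move=> xy Ex Ey zw.
case: z zw => [[u1 h1]|b] zw; last by move=> _ _ /= ->; constructor 2.
case: w zw => [[u2 h2]|b] zw; last by move=> _ _ _ /= ->; constructor 3.
move=> /= /eqP E1 /eqP E2; subst h1 h2.
have nu : u1 != u2 by apply: contra zw => /eqP->.
move=> /erase_eq e1 /erase_eq e2.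
suff [u /erase_eq e0] : (exists u, erase (inl (u, h)) Z = erase (inl (u, h)) Z').
  have [Eu|n1] := eqVneq u u1.
    constructor 3; apply/ffunP => q; have [Eq|/e2 //] := eqVneq (line h q) u2.
    by rewrite e1 ?e0 // Eq ?Eu eq_sym.
  have [Eu|n2] := eqVneq u u2.
    constructor 2; apply/ffunP => q; have [Eq|/e1 //] := eqVneq (line h q) u1.
    by rewrite e2 ?e0 // Eq ?Eu.
  constructor 1; apply/ffunP => q; have [Eq|/e0 //] := eqVneq (line h q) u.
  by rewrite -e1 -?e2 // Eq.
have [Exy|nE] := eqVneq Z Z'; first by exists u1; rewrite Exy.
have ns k : in_edge k x -> in_edge k y -> False.
  by move=> kx ky; case/eqP: nE; apply: (erase_edge xy kx ky).
case: x xy Ex ns => [[u h1]|b] xy Ex ns; last by case/eqP: nE.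
case: y xy Ey ns => [[v h2]|b] xy Ey ns; last by case/eqP: nE.
have [E|n] := eqVneq h1 h; first by exists u; rewrite -E.
have [E|n2] := eqVneq h2 h; first by exists v; rewrite -E.
by case: (ns h1) => /=; rewrite ?eqxx //; move: n n2; case: h1 h2 h {xy Ex Ey ns zw e1 e2} => [] [] [].
Qed.

Definition ordered (T : finType) (R : rel T) := [set g : T * T | R g.1 g.2].

Definition pair_image (x y : role s) := [set (bvert x Z, bvert y Z) | Z : Zt].

Lemma card_pair_image x y : #|pair_image x y| <= M.+1 ^ (s * s).
Proof.
by apply: leq_trans (leq_imset_card _ _) _; rewrite card_ffun card_prod !card_ord.
Qed.

(* The two erasures agree on arrays which differ only at the common entry of the two lines. *)
Lemma card_cross_image u v h :
  M.+1 * #|pair_image (inl (u, h)) (inl (v, ~~ h))| <= M.+1 ^ (s * s).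
Proof.
pose q0 := if h then (v, u) else (u, v).
pose F q : pred 'I_M.+1 := if q == q0 then pred1 ord0 else predT.
have cF : M.+1 * #|family F| = M.+1 ^ (s * s).
  rewrite card_family foldrE big_map big_enum /= (bigD1 q0) //= /F eqxx card1 mul1n.
  rewrite (eq_bigr (fun=> M.+1)); last by move=> q /negPf->; rewrite card_ord.
  rewrite prod_nat_const cardC1 card_prod !card_ord -expnS prednK //.
  by rewrite muln_gt0 andbb (leq_ltn_trans _ (ltn_ord u)).
rewrite -cF leq_mul2l /=; apply: (@leq_trans #|[set (bvert (inl (u, h)) Z, bvert (inl (v, ~~ h)) Z) | Z in family F]|).
  apply: subset_leq_card; apply/subsetP => _ /imsetP[Z _ ->].
  apply/imsetP; exists [ffun q => if q == q0 then ord0 else Z q].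
    by apply/familyP => q; rewrite ffunE /F; case: ifP.
  rewrite /bvert /=; congr ((_, _), (_, _)); apply/ffunP => q; rewrite !ffunE; case: eqP => // nu; case: eqP => // E.
    by case: nu; rewrite E /line /q0; case: (h).
  by case: nu; rewrite E /line /q0; case: (h).
by apply: leq_imset_card.
Qed.

(** Of the ordered pairs of distinct roles, 2s^2 join private vertices of different edges and have
    few images by [card_cross_image]. The other 2(s^2 + 3s + 1) lie inside an edge, and s^2 + 3s + 1
    = r^2 - r - 1 for r = s + 2. *)
Lemma card_ordered_bpair :
  M.+1 * #|ordered bpair| <= M.+1 ^ (s * s) * (2 * (s * s + 3 * s + 1) * M.+1 + 2 * (s * s)).
Proof.
pose P (g : role s * role s) := g.1 != g.2.
pose N (g : role s * role s) := if g.1 is inl (_, h) then if g.2 is inl (_, h') then h != h' else false else false.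
have sub : ordered bpair \subset \bigcup_(g | P g) pair_image g.1 g.2.
  apply/subsetP => [[[x Zx] [y Zy]]]; rewrite inE => /andP[/= ne /existsP[Z /andP[/eqP Ex /eqP Ey]]].
  apply/bigcupP; exists (x, y); last by apply/imsetP; exists Z => //; rewrite Ex Ey.
  by apply: contra ne => /eqP /= xy; rewrite Ex Ey xy.
have cup : #|\bigcup_(g | P g) pair_image g.1 g.2| <= \sum_(g | P g) #|pair_image g.1 g.2|.
  elim/big_rec2: _ => [|g m A _ h]; first by rewrite cards0.
  by apply: leq_trans (leq_card_setU _ _) _; rewrite leq_add2l.
have cN : #|[pred g | N g]| = 2 * (s * s).
  pose f (t : 'I_s * 'I_s * bool) : role s * role s := (inl (t.1.1, t.2), inl (t.1.2, ~~ t.2)).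
  have fi : injective f by move=> [[u v] h] [[u' v'] h'] [-> -> ->].
  rewrite (_ : 2 * (s * s) = #|{: 'I_s * 'I_s * bool}|); last by rewrite !card_prod card_bool !card_ord mulnC.
  rewrite -(card_image fi); apply: eq_card => [[x y]]; rewrite !inE; apply/idP/imageP.
    case: x => [[u h]|b] //; case: y => [[v h']|b] //= ne.
    by exists (u, v, h) => //; rewrite /f /=; case: h h' ne => [] [].
  by move=> [[[u v] h] _ [-> ->]] /=; case: h.
have cP : #|[pred g | P g]| = 2 * (s * s) + 2 * (s * s + 3 * s + 1).
  have c0 : #|role s| = 2 * s + 2 by rewrite card_sum card_prod !card_bool card_ord mulnC.
  have cD : #|[pred g : role s * role s | ~~ P g]| = #|role s|.
    rewrite -(card_image (f := fun x : role s => (x, x))); last by move=> x y [].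
    apply: eq_card => [[x y]]; rewrite !inE negbK /=; apply/eqP/imageP; first by move=> ->; exists y.
    by move=> [z _ [-> ->]].
  have := cardC [pred g | P g]; rewrite card_prod (_ : #|[predC _]| = #|role s|).
    rewrite c0 (_ : (2 * s + 2) * (2 * s + 2) =
      2 * (s * s) + 2 * (s * s + 3 * s + 1) + (2 * s + 2)); last by ring.
    by move/addIn.
  by rewrite -cD; apply: eq_card => g; rewrite !inE.
have NP g : N g -> P g.
  by case: g => [[[u h]|b] [[v h']|b']] //=; rewrite /P /=; apply: contra => /eqP[_ ->].
set b := M.+1 ^ (s * s).
apply: (@leq_trans (\sum_(g | P g) (if N g then b else M.+1 * b))).
  apply: leq_trans (_ : M.+1 * \sum_(g | P g) #|pair_image g.1 g.2| <= _).
    by rewrite leq_mul2l (leq_trans (subset_leq_card sub) cup) orbT.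
  rewrite big_distrr; apply: leq_sum => g Pg; case: ifP => [Ng|_].
    case: g Ng {Pg} => [[[u h]|b1] [[v h']|b2]] //= ne.
    by rewrite (_ : h' = ~~ h); [exact: card_cross_image|case: h h' ne => [] []].
  by rewrite leq_mul2l card_pair_image orbT.
rewrite (bigID N) /= (eq_bigr (fun=> b)); last by move=> g /andP[_ ->].
rewrite [X in _ + X](eq_bigr (fun=> M.+1 * b)); last by move=> g /andP[_ /negPf->].
rewrite !sum_nat_const.
have -> : #|[pred g | P g & N g]| = 2 * (s * s).
  by rewrite -cN; apply: eq_card => g; rewrite !inE andbC; case Ng: (N g) => //=; rewrite NP.
have -> : #|[pred g | P g & ~~ N g]| = 2 * (s * s + 3 * s + 1).
  have := cardID [pred g | N g] [pred g | P g]; rewrite cP.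
  rewrite (_ : #|[predI _ & _]| = 2 * (s * s)); last first.
    by rewrite -cN; apply: eq_card => g; rewrite !inE; case Ng: (N g); rewrite ?andbF ?NP.
  by move/addnI => <-; apply: eq_card => g; rewrite !inE andbC.
by apply: eq_leq; ring.
Qed.

End Book.

Lemma oriented_ordered (X : finType) (J : rel X) : symmetric J ->
  2 * #|oriented J| <= #|ordered J|.
Proof.
move=> symJ; pose sw (g : X * X) := (g.2, g.1).
have swi : injective sw by move=> [a b] [c d] [-> ->].
have dj : oriented J :&: sw @: oriented J = set0.
  apply/setP => g; rewrite !inE; apply/negP => /andP[/andP[_ lt] /imsetP[h]].
  by rewrite inE => /andP[_ lt'] E; move: lt; rewrite E /= ltnNge ltnW.
rewrite mul2n -addnn -{2}(card_imset _ swi) -cardsUI dj cards0 addn0.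
apply: subset_leq_card; apply/subsetP => g; rewrite !inE => /orP[/andP[]//|/imsetP[h]].
by rewrite inE => /andP[hJ _] ->; rewrite symJ.
Qed.

(** A diamond is indexed by a copy of the graph [bpair] and an array. Diamonds sharing a pair lie in
    one copy by [packing], and there [erase_edge] and [erase_third] apply. *)
Lemma base_system (s K : nat) : 0 < s -> 0 < K ->
  exists (V I : finType) (D : I -> role s -> V),
  [/\ diamond_system D, 0 < #|V| &
      K * K * #|V| ^ 2 <= K.+1 * K.+1 * (s * s + 3 * s + 1) * (2 * #|I|)].
Proof.
move=> s0 K0; pose M := K * (s * s).
pose Zt := {ffun 'I_s * 'I_s -> 'I_M.+1}.
have e0 : exists x y, @bpair s M x y.
  by exists (bvert (inr true) [ffun=> ord0]), (bvert (inr false) [ffun=> ord0]); exact: bpairP.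
have [V [I [T [Tinj TJ V0 cI]]]] := @packing _ _ K (@bpair_sym s M) (@bpair_irr s M) e0.
exists V, (I * Zt)%type, (fun i x => T i.1 (bvert x i.2)); split => //.
- have one (i j : I * Zt) x y x' y' : x != y -> T i.1 (bvert x i.2) = T j.1 x' ->
      T i.1 (bvert y i.2) = T j.1 y' -> [/\ i.1 = j.1, bvert x i.2 = x' & bvert y i.2 = y'].
    move=> xy Ex Ey; have E := TJ _ _ _ _ _ _ (bpairP i.2 xy) Ex Ey.
    by move: Ex Ey; rewrite E => /Tinj-> /Tinj->.
  split.
  + by move=> i x y /Tinj [].
  + move=> i j h x y x' y' ij xy hx hy Ex Ey.
    have [E [xx Exx] [yy Eyy]] := one _ _ _ _ _ _ xy Ex Ey; subst x' y'.
    case/eqP: ij; move: i j E Exx Eyy {Ex Ey} => [i Z] [j Z'] /= -> Exx Eyy.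
    by rewrite (erase_edge xy hx hy Exx Eyy).
  + move=> i j k h x y x' y' z w a b ij ik jk xy Ex Ey zw hz hw Ez Ew.
    have [E [xx Exx] [yy Eyy]] := one _ _ _ _ _ _ xy Ex Ey; subst x' y'.
    rewrite -E in Ew.
    have [E' [zz Ezz] [ww Eww]] := one _ _ _ _ _ _ zw Ez Ew; subst a b.
    move: i j k E E' Exx Eyy Ezz Eww ij ik jk {Ex Ey Ez Ew} => [i Z] [j Z'] [k Z''] /= E E' Exx Eyy Ezz Eww.
    have [Z1|Z1|Z1] := erase_third xy Exx Eyy zw hz hw Ezz Eww.
    * by rewrite E Z1 eqxx.
    * by rewrite E' Z1 eqxx.
    * by rewrite -E E' Z1 eqxx.
- set Q := s * s + 3 * s + 1.
  have c1 := card_ordered_bpair s M.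
  have c2 := oriented_ordered (@bpair_sym s M).
  rewrite card_prod card_ffun card_prod !card_ord.
  move: cI c1 c2; rewrite -/Q.
  have MM : 2 * (s * s) * K <= 2 * Q * M.+1.
    rewrite /M -mulnA; apply: leq_mul => //; rewrite /Q; nia.
  move: (#|oriented _|) (#|ordered _|) (M.+1 ^ _) (#|V| ^ 2) #|I| => e o b n i cI c1 c2.
  have c3 : M.+1 * (K * (2 * e)) <= M.+1 * (b * (2 * Q * K.+1)).
    apply: (@leq_trans (K * (M.+1 * o))); first by rewrite mulnCA !leq_mul2l c2 !orbT.
    apply: (@leq_trans (K * (b * (2 * Q * M.+1 + 2 * (s * s))))); first by rewrite leq_mul2l c1 orbT.
    rewrite (_ : K * (b * _) = b * (2 * Q * K * M.+1 + 2 * (s * s) * K)); last by ring.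
    rewrite (_ : M.+1 * (b * _) = b * (2 * Q * K * M.+1 + 2 * Q * M.+1)); last by ring.
    by rewrite leq_mul2l leq_add2l MM orbT.
  rewrite leq_pmul2l // in c3.
  rewrite -mulnA; apply: (@leq_trans (K * (K.+1 * (2 * e * i)))); first by rewrite leq_mul2l cI orbT.
  rewrite (_ : K * _ = K.+1 * i * (K * (2 * e))); last by ring.
  rewrite (_ : K.+1 * K.+1 * _ * _ = K.+1 * i * (b * (2 * Q * K.+1))); last by ring.
  by rewrite leq_mul2l c3 orbT.
Qed.

(** * Slopes *)

Lemma prime_family (P : finType) (b : nat) :
  exists q : P -> nat, [/\ injective q, forall x, prime (q x) & forall x, b < q x].
Proof.
pose nxt m := sval (prime_above m).
have nxtP m : m < nxt m /\ prime (nxt m) by rewrite /nxt; case: (prime_above m).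
pose sq n := iter n.+1 nxt b.
have sq_mono m n : m < n -> sq m < sq n.
  elim: n => // n IH; rewrite ltnS leq_eqVlt => /predU1P[->|/IH h]; first by have [] := nxtP (sq n).
  by apply: ltn_trans h _; have [] := nxtP (sq n).
exists (fun x => sq (enum_rank x)); split.
- move=> x y E; apply/enum_rank_inj/ord_inj.
  by case: (ltngtP (enum_rank x) (enum_rank y)) => // /sq_mono; rewrite E ltnn.
- by move=> x; have [] := nxtP (iter (enum_rank x) nxt b).
- move=> x; elim: (enum_rank x : nat) => [|n IH]; first by have [] := nxtP b.
  by apply: ltn_trans IH _; have [] := nxtP (sq n).
Qed.

Import Order.TTheory Num.Theory.
Local Open Scope ring_scope.

(** Every difference of slopes has a prime divisor of its own, so two equal products of differences
    can be compared factor by factor. *)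
Definition generic (X : finType) (lam : X -> int) : Prop :=
  injective lam /\ forall x y, x != y -> exists2 q : nat, prime q &
    (q %| lam x - lam y)%Z /\
    forall u v, u != v -> (q %| lam u - lam v)%Z -> (u, v) = (x, y) \/ (u, v) = (y, x).

(** Chinese remaindering: modulo the prime of index [Some (x, y)] the residues are, up to the unit
    [E p], the ranks, except that [y] receives the rank of [x]. The index [None] keeps all ranks
    apart and yields injectivity. *)
Lemma generic_exists (X : finType) : exists lam : X -> int, generic lam.
Proof.
pose P := option (X * X).
have [q [qi qp qb]] := prime_family P #|X|.
pose rk (x : X) := enum_rank x : nat.
pose c (x : X) (p : P) : nat := if p is Some (y, z) then if x == z then rk y else rk x else rk x.
pose E (p : P) : nat := (\prod_(p' | p' != p) q p')%N.
pose lam x : int := \sum_p (c x p * E p)%N%:Z.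
have cb x p : (c x p < #|X|)%N by rewrite /c; case: p => [[y z]|]; [case: ifP => _|]; exact: ltn_ord.
have EP p p' : p' != p -> (q p %| E p')%N.
  by move=> ne; rewrite /E (bigD1 p) ?dvdn_mulr // eq_sym.
have En p : ~~ (q p %| E p)%N.
  rewrite /E; elim/big_rec: _ => [|p' m ne IH]; first by rewrite dvdn1; apply: contraTneq (qp p) => ->.
  rewrite Euclid_dvdM // negb_or IH andbT dvdn_prime2 //.
  by apply: contra ne => /eqP/qi->.
have dv x y p : (q p %| lam x - lam y)%Z = (c x p == c y p).
  rewrite /lam -sumrB (bigD1 p) //= rpredDr.
    rewrite !PoszM -mulrBl dvdzE abszM /= Euclid_dvdM // (negPf (En p)) orbF.
    apply/idP/eqP => [|->]; last by rewrite subrr dvdn0.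
    have := cb x p; have := cb y p; have := qb p.
    move: (q p) (c x p) (c y p) => Q u v Qb vb ub /dvdnP[k].
    case: k => [|k]; lia.
  apply: rpred_sum => p' ne; rewrite !PoszM -mulrBl.
  by apply: dvdz_mull; rewrite dvdzE /=; exact: EP.
have rki : injective rk by move=> x y /ord_inj/enum_rank_inj.
have lami : injective lam.
  by move=> x y E'; have := dv x y None; rewrite E' subrr dvdz0 /= => /esym/eqP/rki.
exists lam; split=> // x y xy; exists (q (Some (x, y))) => //; split.
  by rewrite dv /c (negPf xy) eqxx.
move=> u v uv; rewrite dv /c.
case: (eqVneq u y) => [Eu|uy]; case: (eqVneq v y) => [Ev|vy].
- by move: uv; rewrite Eu Ev eqxx.
- by move=> /eqP/rki E'; right; rewrite Eu E'.
- by move=> /eqP/rki E'; left; rewrite Ev E'.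
- by move=> /eqP/rki E'; move: uv; rewrite E' eqxx.
Qed.

(** * Nonvanishing of the wheel determinants *)

Section Wheels.
Variables (X : finType) (lam : X -> int).
Hypothesis gl : generic lam.
Let d x y := lam x - lam y.

Lemma generic_dvd3 x y (u1 v1 u2 v2 u3 v3 : X) z : x != y -> u1 != v1 -> u2 != v2 -> u3 != v3 ->
  d x y * z = d u1 v1 * d u2 v2 * d u3 v3 ->
  [\/ (u1, v1) = (x, y) \/ (u1, v1) = (y, x), (u2, v2) = (x, y) \/ (u2, v2) = (y, x)
    | (u3, v3) = (x, y) \/ (u3, v3) = (y, x)].
Proof.
move=> xy n1 n2 n3 E; have [q qp [qd qu]] := gl.2 _ _ xy.
have : (q %| d u1 v1 * d u2 v2 * d u3 v3)%Z by rewrite -E dvdz_mulr.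
rewrite dvdzE !abszM /= !Euclid_dvdM // => /orP[/orP[]|] h;
 [apply: Or31|apply: Or32|apply: Or33]; exact: qu.
Qed.

Lemma generic_dvd4 x y (u1 v1 u2 v2 u3 v3 u4 v4 : X) z :
  x != y -> u1 != v1 -> u2 != v2 -> u3 != v3 -> u4 != v4 ->
  d x y * z = d u1 v1 * d u2 v2 * d u3 v3 * d u4 v4 ->
  [\/ (u1, v1) = (x, y) \/ (u1, v1) = (y, x), (u2, v2) = (x, y) \/ (u2, v2) = (y, x),
      (u3, v3) = (x, y) \/ (u3, v3) = (y, x) | (u4, v4) = (x, y) \/ (u4, v4) = (y, x)].
Proof.
move=> xy n1 n2 n3 n4 E; have [q qp [qd qu]] := gl.2 _ _ xy.
have : (q %| d u1 v1 * d u2 v2 * d u3 v3 * d u4 v4)%Z by rewrite -E dvdz_mulr.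
rewrite dvdzE !abszM /= !Euclid_dvdM // => /orP[/orP[/orP[]|]|] h;
 [apply: Or41|apply: Or42|apply: Or43|apply: Or44]; exact: qu.
Qed.

(** The determinant of the cyclic system that [spoke_eq] yields for the unknowns [z_i.2 - o.2]. *)
Definition wheel3 (h1 h2 h3 r1 r2 r3 : X) :=
  d r1 h1 * d r2 h2 * d r3 h3 - d r1 h2 * d r2 h3 * d r3 h1.

(** If both products were equal, the private primes of [d r1 h1] and [d r2 h2] would force
    [r1 = h3], [r2 = h1], [r3 = h2]; the second product is then minus the first, and the determinant
    is twice a nonzero product. *)
Lemma wheel3_neq0 h1 h2 h3 r1 r2 r3 :
  h1 != h2 -> h2 != h3 -> h3 != h1 -> r1 != r2 -> r2 != r3 -> r3 != r1 ->
  r1 != h1 -> r1 != h2 -> r2 != h2 -> r2 != h3 -> r3 != h3 -> r3 != h1 ->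
  wheel3 h1 h2 h3 r1 r2 r3 != 0.
Proof.
move=> h12 h23 h31 r12 r23 r31 r1h1 r1h2 r2h2 r2h3 r3h3 r3h1; rewrite subr_eq0; apply/eqP => E.
have e1 : r1 = h3 /\ r2 = h1.
  have [] := @generic_dvd3 r1 h1 _ _ _ _ _ _ (d r2 h2 * d r3 h3) r1h1 r1h2 r2h3 r3h1;
    rewrite ?mulrA //; case=> -[];
    by [|move=> *; subst; rewrite ?eqxx in h12 h23 h31 r12 r23 r31 r1h1 r1h2 r2h2 r2h3 r3h3 r3h1].
have e2 : r3 = h2.
  have [] := @generic_dvd3 r2 h2 _ _ _ _ _ _ (d r1 h1 * d r3 h3) r2h2 r1h2 r2h3 r3h1;
    rewrite ?mulrA ?[_ * d r1 h1]mulrC //; case=> -[];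
    by [|move=> *; subst; rewrite ?eqxx in h12 h23 h31 r12 r23 r31 r1h1 r1h2 r2h2 r2h3 r3h3 r3h1].
case: e1 => e1 e1'; subst r1 r2 r3.
have : 2%:R * (d h3 h1 * d h1 h2 * d h2 h3) = 0.
  by rewrite mulr_natl mulr2n {1}E /d; ring.
move/eqP; rewrite !mulf_eq0 /= /d !subr_eq0 !(inj_eq gl.1) (negPf h12) (negPf h23) (negPf h31).
by [].
Qed.

Definition wheel4 (h1 h2 h3 h4 r1 r2 r3 r4 : X) :=
  d r1 h1 * d r2 h2 * d r3 h3 * d r4 h4 - d r1 h2 * d r2 h3 * d r3 h4 * d r4 h1.

(** Here the private primes of the first three factors already force identities that contradict the
    assumed distinctness. *)
Lemma wheel4_neq0 h1 h2 h3 h4 r1 r2 r3 r4 :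
  h1 != h2 -> h2 != h3 -> h3 != h4 -> h4 != h1 -> r1 != r2 -> r2 != r3 -> r3 != r4 -> r4 != r1 ->
  r1 != h1 -> r1 != h2 -> r2 != h2 -> r2 != h3 -> r3 != h3 -> r3 != h4 -> r4 != h4 -> r4 != h1 ->
  wheel4 h1 h2 h3 h4 r1 r2 r3 r4 != 0.
Proof.
move=> h12 h23 h34 h41 r12 r23 r34 r41 r1h1 r1h2 r2h2 r2h3 r3h3 r3h4 r4h4 r4h1.
rewrite subr_eq0; apply/eqP => E.
have e1 : (r1 = h3 /\ r2 = h1) \/ (r1 = h4 /\ r3 = h1).
  have [] := @generic_dvd4 r1 h1 _ _ _ _ _ _ _ _ (d r2 h2 * d r3 h3 * d r4 h4) r1h1 r1h2 r2h3 r3h4 r4h1;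
    rewrite ?mulrA //; case=> -[];
    by [auto|move=> *; subst; rewrite ?eqxx in h12 h23 h34 h41 r12 r23 r34 r41 r1h1 r1h2 r2h2 r2h3 r3h3 r3h4 r4h4 r4h1].
have e2 : (r2 = h4 /\ r3 = h2) \/ (r2 = h1 /\ r4 = h2).
  have [] := @generic_dvd4 r2 h2 _ _ _ _ _ _ _ _ (d r1 h1 * d r3 h3 * d r4 h4) r2h2 r1h2 r2h3 r3h4 r4h1;
    rewrite ?mulrA ?[_ * d r1 h1]mulrC //; case=> -[];
    by [auto|move=> *; subst; rewrite ?eqxx in h12 h23 h34 h41 r12 r23 r34 r41 r1h1 r1h2 r2h2 r2h3 r3h3 r3h4 r4h4 r4h1].
have e3 : (r3 = h1 /\ r4 = h3) \/ (r3 = h2 /\ r1 = h3).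
  have F : d r3 h3 * (d r1 h1 * d r2 h2 * d r4 h4) = d r1 h2 * d r2 h3 * d r3 h4 * d r4 h1 by rewrite -E; ring.
  have [] := generic_dvd4 r3h3 r1h2 r2h3 r3h4 r4h1 F; case=> -[];
    by [auto|move=> *; subst; rewrite ?eqxx in h12 h23 h34 h41 r12 r23 r34 r41 r1h1 r1h2 r2h2 r2h3 r3h3 r3h4 r4h4 r4h1].
move: e1 e2 e3 => [] [e1 e1'] [] [e2 e2'] [] [e3 e3'];
  by subst; rewrite ?eqxx in h12 h23 h34 h41 r12 r23 r34 r41 r1h1 r1h2 r2h2 r2h3 r3h3 r3h4 r4h4 r4h1.
Qed.

End Wheels.

(* The weights are the Lagrange coefficients at the slopes, cleared of denominators. *)
Lemma slope_relation (X : finType) (lam : X -> int) (R : {set X}) : injective lam -> (3 <= #|R| <= 4)%N ->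
  exists w : X -> int, [/\ forall x, x \in R -> w x != 0, \sum_(x in R) w x = 0 &
    \sum_(x in R) w x * lam x = 0].
Proof.
move=> li R34.
have ne x y : x != y -> lam x - lam y != 0 by move=> xy; rewrite subr_eq0 (inj_eq li).
have big (F : X -> int) : \sum_(x in R) F x = \sum_(x <- enum R) F x by rewrite big_enum.
have := enum_uniq (mem R); have : size (enum R) = #|R| by rewrite cardE.
have memR x : (x \in R) = (x \in enum R) by rewrite mem_enum.
setoid_rewrite big; move: (enum R) memR => l memR sl ul.
have [] : #|R| = 3 \/ #|R| = 4 by lia.
- move=> R3; case: l sl ul memR => [|a [|b [|c [|? ?]]]]; rewrite R3 // => _.
  rewrite /= !inE !negb_or => /and3P[/andP[ab ac] bc _] memR.
  exists (fun x => if x == a then lam b - lam c else if x == b then lam c - lam a else lam a - lam b).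
  rewrite !big_cons !big_nil !eqxx ![b == a]eq_sym ![c == a]eq_sym ![c == b]eq_sym (negPf ab) (negPf ac) (negPf bc).
  split; [|ring|ring] => x _.
  by case: (x == a); [exact: ne|case: (x == b); apply: ne; rewrite // eq_sym].
- move=> R4; case: l sl ul memR => [|a [|b [|c [|d [|? ?]]]]]; rewrite R4 // => _.
  rewrite /= !inE !negb_or => /and4P[/and3P[ab ac ad] /andP[bc bd] cd _] memR.
  exists (fun x => if x == a then (lam b - lam c) * (lam b - lam d) * (lam c - lam d)
    else if x == b then - ((lam a - lam c) * (lam a - lam d) * (lam c - lam d))
    else if x == c then (lam a - lam b) * (lam a - lam d) * (lam b - lam d)
    else - ((lam a - lam b) * (lam a - lam c) * (lam b - lam c))).
  rewrite !big_cons !big_nil !eqxx ![b == a]eq_sym ![c == a]eq_sym ![c == b]eq_sym.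
  rewrite ![d == a]eq_sym ![d == b]eq_sym ![d == c]eq_sym.
  rewrite (negPf ab) (negPf ac) (negPf bc) (negPf ad) (negPf bd) (negPf cd).
  split; [|ring|ring] => x _.
  have prod3 (u v t : int) : u != 0 -> v != 0 -> t != 0 -> u * v * t != 0.
    by move=> u0 v0 t0; rewrite !mulf_neq0.
  case: ifP => _; first by apply: prod3; apply: ne.
  case: ifP => _; first by rewrite oppr_eq0; apply: prod3; apply: ne.
  case: ifP => _; first by apply: prod3; apply: ne.
  by rewrite oppr_eq0; apply: prod3; apply: ne.
Qed.

(** [N] is 1 modulo [B]!, hence modulo every nonzero integer of absolute value at most [B]. *)
Lemma small_unit (B k N : nat) (w : int) : (0 < k)%N -> N = (k * B`!).+1 ->
  w != 0 -> (`|w| <= B)%N -> (w%:~R : 'Z_N) \is a GRing.unit.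
Proof.
move=> k0 NE w0 wB; have N1 : (1 < N)%N by rewrite NE ltnS muln_gt0 k0 fact_gt0.
have w1 : (0 < `|w|)%N by rewrite absz_gt0.
suff u : (`|w|%N%:R : 'Z_N) \is a GRing.unit.
  have [E|E] : w = `|w|%N%:Z \/ w = - (`|w|%N%:Z) by lia.
    by rewrite E.
  by rewrite E mulrNz unitrN.
rewrite unitZpE // coprime_sym /coprime.
have dv : (`|w| %| k * B`!)%N by rewrite dvdn_mull // dvdn_fact // w1.
by rewrite NE -addn1 -(divnK dv) gcdnMDl gcdn1.
Qed.

(** * Wheels of coincidences over a commutative ring *)

Section Rigid.
Variables (X : finType) (lam : X -> int) (A : comUnitRingType).
Let f x : A := (lam x)%:~R.
Let dot (x : X) (z : A * A) := z.1 + f x * z.2.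

(* [o] is the hub, [u] and [v] are consecutive rim lines. *)
Lemma spoke_eq x y r (o u v : A * A) : dot x o = dot x u -> dot y o = dot y v -> dot r u = dot r v ->
  (f r - f x) * (u.2 - o.2) = (f r - f y) * (v.2 - o.2).
Proof.
rewrite /dot => e1 e2 e3; apply/eqP; rewrite -subr_eq0; apply/eqP.
transitivity ((u.1 + f r * u.2) - (v.1 + f r * v.2) + ((o.1 + f x * o.2) - (u.1 + f x * u.2))
   - ((o.1 + f y * o.2) - (v.1 + f y * v.2))); first by ring.
by rewrite e1 e2 e3; ring.
Qed.

Lemma dot_eq x (u v : A * A) : dot x u = dot x v -> u.2 = v.2 -> u = v.
Proof. by case: u v => [a b] [c d]; rewrite /dot /= => E Eb; move: E; rewrite Eb => /addIr ->. Qed.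

Lemma rigid3 h1 h2 h3 r1 r2 r3 (o z1 z2 z3 : A * A) :
  (wheel3 lam h1 h2 h3 r1 r2 r3)%:~R \is a @GRing.unit A ->
  dot h1 o = dot h1 z1 -> dot h2 o = dot h2 z2 -> dot h3 o = dot h3 z3 ->
  dot r1 z1 = dot r1 z2 -> dot r2 z2 = dot r2 z3 -> dot r3 z3 = dot r3 z1 -> o = z1.
Proof.
move=> uw e1 e2 e3 s1 s2 s3.
have t1 := spoke_eq e1 e2 s1; have t2 := spoke_eq e2 e3 s2; have t3 := spoke_eq e3 e1 s3.
apply: (dot_eq e1); apply/eqP; rewrite eq_sym -subr_eq0; apply/eqP.
apply: (mulrI uw); rewrite mulr0.
have -> : (wheel3 lam h1 h2 h3 r1 r2 r3)%:~R * (z1.2 - o.2) =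
   (f r1 - f h1) * (z1.2 - o.2) * (f r2 - f h2) * (f r3 - f h3) -
   (f r1 - f h2) * (f r2 - f h3) * ((f r3 - f h1) * (z1.2 - o.2)).
  by rewrite /wheel3 rmorphB !rmorphM !rmorphB /= -!/(f _); ring.
rewrite t1 -t3.
transitivity ((f r1 - f h2) * (f r3 - f h3) * ((f r2 - f h2) * (z2.2 - o.2) - (f r2 - f h3) * (z3.2 - o.2))).
  by ring.
by rewrite t2 subrr mulr0.
Qed.

Lemma rigid4 h1 h2 h3 h4 r1 r2 r3 r4 (o z1 z2 z3 z4 : A * A) :
  (wheel4 lam h1 h2 h3 h4 r1 r2 r3 r4)%:~R \is a @GRing.unit A ->
  dot h1 o = dot h1 z1 -> dot h2 o = dot h2 z2 -> dot h3 o = dot h3 z3 -> dot h4 o = dot h4 z4 ->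
  dot r1 z1 = dot r1 z2 -> dot r2 z2 = dot r2 z3 -> dot r3 z3 = dot r3 z4 -> dot r4 z4 = dot r4 z1 -> o = z1.
Proof.
move=> uw e1 e2 e3 e4 s1 s2 s3 s4.
have t1 := spoke_eq e1 e2 s1; have t2 := spoke_eq e2 e3 s2.
have t3 := spoke_eq e3 e4 s3; have t4 := spoke_eq e4 e1 s4.
apply: (dot_eq e1); apply/eqP; rewrite eq_sym -subr_eq0; apply/eqP.
apply: (mulrI uw); rewrite mulr0.
have -> : (wheel4 lam h1 h2 h3 h4 r1 r2 r3 r4)%:~R * (z1.2 - o.2) =
   (f r1 - f h1) * (z1.2 - o.2) * (f r2 - f h2) * (f r3 - f h3) * (f r4 - f h4) -
   (f r1 - f h2) * (f r2 - f h3) * (f r3 - f h4) * ((f r4 - f h1) * (z1.2 - o.2)).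
  by rewrite /wheel4 rmorphB !rmorphM !rmorphB /= -!/(f _); ring.
rewrite t1 -t4.
transitivity ((f r1 - f h2) * (f r4 - f h4) * ((f r2 - f h2) * (z2.2 - o.2) * (f r3 - f h3)
   - (f r2 - f h3) * (f r3 - f h4) * (z4.2 - o.2))); first by ring.
rewrite t2 -[_ * _ * (z4.2 - o.2)]mulrA -t3.
by rewrite (_ : _ * _ * (f r3 - f h3) = (f r2 - f h3) * ((f r3 - f h3) * (z3.2 - o.2))) ?subrr ?mulr0 //; ring.
Qed.

End Rigid.

Local Close Scope ring_scope.

(** * Almost disjoint families of four or five sets *)

Section Overlap.
Variables (W T : finType) (S : T -> {set W}).
Hypothesis linear : forall t t', t != t' -> #|S t :&: S t'| <= 1.
Implicit Types (J K : {set T}).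

Definition cov J := \bigcup_(t in J) S t.

Lemma cov_D1 J j : j \in J -> cov J = S j :|: cov (J :\ j).
Proof. by move=> jJ; rewrite /cov (big_setD1 j). Qed.

(** Each member of [K] meets [S j] in at most one point, and the members outside [K] bring no
    further point. *)
Lemma few_points J j K : K \subset J :\ j ->
  (forall k, k \in J -> k != j -> k \notin K -> S j :&: S k \subset cov K) ->
  #|S j :&: cov (J :\ j)| <= #|K|.
Proof.
move=> KJ h; have sub : S j :&: cov (J :\ j) \subset \bigcup_(k in K) (S j :&: S k).
  rewrite -big_distrr /= subsetI subsetIl /=; apply/subsetP => x.
  rewrite inE => /andP[xj /bigcupP[k]]; rewrite !inE => /andP[kj kJ] xk.
  have [kK|kK] := boolP (k \in K); first by apply/bigcupP; exists k.
  by apply: (subsetP (h k kJ kj kK)); rewrite inE xj.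
apply: leq_trans (subset_leq_card sub) _; rewrite -[X in _ <= X]sum1_card.
elim/big_rec2: _ => [|k m A kK h2]; first by rewrite cards0.
apply: leq_trans (leq_card_setU _ _) _; rewrite leq_add // linear // eq_sym.
by have := subsetP KJ _ kK; rewrite !inE => /andP[].
Qed.

Lemma card_covD1 J j : j \in J -> #|cov J| + #|S j :&: cov (J :\ j)| = #|S j| + #|cov (J :\ j)|.
Proof. by move=> jJ; rewrite (cov_D1 jJ) cardsUI. Qed.

Lemma overlap_le J : \sum_(t in J) #|S t| <= #|cov J| + 'C(#|J|, 2).
Proof.
move Jn : #|J| => n; elim: n J Jn => [|n IH] J Jn.
  by move/eqP: Jn; rewrite cards_eq0 => /eqP->; rewrite big_set0.
have /card_gt0P[j jJ] : 0 < #|J| by rewrite Jn.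
have Jj : #|J :\ j| = n by move: Jn; rewrite (cardsD1 j) jJ => -[].
rewrite (big_setD1 j) // binS bin1; have := IH _ Jj; rewrite /=.
have : #|S j :&: cov (J :\ j)| <= n.
  by rewrite -Jj; apply: few_points => // k kJ kj; rewrite !inE kj kJ.
have := card_covD1 jJ; lia.
Qed.

Lemma others_ge J j c : j \in J -> #|cov J| + c <= \sum_(t in J) #|S t| ->
  c <= #|S j :&: cov (J :\ j)| + 'C(#|J|.-1, 2).
Proof.
move=> jJ; rewrite (big_setD1 j) //= => h; have := overlap_le (J :\ j).
have := card_covD1 jJ; rewrite (cardsD1 j J) jJ add1n /=; lia.
Qed.

Lemma peel J j c d : j \in J -> #|cov J| + c <= \sum_(t in J) #|S t| ->
  #|S j :&: cov (J :\ j)| <= d -> #|cov (J :\ j)| + c <= \sum_(t in J :\ j) #|S t| + d.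
Proof. by move=> jJ; rewrite (big_setD1 j) //= => h; have := card_covD1 jJ; lia. Qed.

Lemma point_sub j k x : j != k -> x \in S j -> x \in S k -> S j :&: S k \subset [set x].
Proof.
move=> jk xj xk; apply/subsetP => y yI; rewrite inE.
by have /card_le1_eqP/(_ y x yI) := linear jk; rewrite inE xj xk => ->.
Qed.

(* [j] has three points in common with the others: two coincidences or absences leave too few. *)
Lemma three_points4 J j : #|J| = 4 -> j \in J -> 3 <= #|S j :&: cov (J :\ j)| ->
  (forall k, k \in J -> k != j -> S j :&: S k != set0) /\
  (forall k l x, k \in J -> l \in J -> uniq [:: j; k; l] -> x \in S j -> x \in S k -> x \in S l -> False).
Proof.
move=> J4 jJ j3.
have cK k : k \in J -> k != j -> #|J :\ j :\ k| = 2.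
  move=> kJ kj; move: J4; rewrite (cardsD1 j) jJ (cardsD1 k) !inE kj kJ; lia.
split.
  move=> k kJ kj; apply: contraTneq j3 => E; rewrite -ltnNge ltnS -(cK k) //.
  apply: few_points; first exact: subD1set.
  by move=> l lJ lj; rewrite !inE lJ lj !andbT negbK => /eqP->; rewrite E sub0set.
move=> k l x kJ lJ; rewrite /= !inE negb_or andbT => /andP[/andP[jk jl] kl] xj xk xl.
suff : #|S j :&: cov (J :\ j)| <= 2 by lia.
rewrite -(cK k) 1?eq_sym //; apply: few_points; first exact: subD1set.
move=> i iJ ij; rewrite !inE iJ ij !andbT negbK => /eqP->.
apply: subset_trans (point_sub jk xj xk) _; rewrite sub1set; apply/bigcupP; exists l => //.
by rewrite !inE lJ !(eq_sym l) jl kl.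
Qed.

Definition apart j k := S j :&: S k = set0.
Definition concurrent j k l := exists x, [/\ x \in S j, x \in S k & x \in S l].

Lemma apartC j k : apart j k -> apart k j.
Proof. by rewrite /apart setIC. Qed.

Lemma concurrentC j k l : concurrent j k l -> concurrent j l k.
Proof. by case=> x [xj xk xl]; exists x. Qed.

Lemma concurrentA j k l : concurrent j k l -> concurrent k j l.
Proof. by case=> x [xj xk xl]; exists x. Qed.

Section Five.
Hypothesis T5 : #|T| = 5.
Variable j : T.
Hypothesis j3 : 3 <= #|S j :&: cov (setT :\ j)|.

(** Only two sets remain besides [j], [k] and [l]; if they already account for the points of [S j]
    on [S k] and [S l], then [S j] has at most two common points. *)
Lemma redundant2 k l : uniq [:: j; k; l] ->
  S j :&: S k \subset cov (~: [set j; k; l]) -> S j :&: S l \subset cov (~: [set j; k; l]) -> False.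
Proof.
rewrite /= !inE negb_or andbT => /andP[/andP[jk jl] kl] hk hl.
have c2 : #|~: [set j; k; l]| = 2.
  have := cardsC [set j; k; l]; rewrite T5 -setUA cardsU1 cards2 !inE negb_or jk jl kl; lia.
suff : #|S j :&: cov (setT :\ j)| <= 2 by lia.
rewrite -c2; apply: few_points.
  by apply/subsetP => x; rewrite !inE !negb_or andbT => /andP[/andP[]].
by move=> i _ ij; rewrite !inE negbK (negPf ij) /= => /orP[] /eqP ->.
Qed.

Lemma apart_sub k K : apart j k -> S j :&: S k \subset cov K.
Proof. by move=> ->; exact: sub0set. Qed.

Lemma concurrent_sub k l K : j != k -> concurrent j k l -> l \in K -> S j :&: S k \subset cov K.
Proof.
move=> jk [x [xj xk xl]] lK; apply: subset_trans (point_sub jk xj xk) _.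
by rewrite sub1set; apply/bigcupP; exists l.
Qed.

Lemma apart2 k l : uniq [:: j; k; l] -> apart j k -> apart j l -> False.
Proof. by move=> u ak al; apply: (redundant2 u); exact: apart_sub. Qed.

Lemma apart_concurrent k l n : uniq [:: j; k; l; n] -> apart j k -> concurrent j l n -> False.
Proof.
move=> u ak cl; have /and5P[] := u; rewrite !inE !negb_or => /and3P[jk jl jn] /andP[kl kn] ln _ _.
apply: (@redundant2 k l); first by rewrite /= !inE negb_or jk jl kl.
  exact: apart_sub.
by apply: (concurrent_sub jl cl); rewrite !inE !negb_or !(eq_sym n) jn kn ln.
Qed.

Lemma concurrent2 k l k' l' : uniq [:: j; k; l] -> uniq [:: j; k'; l'] -> l != l' -> l' != k -> l != k' ->
  concurrent j k l -> concurrent j k' l' -> False.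
Proof.
rewrite /= !inE !negb_or !andbT => /andP[/andP[jk jl] kl] /andP[/andP[jk' jl'] kl'] ll lk' lk c c'.
apply: (@redundant2 l l'); first by rewrite /= !inE negb_or jl jl' ll.
  by apply: (concurrent_sub jl (concurrentC c)); rewrite !inE !negb_or !(eq_sym k) jk (eq_sym l k) kl lk'.
by apply: (concurrent_sub jl' (concurrentC c')); rewrite !inE !negb_or !(eq_sym k') jk' lk (eq_sym l' k') kl'.
Qed.

End Five.

Lemma extend_uniq (t : seq T) : uniq t -> exists t', uniq (t ++ t') /\ size (t ++ t') = #|T|.
Proof.
move=> ut; exists [seq x <- enum T | x \notin t]; have u : uniq (t ++ [seq x <- enum T | x \notin t]).
  rewrite cat_uniq ut filter_uniq ?enum_uniq // andbT; apply/hasPn => x.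
  by rewrite mem_filter => /andP[].
split=> //; rewrite cardT; apply/perm_size/uniq_perm => //; first exact: enum_uniq.
by move=> x; rewrite mem_cat mem_filter !mem_enum !inE andbT orbN.
Qed.

End Overlap.

(** * Lifting *)

Section Lift.
Variables (s : nat) (V I : finType) (D : I -> role s -> V).
Hypothesis dD : diamond_system D.
Variable lam : role s -> int.
Hypothesis gl : generic lam.
Variable rel : {set role s} -> role s -> int.
Variables (B q0 N : nat).
Hypothesis k0 : 0 < q0.
Hypothesis NE : N = (q0 * B`!).+1.

Local Open Scope ring_scope.
Hypothesis relP : forall R : {set role s}, (3 <= #|R| <= 4)%N ->
  [/\ forall x, x \in R -> rel R x != 0, \sum_(x in R) rel R x = 0 &
      \sum_(x in R) rel R x * lam x = 0].
Hypothesis B5 : (5 <= B)%N.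
Hypothesis B_rel : forall R x, (`|(12 * rel R x)%R| <= B)%N.
Hypothesis B_lam : forall x y, (`|(lam x - lam y)%R| <= B)%N.
Hypothesis B_wheel3 : forall h1 h2 h3 r1 r2 r3, (`|wheel3 lam h1 h2 h3 r1 r2 r3| <= B)%N.
Hypothesis B_wheel4 : forall h1 h2 h3 h4 r1 r2 r3 r4,
  (`|wheel4 lam h1 h2 h3 h4 r1 r2 r3 r4| <= B)%N.

Definition twist : finType := ({ffun I * role s -> 'I_(B + B).+1} * {ffun I * role s -> bool})%type.

(** The codes are shifted by [B] to represent the integers from [-B] to [B]; zero is replaced by 1,
    so that every scaling is a unit modulo [N]. *)
Definition scale (c : twist) (i : I) (x : role s) : int :=
  let z := (c.1 (i, x) : nat)%:Z - B%:Z in if z == 0 then 1 else z.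

Lemma scale_unit c i x : ((scale c i x)%:~R : 'Z_N) \is a GRing.unit.
Proof.
rewrite /scale; case: eqP => [_|/eqP z0]; first by rewrite unitr1.
apply: (small_unit k0 NE z0); have := ltn_ord (c.1 (i, x)); lia.
Qed.

Lemma twist_exists (f : I -> role s -> int) (g : I -> role s -> bool) :
  (forall i x, f i x != 0 /\ (`|f i x| <= B)%N) ->
  exists c : twist, (forall i x, scale c i x = f i x) /\ (forall i x, c.2 (i, x) = g i x).
Proof.
move=> fP; exists ([ffun ix => inord `|f ix.1 ix.2 + B%:Z|], [ffun ix => g ix.1 ix.2]).
split=> i x; last by rewrite ffunE.
have [f0 fB] := fP i x; rewrite /scale ffunE /= inordK; last by lia.
have -> : (`|(f i x + B)%R|%N : int) - B%:Z = f i x by lia.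
by rewrite (negPf f0).
Qed.

Definition key : finType := (I * {ffun twist -> 'Z_N * 'Z_N})%type.

Definition dot (x : role s) (z : 'Z_N * 'Z_N) : 'Z_N := z.1 + (lam x)%:~R * z.2.

Definition lvert : finType := (V * {ffun twist -> 'Z_N})%type.

Definition lift (j : key) (x : role s) : lvert :=
  (D j.1 x, [ffun c => (scale c j.1 x)%:~R * dot x (j.2 c) + (c.2 (j.1, x))%:R]).

Lemma lift_base j j' x x' : lift j x = lift j' x' -> D j.1 x = D j'.1 x'.
Proof. by case. Qed.

Lemma D_inj i : injective (D i). Proof. by case: dD. Qed.

Lemma lift_inj j : injective (lift j).
Proof. by move=> x y /lift_base/D_inj. Qed.

Lemma lift_same j j' x x' : j.1 = j'.1 -> lift j x = lift j' x' ->
  x = x' /\ forall c, dot x (j.2 c) = dot x (j'.2 c).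
Proof.
move=> E L; have := lift_base L; rewrite E => /D_inj xx; subst x'; split=> // c.
have /= := congr1 (fun p : lvert => p.2 c) L; rewrite !ffunE E => /addIr.
by apply: mulrI; exact: scale_unit.
Qed.

Lemma lift_two j j' x y x' y' : j.1 = j'.1 -> x != y -> lift j x = lift j' x' -> lift j y = lift j' y' -> j = j'.
Proof.
move=> E xy /(lift_same E)[_ ex] /(lift_same E)[_ ey].
suff Ez : j.2 = j'.2 by case: j j' E Ez {ex ey} => [? ?] [? ?] /= -> ->.
apply/ffunP => c; move: (ex c) (ey c); rewrite /dot; case: (j.2 c) (j'.2 c) => [a b] [a' b'] /= e1 e2.
have : (lam x - lam y)%:~R * (b - b') = 0 :> 'Z_N.
  rewrite rmorphB /=; transitivity ((a + (lam x)%:~R * b) - (a' + (lam x)%:~R * b')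
    - ((a + (lam y)%:~R * b) - (a' + (lam y)%:~R * b'))); first by ring.
  by rewrite e1 e2 !subrr.
have u : ((lam x - lam y)%:~R : 'Z_N) \is a GRing.unit.
  by apply: (small_unit k0 NE _ (B_lam x y)); rewrite subr_eq0 (inj_eq gl.1).
rewrite -(mulr0 (lam x - lam y)%:~R) => /(mulrI u)/eqP; rewrite subr_eq0 => /eqP Eb.
by move: e1; rewrite Eb => /addIr ->.
Qed.

Lemma lift_edge j j' h x y x' y' : j != j' -> x != y -> in_edge h x -> in_edge h y ->
  lift j x = lift j' x' -> lift j y = lift j' y' -> False.
Proof.
move=> jj xy hx hy Lx Ly; have [E|nE] := eqVneq j.1 j'.1.
  by case/eqP: jj; apply: (lift_two E xy Lx Ly).
by case: dD => _ + _; apply; [exact: nE|exact: xy|exact: hx|exact: hy|exact: lift_base Lx|exact: lift_base Ly].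
Qed.

Lemma edge_pigeonhole (x y z : role s) : exists h,
  [\/ in_edge h x && in_edge h y, in_edge h x && in_edge h z | in_edge h y && in_edge h z].
Proof.
pose c (t : role s) := if t is inl (_, h) then h else true.
have cP h t : c t = h -> in_edge h t by case: t => [[u h']|b'] //= ->.
have [E|n] := eqVneq (c x) (c y); first by exists (c x); apply: Or31; rewrite !cP.
have [E|n'] := eqVneq (c x) (c z); first by exists (c x); apply: Or32; rewrite !cP.
exists (c y); apply: Or33; rewrite !cP //.
by move: n n'; case: (c x) (c y) (c z) => [] [] [].
Qed.

(** * Lifts over distinct base diamonds *)

Section DistinctTypes.
Variables (T : finType) (key_of : T -> key) (R : T -> {set role s}).
Hypothesis type_inj : injective (fun t => (key_of t).1).
Hypothesis R34 : forall t, (3 <= #|R t| <= 4)%N.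
Hypothesis T5 : (#|T| <= 5)%N.
Hypothesis shared : forall t x, x \in R t ->
  exists t' x', [/\ t' != t, x' \in R t' & lift (key_of t) x = lift (key_of t') x'].

Let G := [set g : T * role s | g.2 \in R g.1].
Let P (g : T * role s) := lift (key_of g.1) g.2.
Let Q p := [set g in G | P g == p].
Let lead g := [pick g' in Q (P g)] == Some g.
(* [tt * qq = 12] keeps the scaling [qq * rel] integral, as a vertex lies in at most five members. *)
Let tt g : int := if lead g then - (#|Q (P g)|.-1)%:Z else 1.
Let qq g : int := if lead g then - (12 %/ #|Q (P g)|.-1)%:Z else 12.

Lemma class_size g : g \in G -> (2 <= #|Q (P g)| <= 5)%N.
Proof.
move=> gG; apply/andP; split.
  have := gG; rewrite inE => /shared[t' [x' [ne x'R E]]].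
  apply/card_gt1P; exists g, (t', x'); split.
  - by rewrite inE gG /=.
  - by rewrite !inE x'R; apply/eqP; rewrite /P E.
  - by apply: contra ne => /eqP->.
apply: leq_trans T5; rewrite -(card_in_imset (f := fst)) ?max_card //.
move=> [t x] [t' x']; rewrite !inE => /andP[_ /eqP Ex] /andP[_ /eqP Ey] /= E; subst t'.
by move: Ey; rewrite -Ex => /lift_inj /= ->.
Qed.

Lemma tq12 g : g \in G -> tt g * qq g = 12.
Proof.
move=> /class_size; rewrite /tt /qq; case: (lead g) => //.
move: #|_| => d d25; have : (d = 2 \/ d = 3 \/ d = 4 \/ d = 5)%N by lia.
by move=> [|[|[]]] -> /=; rewrite mulrNN.
Qed.

Lemma lead_sum g : g \in G -> \sum_(g' in Q (P g)) tt g' = 0.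
Proof.
move=> gG; have gQ : g \in Q (P g) by rewrite inE gG eqxx.
case E : [pick g' in Q (P g)] => [l|]; last by move: E; case: pickP => // /(_ g); rewrite /= gQ.
have lQ : l \in Q (P g) by move: E; case: pickP => // l' l'Q [<-].
have PQ g' : g' \in Q (P g) -> P g' = P g by rewrite inE => /andP[_ /eqP].
rewrite (bigD1 l) //= (eq_bigr (fun=> 1)); last first.
  move=> g' /andP[/PQ Pg' ne]; rewrite /tt /lead Pg' E; case: eqP => // -[E'].
  by rewrite E' eqxx in ne.
rewrite /tt /lead (PQ l lQ) E eqxx sumr_const.
rewrite [X in _ *+ X](_ : _ = #|Q (P g)|.-1); first by rewrite natz addNr.
rewrite (cardsD1 l (Q (P g))) lQ add1n /=; apply: eq_card => g'; rewrite [in RHS]inE andbC.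
by rewrite [in RHS]inE.
Qed.

(* In the coordinate with scalings [qq * rel] the combination of the coincidences with coefficients [tt], which
   sum to zero at every vertex, annihilates all linear parts and leaves only the translation put at [g0]. *)
Lemma distinct_types (t0 : T) : False.
Proof.
have [x0 x0R] : exists x0, x0 \in R t0.
  by apply/card_gt0P; have := R34 t0; lia.
(* Scalings are prescribed per base diamond, which by [type_inj] belongs to at most one member. *)
pose f i x : int := if [pick t | (key_of t).1 == i] is Some t then
  (if x \in R t then qq (t, x) * rel (R t) x else 1) else 1.
have fE t x : x \in R t -> f (key_of t).1 x = qq (t, x) * rel (R t) x.
  rewrite /f; case: pickP => [t' /eqP/type_inj ->|/(_ t)]; last by rewrite eqxx.
  by move=> ->.
have [|c [sc cc]] := @twist_exists f (fun i x => (i == (key_of t0).1) && (x == x0)).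
  move=> i x; rewrite /f; case: pickP => [t _|_]; last by split=> //; lia.
  case: ifP => xR; last by split=> //; lia.
  have gG : (t, x) \in G by rewrite inE.
  have := tq12 gG; have [/(_ _ xR) r0 _ _] := relP (R34 t).
  have := class_size gG; have := B_rel (R t) x.
  rewrite /tt /qq; case: (lead _); last by move=> b _ _; rewrite mulf_neq0.
  move: #|_| (rel (R t) x) r0 => d r r0 b d25.
  have : (d = 2 \/ d = 3 \/ d = 4 \/ d = 5)%N by lia.
  by move=> [|[|[]]] -> _ /=; rewrite mulf_neq0 //; split=> //; move: b; rewrite !abszM /=; lia.
pose g0 := (t0, x0); have g0G : g0 \in G by rewrite inE.
have Pc g : g \in G -> (tt g)%:~R * (P g).2 c =
    (12 * rel (R g.1) g.2)%:~R * dot g.2 ((key_of g.1).2 c) + (if g == g0 then (tt g)%:~R else 0) :> 'Z_N.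
  move=> gG; have gR : g.2 \in R g.1 by move: gG; rewrite inE.
  rewrite /P /lift /= ffunE sc (fE _ _ gR) -surjective_pairing cc (inj_eq type_inj).
  rewrite mulrDr mulrA -rmorphM mulrA tq12 //; congr (_ + _).
  by rewrite -[g == g0]/((g.1 == t0) && (g.2 == x0)); case: (_ && _); rewrite ?mulr1 ?mulr0.
pose S : 'Z_N := \sum_(g in G) (tt g)%:~R * (P g).2 c.
have S0 : S = 0.
  rewrite /S (partition_big P predT) //= big1 // => p _.
  have [/existsP[g /andP[gG /eqP Pg]]|no] := boolP [exists g, (g \in G) && (P g == p)]; last first.
    by rewrite big_pred0 // => g; apply/negP => gp; case/negP: no; apply/existsP; exists g.
  rewrite (eq_bigr (fun g => (tt g)%:~R * p.2 c)); last by move=> g' /andP[_ /eqP <-].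
  rewrite -mulr_suml -rmorph_sum /= (_ : \sum_(i | _) tt i = 0) ?mul0r //.
  by rewrite -[RHS](lead_sum gG); apply: eq_bigl => g'; rewrite [in RHS]inE Pg.
have ST : S = (tt g0)%:~R.
  rewrite /S (eq_bigr _ Pc) big_split /= -big_mkcondr /= [X in _ + X](big_pred1 g0); last first.
    by move=> g /=; apply/andP/eqP => [[_ /eqP]|->]; rewrite ?eqxx //.
  rewrite -[RHS]add0r; congr (_ + _).
  transitivity (\sum_t \sum_(x in R t) (12 * rel (R t) x)%:~R * dot x ((key_of t).2 c) : 'Z_N).
    by rewrite pair_big_dep; apply: eq_bigl => g; rewrite inE.
  rewrite big1 // => t _.
  have [_ r0 r1] := relP (R34 t).
  transitivity ((12 * \sum_(x in R t) rel (R t) x)%:~R * ((key_of t).2 c).1 +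
     (12 * \sum_(x in R t) rel (R t) x * lam x)%:~R * ((key_of t).2 c).2 : 'Z_N).
    rewrite !mulr_sumr !rmorph_sum !mulr_suml /= -big_split; apply: eq_bigr => x _.
    by rewrite /dot !rmorphM /=; ring.
  by rewrite r0 r1 !mulr0 !mul0r addr0.
have : ((tt g0)%:~R : 'Z_N) \is a GRing.unit.
  apply: (small_unit k0 NE); have := class_size g0G; rewrite /tt; case: (lead _); lia.
by rewrite -ST S0 unitr0.
Qed.

End DistinctTypes.

(** * Families of lifted edges with at most one full diamond *)

Section Items.
Variables (T : finType) (kf : T -> key) (U : T -> {set role s}) (t0 : T).
Hypothesis kf_inj : injective kf.
Hypothesis edgeU : forall t, t != t0 -> exists h, forall x, x \in U t -> in_edge h x.

Definition item t := [set lift (kf t) x | x in U t].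

Lemma item_linear t t' : t != t' -> (#|item t :&: item t'| <= 1)%N.
Proof.
have main u v : u != v -> u != t0 -> (#|item u :&: item v| <= 1)%N.
  move=> uv /edgeU[h hU]; apply/card_le1_eqP => p p'; rewrite !inE.
  move=> /andP[/imsetP[x xU ->] /imsetP[x' _ Ex]] /andP[/imsetP[y yU ->] /imsetP[y' _ Ey]].
  have [->//|xy] := eqVneq x y; case: (@lift_edge (kf u) (kf v) h x y x' y') => //; try exact: hU.
  by rewrite (inj_eq kf_inj).
move=> ne; have [E|n0] := eqVneq t t0; last exact: main.
by rewrite setIC main // -?E eq_sym.
Qed.

(** The default [inr true] occurs only when no vertex is common; otherwise the lift of this role is
    the common vertex, unique for distinct items. *)
Definition meet j k : role s := odflt (inr true) [pick x in U j | lift (kf j) x \in item k].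

Lemma meetP j k : item j :&: item k != set0 ->
  meet j k \in U j /\ lift (kf j) (meet j k) \in item k.
Proof.
move=> /set0Pn[p]; rewrite inE => /andP[/imsetP[x xU ->] px].
by rewrite /meet; case: pickP => [y /andP[]|/(_ x)] //=; rewrite xU px.
Qed.

Lemma meet_item j k : item j :&: item k != set0 -> lift (kf j) (meet j k) \in item j.
Proof. by move=> /meetP[mU _]; apply: imset_f. Qed.

Lemma meetC j k : j != k -> item j :&: item k != set0 ->
  lift (kf j) (meet j k) = lift (kf k) (meet k j).
Proof.
move=> jk m; have m' : item k :&: item j != set0 by rewrite setIC.
have [_ h1] := meetP m; have [_ h2] := meetP m'.
have e1 := meet_item m; have e2 := meet_item m'.
by apply: (card_le1_eqP (item_linear jk)); rewrite inE ?h1 ?h2 ?e1 ?e2.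
Qed.

Lemma meet_neq j k l : item j :&: item k != set0 -> item j :&: item l != set0 ->
  (forall p, p \in item j -> p \in item k -> p \in item l -> False) -> meet j k != meet j l.
Proof.
move=> mk ml no; apply/eqP => E; have [_ pk] := meetP mk; have [_] := meetP ml.
by rewrite -E => pl; apply: no pk pl; exact: meet_item.
Qed.

Lemma no_common_edge j k l h : item l :&: item j != set0 -> item l :&: item k != set0 ->
  l != j -> l != k -> (kf j).1 = (kf k).1 -> (kf l).1 != (kf j).1 ->
  meet l j != meet l k -> in_edge h (meet l j) -> in_edge h (meet l k) -> False.
Proof.
move=> mj mk lj lk E nE ne hj hk; have := meetC lj mj; have := meetC lk mk.
move=> /lift_base; rewrite -E => Ek /lift_base Ej.
by case: dD => _ + _; apply; [exact: nE|exact: ne|exact: hj|exact: hk|exact: Ej|exact: Ek].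
Qed.

(** An overlap of 6 forces all six pairs of items to meet, without triple points. If the base
    diamonds are distinct, [distinct_types] applies to the three meeting roles of each item; if two
    of them agree, all four do, and [rigid3] identifies two lifts. *)
Lemma no_four (J : {set T}) : #|J| = 4%N -> (#|cov item J| + 6 <= \sum_(t in J) #|item t|)%N -> False.
Proof.
move=> J4 big.
have three j : j \in J -> (3 <= #|item j :&: cov item (J :\ j)|)%N.
  by move=> jJ; have := others_ge item_linear jJ big; rewrite J4 (_ : 'C(3, 2) = 3) //; lia.
have mt j k : j \in J -> k \in J -> j != k -> item j :&: item k != set0.
  move=> jJ kJ jk; have [h _] := three_points4 item_linear J4 jJ (three j jJ).
  by apply: h; rewrite // eq_sym.
have nt j k l : j \in J -> k \in J -> l \in J -> uniq [:: j; k; l] -> meet j k != meet j l.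
  move=> jJ kJ lJ u; have [_ h] := three_points4 item_linear J4 jJ (three j jJ).
  have /and3P[] := u; rewrite !inE negb_or => /andP[jk jl] kl _.
  by apply: meet_neq; [exact: mt|exact: mt|move=> p; exact: h].
have same j k l : j \in J -> k \in J -> l \in J -> j != k -> (kf j).1 = (kf k).1 -> (kf l).1 = (kf j).1.
  move=> jJ kJ lJ jk E; apply/eqP; apply: contraT => nE.
  have ne m m' : (kf m).1 != (kf m').1 -> m != m' by apply: contra => /eqP->.
  have pair m a b h : m \in J -> a \in J -> b \in J -> a != b -> (kf a).1 = (kf j).1 -> (kf b).1 = (kf j).1 ->
      (kf m).1 != (kf j).1 -> in_edge h (meet m a) -> in_edge h (meet m b) -> False.
    move=> mJ aJ bJ ab Ea Eb nm ha hb.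
    have [ma mb] : m != a /\ m != b by split; apply: ne; rewrite ?Ea ?Eb.
    apply: (@no_common_edge a b m h); rewrite ?mt ?Ea ?Eb //.
    by apply: nt; rewrite //= !inE negb_or ma mb ab.
  have [E0|n0] := eqVneq l t0; last first.
    have [h hU] := edgeU n0; exfalso; apply: (pair l j k h) => //.
      by apply: hU; have [] := meetP (mt _ _ lJ jJ (ne _ _ nE)).
    by apply: hU; have [] := meetP (mt _ _ lJ kJ _); rewrite // ne // -E.
  (* Here [l] may be a full diamond. The fourth item [m] is within an edge, hence over the base of
     [j], and two of the three roles at which [l] meets the others share an edge. *)
  have [m mJ /and3P[mj mk ml]] : exists2 m, m \in J & [&& m != j, m != k & m != l].
    have : (0 < #|J :\ j :\ k :\ l|)%N.
      rewrite -subn_gt0 subn0; have := cardsD1 j J; have := cardsD1 k (J :\ j); have := cardsD1 l (J :\ j :\ k).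
      rewrite J4; do 3!case: (_ \in _); lia.
    move=> /card_gt0P[m]; rewrite !inE => /and4P[ml mk mj mJ].
    by exists m => //; rewrite mj mk ml.
  have Em : (kf m).1 = (kf j).1.
    apply/eqP; apply: contraT => nm; have [|h hU] := @edgeU m; first by rewrite -E0.
    exfalso; apply: (pair m j k h) => //; apply: hU.
      by have [] := meetP (mt _ _ mJ jJ mj).
    by have [] := meetP (mt _ _ mJ kJ mk).
  have [h [] /andP[h1 h2]] := edge_pigeonhole (meet l j) (meet l k) (meet l m); exfalso.
  - exact: (pair l j k h).
  - by apply: (pair l j m h) => //; rewrite eq_sym.
  - by apply: (pair l k m h) => //; rewrite eq_sym.
have [/existsP[j /existsP[k /and4P[jJ kJ jk /eqP E]]]|no] :=
  boolP [exists j, exists k, [&& j \in J, k \in J, j != k & (kf j).1 == (kf k).1]]; last first.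
  pose R (t : {t | t \in J}) := [set meet (val t) k | k in J :\ val t].
  have [a aJ] : exists a, a \in J by apply/card_gt0P; rewrite J4.
  apply: (@distinct_types {t | t \in J} (fun t => kf (val t)) R) (exist _ a aJ).
  - move=> [t tJ] [u uJ] /= E; apply/val_inj/eqP => /=; apply: contraT => tu.
    by case/negP: no; apply/existsP; exists t; apply/existsP; exists u; rewrite tJ uJ tu E eqxx.
  - move=> [t tJ]; rewrite /R /= card_in_imset.
      by have := cardsD1 t J; rewrite J4 tJ; lia.
    move=> k l; rewrite !inE => /andP[kt kJ] /andP[lt lJ] E; apply/eqP; apply: contraT => kl.
    by have := @nt t k l tJ kJ lJ; rewrite /= !inE negb_or E eqxx !(eq_sym t) kt lt kl => /(_ isT).
  - by rewrite card_sub (eq_card (B := J)) ?J4.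
  - move=> [t tJ] x /imsetP[k]; rewrite !inE => /andP[kt kJ] ->.
    exists (exist _ k kJ), (meet k t); split=> //=.
      by apply/imsetP; exists t => //=; rewrite !inE eq_sym kt tJ.
    by apply: meetC; [rewrite eq_sym|apply: mt; rewrite // eq_sym].
have sm t u : t \in J -> u \in J -> (kf t).1 = (kf u).1.
  by move=> tJ uJ; rewrite (same j k t) // (same j k u).
have [a [b [c [d [JE u]]]]] : exists a b c d, enum J = [:: a; b; c; d] /\ uniq [:: a; b; c; d].
  have := enum_uniq (mem J); have : size (enum J) = 4 by rewrite -cardE.
  by case: (enum J) => [|a [|b [|c [|d [|]]]]] // _ u; exists a, b, c, d.
have [aJ bJ cJ dJ] : [/\ a \in J, b \in J, c \in J & d \in J].
  by split; rewrite -mem_enum JE !inE eqxx ?orbT.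
have /and5P[] := u; rewrite !inE !negb_or => /and3P[ab ac ad] /andP[bc bd] cd _ _.
have eq2 t v : t \in J -> v \in J -> t != v -> meet t v = meet v t /\
    forall e, dot (meet t v) ((kf t).2 e) = dot (meet t v) ((kf v).2 e).
  by move=> tJ vJ tv; apply: lift_same (sm _ _ tJ vJ) (meetC tv (mt _ _ tJ vJ tv)).
suff /kf_inj E' : kf a = kf b by rewrite E' eqxx in ab.
suff Ez : (kf a).2 = (kf b).2.
  by move: (sm a b aJ bJ) Ez; case: (kf a) (kf b) => [? ?] [? ?] /= -> ->.
apply/ffunP => e.
have N3 x y z : x \in J -> y \in J -> z \in J -> x != y -> x != z -> y != z -> meet x y != meet x z.
  by move=> xJ yJ zJ xy xz yz; apply: nt; rewrite //= !inE negb_or xy xz yz.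
have [db da dc] : [/\ d != b, d != a & d != c] by split; rewrite eq_sym.
have [ca ba cb] : [/\ c != a, b != a & c != b] by split; rewrite eq_sym.
have C2 t v : t \in J -> v \in J -> t != v -> meet t v = meet v t by move=> *; apply: (eq2 _ _ _ _ _).1.
(* The hub is [a] and the rim is [b], [c], [d]; over one base diamond every coincidence is between
   equal roles. *)
apply: (@rigid3 _ lam _ (meet a b) (meet a c) (meet a d) (meet b c) (meet c d) (meet d b)
  _ _ ((kf c).2 e) ((kf d).2 e)).
- apply: (small_unit k0 NE) => //; apply: (wheel3_neq0 gl).
  + exact: N3. + exact: N3. + exact: N3.
  + rewrite (C2 b c) //; exact: N3.
  + rewrite (C2 c d) //; exact: N3.
  + rewrite (C2 d b) //; exact: N3.
  + rewrite (C2 a b) //; exact: N3.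
  + rewrite (C2 a c) // (C2 b c) //; exact: N3.
  + rewrite (C2 a c) //; exact: N3.
  + rewrite (C2 a d) // (C2 c d) //; exact: N3.
  + rewrite (C2 a d) //; exact: N3.
  + rewrite (C2 a b) // (C2 d b) //; exact: N3.
- by have [_] := eq2 a b aJ bJ ab; apply.
- by have [_] := eq2 a c aJ cJ ac; apply.
- by have [_] := eq2 a d aJ dJ ad; apply.
- by have [_] := eq2 b c bJ cJ bc; apply.
- by have [_] := eq2 c d cJ dJ cd; apply.
- by have [_] := eq2 d b dJ bJ db; apply.
Qed.

Local Ltac distinct := by rewrite /= ?inE ?negb_or; do ?[apply/andP; split]; rewrite // eq_sym.

(** * Five edges in five different lifted diamonds *)

Section Five.
Hypothesis T5 : #|T| = 5%N.
Hypothesis edge_all : forall t, exists h, forall x, x \in U t -> in_edge h x.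
Hypothesis three : forall t, (3 <= #|item t :&: cov item (setT :\ t)|)%N.

Let apart2' := fun j => apart2 item_linear T5 (three j).
Let apart_concurrent' := fun j => apart_concurrent item_linear T5 (three j).
Let concurrent2' := fun j => concurrent2 item_linear T5 (three j).

Lemma meet_uniq j k l : uniq [:: j; k; l] -> ~ apart item j k -> ~ apart item j l ->
  ~ concurrent item j k l -> meet j k != meet j l.
Proof.
move=> u /eqP mk /eqP ml no; apply: meet_neq => // p pj pk pl; apply: no; by exists p.
Qed.

(** Without a defect [l] would meet [j] and [k] in two different vertices of one edge, and that edge
    would share two vertices with their base diamond. *)
Lemma same_type_defect j k l : uniq [:: j; k; l] -> (kf j).1 = (kf k).1 -> (kf l).1 <> (kf j).1 ->
  [\/ apart item l j, apart item l k | concurrent item l j k].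
Proof.
move=> u E nE; have [al|nlj] := eqVneq (item l :&: item j) set0; first by apply: Or31.
have [al|nlk] := eqVneq (item l :&: item k) set0; first by apply: Or32.
apply: Or33; have [x xP|no] := pickP (fun x => [&& x \in item l, x \in item j & x \in item k]).
  by exists x; apply/and3P.
have [h hU] := edge_all l; have /and3P[] := u; rewrite !inE negb_or => /andP[jk jl] kl _.
have [lj lk] : l != j /\ l != k by rewrite !(eq_sym l).
exfalso; apply: (@no_common_edge j k l h) => //; first exact/eqP.
- apply: meet_neq => // p pl pj pk; have := no p; by rewrite pl pj pk.
- by apply: hU; have [] := meetP nlj.
- by apply: hU; have [] := meetP nlk.
Qed.

Lemma wheel_impossible o w1 w2 w3 w4 : uniq [:: o; w1; w2; w3; w4] -> (forall t, (kf t).1 = (kf o).1) ->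
  ~ apart item o w1 -> ~ apart item o w2 -> ~ apart item o w3 -> ~ apart item o w4 ->
  ~ apart item w1 w2 -> ~ apart item w2 w3 -> ~ apart item w3 w4 -> ~ apart item w4 w1 ->
  ~ concurrent item o w1 w2 -> ~ concurrent item o w2 w3 -> ~ concurrent item o w3 w4 ->
  ~ concurrent item o w4 w1 -> ~ concurrent item w1 w2 w4 -> ~ concurrent item w2 w1 w3 ->
  ~ concurrent item w3 w2 w4 -> ~ concurrent item w4 w3 w1 -> False.
Proof.
move=> u st ao1 ao2 ao3 ao4 a12 a23 a34 a41 c12 c23 c34 c41 r1 r2 r3 r4.
move: u; rewrite /= !inE !negb_or => /and5P[/and4P[o1 o2 o3 o4] /and3P[w12 w13 w14] /andP[w23 w24] w34 _].
have eq2 t v : t != v -> ~ apart item t v -> meet t v = meet v t /\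
    forall e, dot (meet t v) ((kf t).2 e) = dot (meet t v) ((kf v).2 e).
  by move=> tv /eqP m; apply: lift_same (meetC tv m); rewrite !st.
have sA t v : ~ apart item t v -> ~ apart item v t by move=> n /apartC.
have sC x y z : ~ concurrent item x y z -> ~ concurrent item x z y by move=> n /concurrentC.
have sB x y z : ~ concurrent item x y z -> ~ concurrent item y x z by move=> n /concurrentA.
have NN x y z : x != y -> x != z -> y != z -> ~ apart item x y -> ~ apart item x z ->
    ~ concurrent item x y z -> meet x y != meet x z.
  by move=> xy xz yz; apply: meet_uniq; rewrite /= !inE negb_or xy xz yz.
have CC t v : t != v -> ~ apart item t v -> meet t v = meet v t by move=> tv /(eq2 _ _ tv)[].
have [w21 w31 w41] : [/\ w2 != w1, w3 != w1 & w4 != w1] by split; rewrite eq_sym.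
have [w32 w42 w43] : [/\ w3 != w2, w4 != w2 & w4 != w3] by split; rewrite eq_sym.
have [o1' o2' o3' o4'] : [/\ w1 != o, w2 != o, w3 != o & w4 != o] by split; rewrite eq_sym.
suff /kf_inj E' : kf o = kf w1 by rewrite E' eqxx in o1.
suff Ez : (kf o).2 = (kf w1).2.
  by move: (st w1) Ez; case: (kf o) (kf w1) => [? ?] [? ?] /= -> ->.
apply/ffunP => e.
apply: (@rigid4 _ lam _ (meet o w1) (meet o w2) (meet o w3) (meet o w4)
  (meet w1 w2) (meet w2 w3) (meet w3 w4) (meet w4 w1)
  _ _ ((kf w2).2 e) ((kf w3).2 e) ((kf w4).2 e)).
- apply: (small_unit k0 NE) => //; apply: (wheel4_neq0 gl).
  + by apply: NN. + by apply: NN. + by apply: NN. + by apply: NN.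
  + rewrite (CC w1 w2) //; apply: NN => //; auto 7 using sA, sB, sC.
  + rewrite (CC w2 w3) //; apply: NN => //; auto 7 using sA, sB, sC.
  + rewrite (CC w3 w4) //; apply: NN => //; auto 7 using sA, sB, sC.
  + rewrite (CC w4 w1) //; apply: NN => //; auto 7 using sA, sB, sC.
  + rewrite (CC o w1) //; apply: NN => //; auto 7 using sA, sB, sC.
  + rewrite (CC o w2) // (CC w1 w2) //; apply: NN => //; auto 7 using sA, sB, sC.
  + rewrite (CC o w2) //; apply: NN => //; auto 7 using sA, sB, sC.
  + rewrite (CC o w3) // (CC w2 w3) //; apply: NN => //; auto 7 using sA, sB, sC.
  + rewrite (CC o w3) //; apply: NN => //; auto 7 using sA, sB, sC.
  + rewrite (CC o w4) // (CC w3 w4) //; apply: NN => //; auto 7 using sA, sB, sC.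
  + rewrite (CC o w4) //; apply: NN => //; auto 7 using sA, sB, sC.
  + rewrite (CC o w1) // (CC w4 w1) //; apply: NN => //; auto 7 using sA, sB, sC.
- by have [_] := eq2 o w1 o1 ao1; apply.
- by have [_] := eq2 o w2 o2 ao2; apply.
- by have [_] := eq2 o w3 o3 ao3; apply.
- by have [_] := eq2 o w4 o4 ao4; apply.
- by have [_] := eq2 w1 w2 w12 a12; apply.
- by have [_] := eq2 w2 w3 w23 a23; apply.
- by have [_] := eq2 w3 w4 w34 a34; apply.
- by have [_] := eq2 w4 w1 w41 a41; apply.
Qed.

(** An item tolerates a single defect: one disjoint partner or one triple point. An item over
    another base has a defect with every two items over the base of [j]. Three such items would
    burden it twice; if there are only [j] and [k], the three foreign items burden these two beyond
    one defect each. *)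
Lemma all_same_type j k : j != k -> (kf j).1 = (kf k).1 -> forall l, (kf l).1 = (kf j).1.
Proof.
move=> jk E l; have [//|nE] := eqVneq (kf l).1 (kf j).1; exfalso.
have ne m m' : (kf m).1 <> (kf m').1 -> m != m' by move=> n; apply/eqP => E'; apply: n; rewrite E'.
move/eqP: nE => nE.
have [lj lk] : l != j /\ l != k by split; apply: ne; rewrite -?E.
have u3 : uniq [:: j; k; l] by rewrite /= !inE negb_or jk !(eq_sym _ l) lj lk.
have [t' []] := extend_uniq u3; rewrite T5.
case: t' => [|u [|v [|? ?]]] //= /[swap] _; rewrite !inE !negb_or andbT.
move=> /and4P[/and4P[_ jl ju jv] /and3P[kl ku kv] /andP[lu lv] uv].
have [uj uk ul] : [/\ u != j, u != k & u != l] by split; rewrite eq_sym.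
have [vj vk vl] : [/\ v != j, v != k & v != l] by split; rewrite eq_sym.
have [kj vu] : k != j /\ v != u by split; rewrite eq_sym.
have df x m m' : m != m' -> x != m -> x != m' -> (kf m).1 = (kf j).1 -> (kf m').1 = (kf j).1 ->
    (kf x).1 <> (kf j).1 -> [\/ apart item x m, apart item x m' | concurrent item x m m'].
  move=> mm xm xm' Em Em' nx; apply: same_type_defect; rewrite ?Em ?Em' //=.
  by rewrite !inE negb_or mm !(eq_sym _ x) xm xm'.
have A2 x y z : x != y -> x != z -> y != z -> apart item x y -> apart item x z -> False.
  by move=> xy xz yz; apply: apart2'; rewrite /= !inE negb_or xy xz yz.
have AC x y z w : x != y -> x != z -> x != w -> y != z -> y != w -> z != w ->
    apart item x y -> concurrent item x z w -> False.
  by move=> *; apply: (apart_concurrent' (j := x) (k := y) (l := z) (n := w)); rewrite //= !inE !negb_or; do ?[apply/andP; split].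
have AT x y z : apart item x y -> concurrent item x y z -> False.
  by rewrite /apart => /setP E0 [p [px py _]]; have := E0 p; rewrite !inE px py.
have TT x y z w : uniq [:: x; y; z; w] -> concurrent item x y z -> concurrent item x y w -> False.
  rewrite /= !inE !negb_or !andbT => /and3P[/and3P[xy xz xw] /andP[yz yw] zw] c c'.
  by apply: (concurrent2' (j := x) (k := y) (l := z) (k' := y) (l' := w)); rewrite //= ?inE ?negb_or ?xy ?xz ?xw ?yz ?yw ?zw // eq_sym.
have other x : x != j -> x != k -> x != l -> (kf x).1 = (kf j).1 -> False.
  move=> xj xk xl Ex.
  have [lx kx jx] : [/\ l != x, k != x & j != x] by split; rewrite eq_sym.
  have d1 := df l j k jk lj lk erefl (esym E) nE.
  have d2 := df l j x jx lj lx erefl Ex nE.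
  have d3 := df l k x kx lk lx (esym E) Ex nE.
  case: d1 => d1.
  - case: d3 => d3; [exact: (A2 l j k)|exact: (A2 l j x)|exact: (AC l j k x)].
  - case: d2 => d2; [exact: (A2 l j k)|exact: (A2 l k x)|exact: (AC l k j x)].
  - case: d2 => d2; [exact: (AT l j k)|by apply: (AC l x j k)|apply: (TT l j k x) => //].
    by rewrite /= !inE !negb_or lj lk lx jk jx kx.
have Eu : (kf u).1 <> (kf j).1 by move=> Eu; apply: (other u).
have Ev : (kf v).1 <> (kf j).1 by move=> Ev; apply: (other v).
have d x : x != j -> x != k -> (kf x).1 <> (kf j).1 ->
    [\/ apart item x j, apart item x k | concurrent item x j k].
  by move=> xj xk nx; apply: df.
have two x y : x != j -> x != k -> y != j -> y != k -> x != y -> apart item x j ->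
   [\/ apart item y j, apart item y k | concurrent item y j k] -> apart item y k.
  move=> xj xk yj yk xy ax [ay|//|cy]; exfalso.
    by apply: (A2 j x y); rewrite ?(eq_sym j) //; exact: apartC.
  by apply: (AC j x y k); rewrite // 1?(eq_sym j) //; [exact: apartC|exact: concurrentA].
have two' x y : x != j -> x != k -> y != j -> y != k -> x != y -> apart item x k ->
   [\/ apart item y j, apart item y k | concurrent item y j k] -> apart item y j.
  move=> xj xk yj yk xy ax [//|ay|cy]; exfalso.
    by apply: (A2 k x y); rewrite ?(eq_sym k) //; exact: apartC.
  by apply: (AC k x y j); rewrite // 1?(eq_sym k) //; [exact: apartC|exact/concurrentA/concurrentC].
have dl := d l lj lk nE; have du := d u uj uk Eu; have dv := d v vj vk Ev.
have bad x y z : uniq [:: x; y; z] -> x != j -> x != k -> y != j -> y != k -> z != j -> z != k ->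
    apart item x j -> apart item y k -> [\/ apart item z j, apart item z k | concurrent item z j k] -> False.
  rewrite /= !inE negb_or andbT => /andP[/andP[xy xz] yz] xj xk yj yk zj zk ax ay dz.
  have az := two x z xj xk zj zk xz ax dz.
  by apply: (A2 k y z); rewrite ?(eq_sym k) //; exact: apartC.
case: dl => dl.
- have au := two l u lj lk uj uk lu dl du.
  by apply: (bad l u v) => //=; rewrite !inE negb_or lu lv uv.
- have au := two' l u lj lk uj uk lu dl du.
  by apply: (bad u l v) => //=; rewrite !inE negb_or ul uv lv.
- case: du => du.
  + by apply: (AC j u l k); rewrite // 1?eq_sym //; [exact: apartC|exact: concurrentA].
  + by apply: (AC k u l j); rewrite // 1?eq_sym //; [exact: apartC|exact/concurrentA/concurrentC].
  + apply: (TT j k l u); rewrite /= ?inE ?negb_or ?jk ?jl ?ju ?kl ?ku ?lu //.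
      exact/concurrentC/concurrentA.
    exact/concurrentC/concurrentA.
Qed.

(** A wheel avoiding the defects is chosen: two items of a triple point, or of a disjoint pair, are
    placed opposite on the rim, where no coincidence is required. For a triple point its third item
    is the hub; for a disjoint pair the hub meets both other rim items. *)
Lemma same_type_impossible o : (forall t, (kf t).1 = (kf o).1) -> False.
Proof.
move=> st.
have st' x t : (kf t).1 = (kf x).1 by rewrite !st.
have A2 x y z : uniq [:: x; y; z] -> apart item x y -> apart item x z -> False by exact: apart2'.
have AC x y z w : uniq [:: x; y; z; w] -> apart item x y -> concurrent item x z w -> False.
  by exact: apart_concurrent'.
have AT x y z : apart item x y -> concurrent item x y z -> False.
  by rewrite /apart => /setP E0 [p [px py _]]; have := E0 p; rewrite !inE px py.
have CC x k l k' l' := @concurrent2' x k l k' l'.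
have [/existsP[a /existsP[b /existsP[c /andP[u3 cc]]]]|no] :=
  boolP [exists a, exists b, exists c, uniq [:: a; b; c] && (item a :&: item b :&: item c != set0)].
  have {}cc : concurrent item a b c by case/set0Pn: cc => p; rewrite !inE => /andP[/andP[pa pb] pc]; exists p.
  have [t' []] := extend_uniq u3; rewrite T5.
  case: t' => [|d [|e [|? ?]]] //= u _.
  have cab : concurrent item b a c by exact: concurrentA.
  have ccb : concurrent item c a b by exact/concurrentA/concurrentC.
  move: u; rewrite /= !inE !negb_or !andbT => /and4P[/and4P[ab ac ad ae] /and3P[bc bd be] /andP[cd ce] de].
  have [ba ca da ea] : [/\ b != a, c != a, d != a & e != a] by split; rewrite eq_sym.
  have [cb db eb] : [/\ c != b, d != b & e != b] by split; rewrite eq_sym.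
  have [dc ec ed] : [/\ d != c, e != c & e != d] by split; rewrite eq_sym.
  have cac := concurrentC cc; have cba := concurrentC cab; have ccba := concurrentC ccb.
  have AC' x y z w : uniq [:: x; y; z; w] -> apart item y x -> concurrent item x z w -> False.
    by move=> u /apartC; exact: AC.
  apply: (@wheel_impossible a b d c e _ (st' a)) => [|h|h|h|h|h|h|h|h|h|h|h|h|h|h|h|h].
  - distinct.
  - exact: (AT a b c).
  - by apply: (AC a d b c) => //; distinct.
  - exact: (AT a c b).
  - by apply: (AC a e b c) => //; distinct.
  - by apply: (AC b d a c) => //; distinct.
  - by apply: (AC' c d a b) => //; distinct.
  - by apply: (AC c e a b) => //; distinct.
  - by apply: (AC' b e a c) => //; distinct.
  - by apply: (CC a b c b d) => //; distinct.
  - by apply: (CC a c b c d) => //; first [distinct|exact: concurrentC].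
  - by apply: (CC a c b c e) => //; distinct.
  - by apply: (CC a b c b e) => //; first [distinct|exact: concurrentC].
  - by apply: (CC b a c d e) => //; distinct.
  - by apply: (CC b c a c d) => //; first [distinct|exact/concurrentC/concurrentA].
  - by apply: (CC c a b d e) => //; distinct.
  - by apply: (CC c b a b e) => //; first [distinct|exact/concurrentC/concurrentA].
have nT x y z : uniq [:: x; y; z] -> ~ concurrent item x y z.
  move=> u3 [p [px py pz]]; case/negP: no; apply/existsP; exists x; apply/existsP; exists y; apply/existsP; exists z.
  by rewrite u3 /=; apply/set0Pn; exists p; rewrite !inE px py.
have A2' x y z : uniq [:: x; y; z] -> apart item x y -> ~ apart item x z by move=> u h h'; exact: (A2 x y z).
have sA x y : ~ apart item x y -> ~ apart item y x by move=> n /apartC.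
have fin a b h x y : uniq [:: a; b; h; x; y] -> apart item a b -> ~ apart item h x -> ~ apart item h y -> False.
  rewrite /= !inE !negb_or !andbT => /and4P[/and4P[ab ah ax ay] /and3P[bh bx by_] /andP[hx hy] xy] ap ahx ahy.
  have ap' := apartC ap.
  apply: (@wheel_impossible h a x b y _ (st' h)) => //; try (by apply: nT; distinct).
  - distinct.
  - by apply: sA; apply: (A2' a b h) => //; distinct.
  - by apply: sA; apply: (A2' b a h) => //; distinct.
  - by apply: (A2' a b x) => //; distinct.
  - by apply: sA; apply: (A2' b a x) => //; distinct.
  - by apply: (A2' b a y) => //; distinct.
  - by apply: sA; apply: (A2' a b y) => //; distinct.
have [/existsP[a /existsP[b /andP[ab /eqP ap]]]|noap] :=
  boolP [exists a, exists b, (a != b) && (item a :&: item b == set0)].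
  have u2 : uniq [:: a; b] by rewrite /= inE ab.
  have [t' []] := extend_uniq u2; rewrite T5.
  case: t' => [|c [|d [|e [|? ?]]]] //= u _.
  move: (u); rewrite /= !inE !negb_or !andbT => /and4P[/and4P[_ ac ad ae] /and3P[bc bd be] /andP[cd ce] de].
  have [cdap|ncd] := eqVneq (item c :&: item d) set0.
    apply: (fin a b e c d) => //; first by distinct.
      by apply: sA; apply: (A2' c d e) => //; distinct.
    by apply: sA; apply: (A2' d c e); [distinct|exact: apartC].
  have [ceap|nce] := eqVneq (item c :&: item e) set0.
    apply: (fin a b d c e) => //; first by distinct.
      by apply: sA; apply: (A2' c e d) => //; distinct.
    by apply: sA; apply: (A2' e c d); [distinct|exact: apartC].
  by apply: (fin a b c d e) => //; apply/eqP.
have [t' []] := @extend_uniq T [::] isT; rewrite T5 /=.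
case: t' => [|a [|b [|c [|d [|e [|? ?]]]]]] // u _.
have nA x y : x != y -> ~ apart item x y.
  by move=> xy ap; case/negP: noap; apply/existsP; exists x; apply/existsP; exists y; rewrite xy ap eqxx.
move: (u); rewrite /= !inE !negb_or !andbT => /and4P[/and4P[ab ac ad ae] /and3P[bc bd be] /andP[cd ce] de].
by apply: (@wheel_impossible a b c d e u (st' a)); try (by apply: nT; distinct); apply: nA; rewrite // eq_sym.
Qed.

Lemma three_points_impossible : False.
Proof.
have [o _] : exists o : T, true by have /card_gt0P[o _] : (0 < #|T|)%N by [rewrite T5]; exists o.
have [/existsP[j /existsP[k /andP[jk /eqP E]]]|no] :=
  boolP [exists j, exists k, (j != k) && ((kf j).1 == (kf k).1)].
  by apply: (@same_type_impossible j); exact: all_same_type jk E.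
pose R t := [set meet t k | k in [set k | (k != t) && (item t :&: item k != set0)]].
apply: (@distinct_types T kf R) o.
- move=> t u E; apply/eqP; apply: contraT => tu; case/negP: no.
  by apply/existsP; exists t; apply/existsP; exists u; rewrite tu E eqxx.
- move=> t; apply/andP; split; last first.
    apply: leq_trans (leq_imset_card _ _) _; apply: (@leq_trans #|[set~ t]|).
      by apply: subset_leq_card; apply/subsetP => x; rewrite !inE => /andP[].
    by rewrite cardsC1 T5.
  rewrite -(card_imset _ (@lift_inj (kf t))); apply: leq_trans (three t) _.
  apply: subset_leq_card; apply/subsetP => p; rewrite inE => /andP[pt /bigcupP[k]].
  rewrite !inE andbT => kt pk.
  have m : item t :&: item k != set0 by apply/set0Pn; exists p; rewrite inE pt.
  apply/imsetP; exists (meet t k); first by apply/imsetP; exists k; rewrite // inE kt m.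
  have tk : t != k by rewrite eq_sym.
  apply: (card_le1_eqP (item_linear tk)); rewrite inE ?pt ?pk //.
  by have [_ ->] := meetP m; rewrite meet_item.
- by rewrite T5.
- move=> t x /imsetP[k]; rewrite inE => /andP[kt m] ->; exists k, (meet k t); split=> //.
    by apply/imsetP; exists t; rewrite // inE eq_sym kt setIC.
  by apply: meetC; rewrite // eq_sym.
Qed.

End Five.

(** An item with at most two common points can be removed, and the other four still have overlap 6;
    otherwise every item has three common points. *)
Lemma no_five : #|T| = 5%N -> (forall t, exists h, forall x, x \in U t -> in_edge h x) ->
  (#|cov item setT| + 8 <= \sum_(t in setT) #|item t|)%N -> False.
Proof.
move=> T5 edge_all big.
have [/existsP[j few]|no] := boolP [exists j, (#|item j :&: cov item (setT :\ j)| <= 2)%N]; last first.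
  apply: three_points_impossible => // t; rewrite ltnNge; apply: contra no => few.
  by apply/existsP; exists t.
apply: (@no_four (setT :\ j)); first by rewrite cardsDS ?sub1set ?inE // cardsT cards1 T5.
have := peel (in_setT j) big few; lia.
Qed.

End Items.

(** * Intersections of full lifted diamonds, and five edges in general *)

Lemma share_two_types j j' x y x' y' : j != j' -> x != y ->
  lift j x = lift j' x' -> lift j y = lift j' y' -> j.1 != j'.1.
Proof. by move=> jj xy Lx Ly; apply: contra jj => /eqP E; apply/eqP; exact: lift_two E xy Lx Ly. Qed.

Lemma no_three_common i i' (x y z x' y' z' : role s) : i != i' -> x != y -> x != z -> y != z ->
  D i x = D i' x' -> D i y = D i' y' -> D i z = D i' z' -> False.
Proof.
move=> ii xy xz yz Ex Ey Ez; have [_ + _] := dD => H2.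
have [h [] /andP[h1 h2]] := edge_pigeonhole x y z.
- exact: H2 ii xy h1 h2 Ex Ey.
- exact: H2 ii xz h1 h2 Ex Ez.
- exact: H2 ii yz h1 h2 Ey Ez.
Qed.

(* If two lifted diamonds share two vertices, then so do their base diamonds, and no further base vertex is
   common. Hence a lift of the first base diamond meets the second lift only in those two vertices. *)
Lemma third_lift j1 j2 j3 x y x' y' w b : j1 != j2 -> x != y ->
  lift j1 x = lift j2 x' -> lift j1 y = lift j2 y' -> j3.1 = j1.1 -> lift j3 w = lift j2 b ->
  exists a, lift j2 b = lift j1 a.
Proof.
move=> j12 xy Lx Ly E Lw; have n12 := share_two_types j12 xy Lx Ly.
have [Ex Ey Ew] := And3 (lift_base Lx) (lift_base Ly) (lift_base Lw); rewrite E in Ew.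
have [wx|wx] := eqVneq w x.
  by exists x; rewrite Lx; congr lift; apply: (@D_inj j2.1); rewrite -Ew -Ex wx.
have [wy|wy] := eqVneq w y.
  by exists y; rewrite Ly; congr lift; apply: (@D_inj j2.1); rewrite -Ew -Ey wy.
by case: (no_three_common n12 xy _ _ Ex Ey Ew); rewrite eq_sym.
Qed.

Definition dia j : {set lvert} := [set lift j x | x in [set: role s]].
Definition edge j h : {set lvert} := [set lift j x | x in [set x | in_edge h x]].

Lemma dia_inter j j' : j != j' -> (#|dia j :&: dia j'| <= 2)%N.
Proof.
move=> jj; rewrite leqNgt; apply/negP => /card_gt2P[p [q [r [[]]]]]; rewrite !inE.
move=> /andP[/imsetP[x _ ->] /imsetP[x' _ Lx]] /andP[/imsetP[y _ ->] /imsetP[y' _ Ly]].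
move=> /andP[/imsetP[z _ ->] /imsetP[z' _ Lz]]; rewrite !(inj_eq (@lift_inj j)) => -[xy yz zx].
have [h [] /andP[h1 h2]] := edge_pigeonhole x y z.
- exact: lift_edge jj xy h1 h2 Lx Ly.
- by apply: (lift_edge jj _ h1 h2 Lx Lz); rewrite eq_sym.
- exact: lift_edge jj yz h1 h2 Ly Lz.
Qed.

Lemma edge_dia_inter j j' h : j != j' -> (#|edge j h :&: dia j'| <= 1)%N.
Proof.
move=> jj; apply/card_le1_eqP => p p'; rewrite !inE.
move=> /andP[/imsetP[x xU ->] /imsetP[x' _ Ex]] /andP[/imsetP[y yU ->] /imsetP[y' _ Ey]].
rewrite !inE in xU yU; have [->//|xy] := eqVneq x y; case: (lift_edge jj xy xU yU Ex Ey).
Qed.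

Lemma card_role : #|role s| = (s + s + 2)%N.
Proof. by rewrite card_sum card_prod !card_bool card_ord; lia. Qed.

Lemma card_dia j : #|dia j| = (s + s + 2)%N.
Proof. by rewrite card_imset ?cardsT ?card_role //; exact: lift_inj. Qed.

Lemma card_in_edge h : #|[set x : role s | in_edge h x]| = (s + 2)%N.
Proof.
pose f (t : 'I_s + bool) : role s := match t with inl u => inl (u, h) | inr b => inr b end.
have fi : injective f by case=> [u|b] [v|c] //= [->].
rewrite -[RHS](_ : #|{: 'I_s + bool}| = _); last by rewrite card_sum card_ord card_bool.
rewrite -(card_image fi); apply: eq_card => x; rewrite !inE; apply/idP/imageP.
  by case: x => [[u h']|b] /=; [move=> /eqP->; exists (inl u)|exists (inr b)].
by case=> [[u|b]] _ -> //=.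
Qed.

Lemma card_edge j h : #|edge j h| = (s + 2)%N.
Proof. by rewrite card_imset ?card_in_edge //; exact: lift_inj. Qed.

(** The sizes add up to 5s + 6, so an overlap of 4 is needed: the diamonds share two vertices and
    the edge meets each of them in one vertex of its own. Three distinct base diamonds contradict
    the last clause of [diamond_system]; coinciding ones are excluded by [third_lift]. *)
Lemma no_two_diamonds_edge j1 j2 j3 h : j1 != j2 -> j3 != j1 -> j3 != j2 ->
  (#|edge j3 h :|: (dia j1 :|: dia j2)| <= 5 * s + 2)%N -> False.
Proof.
move=> j12 j31 j32; rewrite !cardsU card_edge !card_dia setIUr => small.
have d12 := dia_inter j12; have e1 := edge_dia_inter h j31; have e2 := edge_dia_inter h j32.
have c12 : (#|dia j1 :&: dia j2| <= s + s + 2)%N by rewrite -(card_dia j1) subset_leq_card // subsetIl.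
have u12 := leq_of_leqif (leq_card_setU (edge j3 h :&: dia j1) (edge j3 h :&: dia j2)).
have [d2 u2] : (2 <= #|dia j1 :&: dia j2| /\ 2 <= #|edge j3 h :&: dia j1 :|: edge j3 h :&: dia j2|)%N.
  split; lia.
have disj : edge j3 h :&: dia j1 :&: (edge j3 h :&: dia j2) = set0.
  by apply/eqP; rewrite -cards_eq0; move: u2; rewrite cardsU; lia.
have /card_gt1P[u [v []]] := d2; rewrite !inE => /andP[/imsetP[x _ ->] /imsetP[x' _ Lx]].
move=> /andP[/imsetP[y _ ->] /imsetP[y' _ Ly]]; rewrite (inj_eq (@lift_inj j1)) => xy.
have [n1 n2] : (0 < #|edge j3 h :&: dia j1| /\ 0 < #|edge j3 h :&: dia j2|)%N by lia.
have /card_gt0P[p] := n1; rewrite inE => /andP[pe pd1].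
have /card_gt0P[q] := n2; rewrite inE => /andP[qe qd2].
have pd2 : p \notin dia j2.
  by apply/negP => pd2; move/setP/(_ p): disj; rewrite !inE pe pd1 pd2.
have qd1 : q \notin dia j1.
  by apply/negP => qd1; move/setP/(_ q): disj; rewrite !inE qe qd1 qd2.
move: pe pd1 qe qd2 => /imsetP[z + pz] /imsetP[a _ pa] /imsetP[w + qw] /imsetP[b _ qb].
rewrite !inE => hz hw.
have zw : z != w by apply: contra pd2 => /eqP E; rewrite pz E -qw qb; apply: imset_f; rewrite inE.
have [E1|n31] := eqVneq j3.1 j1.1.
  have [|a' E] := @third_lift j1 j2 j3 x y x' y' w b j12 xy Lx Ly E1; first by rewrite -qw qb.
  by case/negP: qd1; rewrite qb E; apply: imset_f; rewrite inE.
have [E2|n32] := eqVneq j3.1 j2.1.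
  have xy' : x' != y'.
    by apply: contra xy => /eqP E; apply/eqP/(@lift_inj j1); rewrite Lx Ly E.
  have [||a' E] := @third_lift j2 j1 j3 x' y' x y z a _ xy' (esym Lx) (esym Ly) E2; first by rewrite eq_sym.
    by rewrite -pz pa.
  by case/negP: pd2; rewrite pa E; apply: imset_f; rewrite inE.
have [_ _ H3] := dD; apply: (H3 j1.1 j2.1 j3.1 h x y x' y' z w a b) => //; try by rewrite eq_sym.
- exact: share_two_types j12 xy Lx Ly.
- exact: lift_base Lx.
- exact: lift_base Ly.
- by apply: lift_base; rewrite -pz.
- by apply: lift_base; rewrite -qw.
Qed.

(** With [T] the lifted diamonds involved and [F] those with both edges present, [#|T| + #|F| = 5],
    which leaves three cases: the overlap is at least 8 for five single edges, 6 for one full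
    diamond with three edges, and two full diamonds with an edge were excluded directly. *)
Lemma lift_free (G : {set key * bool}) : #|G| = 5%N ->
  (5 * s + 2 < #|\bigcup_(g in G) edge g.1 g.2|)%N.
Proof.
move=> G5; rewrite ltnNge; apply/negP => small.
pose full j := ((j, true) \in G) && ((j, false) \in G).
pose Kset := [set g.1 | g in G].
pose U j := [set x : role s | [exists h, ((j, h) \in G) && in_edge h x]].
pose T : finType := {j : key | j \in Kset}.
pose kf (t : T) : key := val t.
have kf_inj : injective kf by exact: val_inj.
have fullU j : full j -> U j = setT.
  move=> /andP[jt jf]; apply/setP => x; rewrite !inE; apply/existsP.
  case: x => [[u h]|b]; last by exists true; rewrite jt.
  by exists h; rewrite /= eqxx andbT; case: h.
have halfU j : j \in Kset -> ~~ full j -> exists h, [/\ (j, h) \in G & U j = [set x | in_edge h x]].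
  move=> /imsetP[[j' h] gG /= ->{j}] nf; exists h; split=> //; apply/setP => x; rewrite !inE.
  apply/existsP/idP => [[h' /andP[gG' hx]]|hx]; last by exists h; rewrite gG.
  suff -> : h = h' by [].
  by apply/eqP; apply: contraT => ne; case/negP: nf; rewrite /full; move: gG gG' ne; case: h h' {hx} => [] [] // -> ->.
have itemE t : item kf (U \o kf) t = [set lift (kf t) x | x in U (kf t)] by [].
have covE : cov (item kf (U \o kf)) setT = \bigcup_(g in G) edge g.1 g.2.
  apply/setP => p; apply/bigcupP/bigcupP => [[t _ /imsetP[x + ->]]|[[j h] gG /imsetP[x + ->]]].
    rewrite inE => /existsP[h /andP[gG hx]]; exists (kf t, h) => //=.
    by apply/imsetP; exists x; rewrite // inE.
  rewrite inE /= => hx; have jK : j \in Kset by apply/imsetP; exists (j, h).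
  exists (exist _ j jK : T); first by rewrite inE.
   apply/imsetP; exists x => //; rewrite inE; apply/existsP; exists h.
  by rewrite gG.
have card_item t : #|item kf (U \o kf) t| = (s + 2 + full (kf t) * s)%N.
  rewrite itemE; have [ft|nf] := boolP (full (kf t)).
    by rewrite fullU // card_dia; lia.
  have [h [_ ->]] := halfU _ (valP t) nf; rewrite card_edge; lia.
pose F := [set t : T | full (kf t)].
have cF : (\sum_(t : T) full (kf t) = #|F|)%N.
  by rewrite -sum1_card [RHS]big_mkcond; apply: eq_bigr => t _; rewrite inE; case: (full _).
have total : (#|T| + #|F| = 5%N)%N.
  have -> : #|T| = (\sum_(t : T) 1)%N by rewrite sum1_card.
  rewrite -cF -big_split /= -(big_sub (mem Kset) (fun j => 1 + full j)%N) -G5 -sum1_card.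
  transitivity (\sum_j \sum_h ((j, h) \in G))%N; last first.
    by rewrite pair_bigA [RHS]big_mkcond; apply: eq_bigr => [[j h]] _ /=; case: (_ \in G).
  rewrite big_mkcond; apply: eq_bigr => j _; rewrite big_bool /full.
  have [jK|jK] := boolP (j \in Kset).
    have [[j' h] gG /= E] := imsetP jK; move: gG; rewrite -E.
    by case: h; case: ((j, true) \in G); case: ((j, false) \in G).
  have no h : ((j, h) \in G) = false by apply: contraNF jK => gG; apply/imsetP; exists (j, h).
  by rewrite !no.
have F_le : (#|F| <= #|T|)%N by exact: max_card.
have sum_item : (\sum_(t in [set: T]) #|item kf (U \o kf) t| = #|T| * (s + 2) + #|F| * s)%N.
  rewrite (eq_bigl predT); last by move=> t; rewrite inE.
  rewrite (eq_bigr _ (fun t _ => card_item t)) big_split /= sum_nat_const -cF.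
  by congr (_ + _)%N; rewrite big_distrl.
have edgeF t : t \notin F -> exists h, forall x, x \in U (kf t) -> in_edge h x.
  rewrite inE => nf; have [h [_ ->]] := halfU _ (valP t) nf; exists h => x; by rewrite inE.
have [t0 _] : exists t : T, true.
  have /card_gt0P[t _] : (0 < #|T|)%N by lia.
  by exists t.
have [[cT cF']|[[cT cF']|[cT cF']]] : (#|T| = 5%N /\ #|F| = 0%N) \/ (#|T| = 4%N /\ #|F| = 1%N) \/ (#|T| = 3%N /\ #|F| = 2%N).
- lia.
- have F0 : F = set0 by apply/eqP; rewrite -cards_eq0 cF'.
  have ed t : exists h, forall x, x \in (U \o kf) t -> in_edge h x by apply: edgeF; rewrite F0 inE.
  apply: (@no_five T kf (U \o kf) t0) => //; rewrite covE sum_item cT cF'; lia.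
- have /cards1P[t1 F1] : #|F| == 1 by rewrite cF'.
  apply: (@no_four T kf (U \o kf) t1 kf_inj _ setT); rewrite ?cardsT // ?covE ?sum_item ?cT ?cF'; last by lia.
  by move=> t tt; apply: edgeF; rewrite F1 inE.
- have /cards2P[t1 [t2 [t12 F2]]] : #|F| == 2 by rewrite cF'.
  have [t3 t3F] : exists t3, t3 \notin F.
    have : (0 < #|~: F|)%N by have := cardsC F; rewrite cT cF'; lia.
    by move=> /card_gt0P[t]; rewrite inE; exists t.
  have nf3 : ~~ full (kf t3) by move: t3F; rewrite inE.
  have [h [gG UE]] := halfU (kf t3) (valP t3) nf3.
  have [f1 f2] : full (kf t1) /\ full (kf t2).
    have inF t : t \in F -> full (kf t) by rewrite inE.
    by split; apply: inF; rewrite F2 !inE eqxx ?orbT.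
  have [t31 t32] : t3 != t1 /\ t3 != t2.
    by move: t3F; rewrite F2 !inE negb_or => /andP.
  apply: (@no_two_diamonds_edge (kf t1) (kf t2) (kf t3) h); rewrite ?(inj_eq kf_inj) //.
  apply: leq_trans small; rewrite -covE; apply: subset_leq_card.
  have sub t : item kf (U \o kf) t \subset cov (item kf (U \o kf)) setT.
    by apply: bigcup_sup; rewrite inE.
  rewrite !subUset; apply/and3P; split.
  - by have := sub t3; rewrite itemE UE.
  - by have := sub t1; rewrite itemE fullU.
  - by have := sub t2; rewrite itemE fullU.
Qed.

End Lift.

(** * The lower bound *)

Lemma f_ext_ge (W : finType) (H : {set {set W}}) (r n k s : nat) : #|W| <= n ->
  (forall e, e \in H -> #|e| = r) ->
  (forall F : {set {set W}}, F \subset H -> #|F| = k -> s < #|cover F|) ->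
  #|H| <= f_ext r n s k.
Proof.
move=> Wn unif free.
pose phi (x : W) : 'I_n := widen_ord Wn (enum_rank x).
have phi_inj : injective phi by move=> x y /(congr1 val) /= /ord_inj/enum_rank_inj.
pose im (e : {set W}) := phi @: e.
have im_inj : injective im by exact: imset_inj.
rewrite -(card_imset _ im_inj) /f_ext; apply: (@leq_bigmax_cond _ _ (fun H' : {set {set 'I_n}} => #|H'|)).
apply/andP; split.
  by apply/forall_inP => _ /imsetP[e eH ->]; rewrite card_imset ?unif.
apply/forallP => F; apply/implyP => /andP[FH /eqP Fk].
pose F0 := [set e in H | im e \in F].
have FE : F = im @: F0.
  apply/setP => e'; apply/idP/imsetP => [eF|[e + ->]]; last by rewrite inE => /andP[].
  by have /imsetP[e eH E] := subsetP FH _ eF; exists e; rewrite // inE eH -E.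
have F0k : #|F0| = k by rewrite -Fk FE card_imset.
have F0H : F0 \subset H by apply/subsetP => e; rewrite inE => /andP[].
apply: leq_trans (free _ F0H F0k) _; rewrite -(card_imset _ phi_inj).
apply: subset_leq_card; apply/subsetP => _ /imsetP[x /bigcupP[e eF xe] ->].
apply/bigcupP; exists (im e); first by rewrite FE imset_f.
exact: imset_f.
Qed.

Lemma lift_family (s K : nat) : 0 < s -> 0 < K ->
  exists v i c L, [/\ 0 < v, 0 < c, 0 < L,
    K * K * v ^ 2 <= K.+1 * K.+1 * (s * s + 3 * s + 1) * (2 * i) &
    forall k n, 0 < k -> v * (k * L).+1 ^ c <= n ->
      2 * i * (k * L).+1 ^ (2 * c) <= f_ext (s + 2) n (5 * s + 2) 5].
Proof.
move=> s0 K0; have [V [I [D [dD V0 cI]]]] := base_system s0 K0.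
have [lam gl] := generic_exists (role s).
have [rel relP] : exists rel : {set role s} -> role s -> int, forall R : {set role s}, 3 <= #|R| <= 4 ->
  [/\ forall x, x \in R -> rel R x != 0%R, (\sum_(x in R) rel R x = 0)%R &
      (\sum_(x in R) rel R x * lam x = 0)%R].
  apply: (@fin_all_exists {set role s} (fun=> role s -> int) (fun R w => 3 <= #|R| <= 4 ->
    [/\ forall x, x \in R -> w x != 0%R, (\sum_(x in R) w x = 0)%R & (\sum_(x in R) w x * lam x = 0)%R])) => R.
  have [R34|nR] := boolP (3 <= #|R| <= 4); last by exists (fun=> 0%R) => R34; case/negP: nR.
  by have [w wP] := slope_relation gl.1 R34; exists w.
pose rl := role s.
pose b1 := \max_(t : {set rl} * rl) `|(12 * rel t.1 t.2)%R|.
pose b2 := \max_(t : rl * rl) `|(lam t.1 - lam t.2)%R|.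
pose b3 := \max_(t : rl * rl * rl * rl * rl * rl)
  `|wheel3 lam t.1.1.1.1.1 t.1.1.1.1.2 t.1.1.1.2 t.1.1.2 t.1.2 t.2|.
pose b4 := \max_(t : rl * rl * rl * rl * rl * rl * rl * rl)
  `|wheel4 lam t.1.1.1.1.1.1.1 t.1.1.1.1.1.1.2 t.1.1.1.1.1.2 t.1.1.1.1.2 t.1.1.1.2 t.1.1.2 t.1.2 t.2|.
pose B := 5 + b1 + b2 + b3 + b4.
have B5 : 5 <= B by rewrite /B; lia.
have B_rel R x : `|(12 * rel R x)%R| <= B.
  apply: (@leq_trans b1); last by rewrite /B; lia.
  exact: (leq_bigmax (R, x)).
have B_lam x y : `|(lam x - lam y)%R| <= B.
  apply: (@leq_trans b2); last by rewrite /B; lia.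
  exact: (leq_bigmax (x, y)).
have B_w3 h1 h2 h3 r1 r2 r3 : `|wheel3 lam h1 h2 h3 r1 r2 r3| <= B.
  apply: (@leq_trans b3); last by rewrite /B; lia.
  exact: (leq_bigmax (h1, h2, h3, r1, r2, r3)).
have B_w4 h1 h2 h3 h4 r1 r2 r3 r4 : `|wheel4 lam h1 h2 h3 h4 r1 r2 r3 r4| <= B.
  apply: (@leq_trans b4); last by rewrite /B; lia.
  exact: (leq_bigmax (h1, h2, h3, h4, r1, r2, r3, r4)).
pose c := #|twist s I B|.
exists #|V|, #|I|, c, B`!; split => //.
- by apply/card_gt0P; exists ([ffun=> ord0], [ffun=> false]).
- exact: fact_gt0.
move=> k n k0 le; pose N := (k * B`!).+1.
have N1 : 1 < N by rewrite ltnS muln_gt0 k0 fact_gt0.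
have cZ : #|{: 'Z_N}| = N by rewrite card_ord Zp_cast.
pose ed (g : key s I B N * bool) := edge D lam g.1 g.2.
have ed_inj : injective ed.
  move=> [j h] [j' h'] E; have [jj|jj] := eqVneq j j'; last first.
    have := edge_dia_inter dD gl k0 (erefl N) B5 B_lam h jj.
    rewrite (setIidPl _) ?(card_edge dD) //; first lia.
    rewrite [edge _ _ _ _](_ : _ = ed (j', h')) //; apply/subsetP => _ /imsetP[x _ ->].
    exact: imset_f.
  subst j'; congr (_, _); apply/eqP; apply: contraT => hh.
  have : lift D lam j (inl (Ordinal s0, h)) \in ed (j, h) by apply: imset_f; rewrite inE /= eqxx.
  rewrite E => /imsetP[x + /(lift_inj dD) Ex]; rewrite -Ex inE /=.
  by rewrite (negPf hh).
pose H := [set ed g | g : key s I B N * bool].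
have cH : #|H| = 2 * #|I| * N ^ (2 * c).
  rewrite card_imset // card_prod card_prod card_bool card_ffun card_prod !cZ -/c expnM mulnn; lia.
rewrite -/N -cH; apply: f_ext_ge.
- apply: leq_trans le; rewrite card_prod card_ffun cZ; exact: leqnn.
- by move=> _ /imsetP[g _ ->]; rewrite (card_edge dD).
- move=> F FH F5; pose G := [set g | ed g \in F].
  have FE : F = ed @: G.
    apply/setP => e; apply/idP/imsetP => [eF|[g + ->]]; last by rewrite inE.
    by have /imsetP[g _ E] := subsetP FH _ eF; exists g; rewrite // inE -E.
  have G5 : #|G| = 5 by rewrite -F5 FE card_imset.
  have := lift_free dD gl k0 (erefl N) relP B5 B_rel B_lam B_w3 B_w4 G5.
  by rewrite FE /cover big_imset //= => g g' _ _; exact: ed_inj.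
Qed.

(** For given [n] the largest admissible [k] is used. Of the three factors (K + 1)/K two come from
    the base system and one from the gap between consecutive moduli. *)
Lemma f_ext_lower (s K : nat) : 0 < s -> 0 < K -> exists n0, forall n, n0 <= n ->
  K ^ 3 * n ^ 2 <= K.+1 ^ 3 * ((s * s + 3 * s + 1) * f_ext (s + 2) n (5 * s + 2) 5).
Proof.
move=> s0 K0; have [v [i [c [L [v0 c0 L0 vi fam]]]]] := lift_family s0 K0.
(* From [k0] on the Bernoulli loss between consecutive moduli, for the exponent [2 * c], is at most
   a fraction 1/(K + 1). *)
pose k0 := K.+1 * (2 * c); exists (v * (k0 * L).+1 ^ c) => n n0n.
have k00 : 0 < k0 by rewrite !muln_gt0 c0.
pose P k := (0 < k) && (v * (k * L).+1 ^ c <= n).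
have exP : exists k, P k by exists k0; rewrite /P k00.
have bd k : P k -> k <= n.
  move=> /andP[k1]; apply: leq_trans; apply: leq_trans (leq_pmull _ v0).
  apply: leq_trans (_ : (k * L).+1 <= _); first by rewrite leqW // leq_pmulr.
  by rewrite -[X in X <= _]expn1 leq_exp2l // ltnS muln_gt0 k1.
case: (ex_maxnP exP bd) => k /andP[k_gt0 kn] kmax.
have k0k : k0 <= k by apply: kmax; rewrite /P k00.
have nk : n < v * (k.+1 * L).+1 ^ c.
  by rewrite ltnNge; apply/negP => le; have := kmax k.+1; rewrite /P le ltnn => /(_ isT).
have step : K * (k.+1 * L).+1 ^ (2 * c) <= K.+1 * (k * L).+1 ^ (2 * c).
  have := @expn_sub_lb (k.+1 * L).+1 L (2 * c).-1.
  rewrite prednK ?muln_gt0 ?c0 // mulSn.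
  rewrite (_ : (L + k * L).+1 - L = (k * L).+1); last lia.
  set a := (k * L).+1 ^ _; set b := (L + k * L).+1 => h.
  have {h} : b ^ (2 * c) <= a + 2 * c * L * b ^ (2 * c).-1.
    by apply: h; rewrite /b; lia.
  have bE : b ^ (2 * c) = b * b ^ (2 * c).-1 by rewrite -expnS prednK ?muln_gt0 ?c0.
  have bb : K.+1 * (2 * c * L) * b ^ (2 * c).-1 <= b ^ (2 * c).
    rewrite bE leq_mul2r; apply/orP; right; rewrite mulnA -/k0 /b.
    by rewrite leqW // (leq_trans _ (leq_addl _ _)) // leq_mul2r k0k orbT.
  rewrite -(leq_pmul2l (ltn0Sn K)) mulnDr (mulnA K.+1 (2 * c * L)) => h.
  have {h} := leq_trans h (leq_add (leqnn _) bb).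
  by rewrite mulSn addnC leq_add2r.
have main := fam k n k_gt0 kn.
have n2 : n ^ 2 <= v ^ 2 * (k.+1 * L).+1 ^ (2 * c).
  rewrite mulnC -[(_.+1 ^ _)]/(_) (mulnC 2) expnM -expnMn mulnC leq_exp2r //.
  exact: ltnW.
move: vi main n2 step; set Q := s * s + _ + _; set a := _ ^ (2 * c); set b := _ ^ (2 * c).
set f := f_ext _ _ _ _ => vi main n2 step.
apply: leq_trans (_ : K ^ 3 * (v ^ 2 * b) <= _); first by rewrite leq_mul2l n2 orbT.
apply: leq_trans (_ : (K.+1 * K.+1 * Q * (2 * i)) * (K.+1 * a) <= _).
  by rewrite (_ : K ^ 3 * (v ^ 2 * b) = K * K * v ^ 2 * (K * b)); [exact: leq_mul | ring].
rewrite (_ : _ * _ = K.+1 ^ 3 * (Q * (2 * i * a))); last by ring.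
by rewrite !leq_mul2l main !orbT.
Qed.

(* The limit *)
From mathcomp Require Import all_classical all_reals all_analysis.
Import Order.TTheory GRing.Theory Num.Theory.
Import numFieldNormedType.Exports.
Local Open Scope classical_set_scope.
Local Open Scope ring_scope.

Local Open Scope classical_set_scope.

Theorem theorem1p1 (R : realType) (r : nat) (hr : (3 <= r)%N) :
  (fun n : nat => ((f_ext r n (5 * r - 8) 5)%:R / (n ^ 2)%:R : R)) @ \oo
    --> (((r%:R : R) ^+ 2 - r%:R - 1)^-1).
Proof.
pose Q := (r * (r - 1) - 1)%N; have Q0 : (0 < Q)%N by rewrite /Q; nia.
have -> : r%:R ^+ 2 - r%:R - 1 = Q%:R :> R.
  rewrite /Q natrB ?natrM ?natrB; [|lia|nia]; ring.
have Qp : 1 <= Q%:R :> R by rewrite ler1n.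
apply/cvgrPdist_lt => eps eps0.
(* The 8 absorbs the term [8 * n] of the upper bound once [n] is at least [K], and it exceeds the 3
   lost in the lower bound. *)
pose K := Num.bound (8 / eps); have Keps : 8 / eps < K%:R by apply: archi_boundP; apply: divr_ge0 => //; exact: ltW.
have Kp : 0 < K%:R :> R by apply: lt_trans Keps; exact: divr_gt0.
have K0 : (0 < K)%N by rewrite -(ltr0n R).
rewrite ltr_pdivrMr // in Keps.
have [|n0 low] := @f_ext_lower (r - 2) K _ K0; first by lia.
exists (maxn n0 K) => // n /=; rewrite geq_max => /andP[n0n Kn].
have np : K%:R <= n%:R :> R by rewrite ler_nat.
have {}low := low n n0n.
rewrite (_ : (r - 2) * (r - 2) + _ + _ = Q)%N in low; last by rewrite /Q; nia.
have E1 : (r - 2 + 2 = r)%N by lia.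
have E2 : (5 * (r - 2) + 2 = 5 * r - 8)%N by lia.
rewrite E1 E2 in low.
have up := f_ext_upper n hr; rewrite -/Q in up.
move: (f_ext _ _ _ _) low up => f low up.
have {}up : Q%:R * f%:R <= n%:R * n%:R + Q%:R * (8 * n%:R) :> R by rewrite -!natrM -natrD ler_nat.
have {}low : K%:R ^+ 3 * n%:R ^+ 2 <= (K%:R + 1) ^+ 3 * (Q%:R * f%:R) :> R.
  by rewrite natr1 -!natrX -!natrM ler_nat.
rewrite natrX; move: (K%:R) (n%:R) (Q%:R) (f%:R) Kp Keps np Qp up low => k m q x Kp Keps mp Qp up low.
have m0 : 0 < m by exact: lt_le_trans mp.
have q0 : 0 < q by exact: lt_le_trans Qp.
(* The cube is linearised by (k + 1)^3 (k - 3) <= k^4. *)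
have {}low : (k - 3) * m ^+ 2 <= k * (q * x).
  rewrite -(ler_pM2l (_ : 0 < (k + 1) ^+ 3)); last by rewrite exprn_gt0 // ltr_wpDr.
  apply: le_trans (_ : k * (k ^+ 3 * m ^+ 2) <= _).
    have h : (k + 1) ^+ 3 * (k - 3) <= k * k ^+ 3.
      rewrite -subr_ge0 [X in 0 <= X](_ : _ = 6 * (k * k) + 8 * k + 3); last by ring.
      by rewrite !addr_ge0 ?mulr_ge0 // ltW.
    rewrite (mulrA ((k + 1) ^+ 3)) (mulrA k); exact: ler_wpM2r (sqr_ge0 m) _ _ h.
  by rewrite (mulrCA ((k + 1) ^+ 3)) ler_pM2l.
have m2 : 0 < m ^+ 2 by rewrite exprn_gt0.
rewrite (_ : q^-1 - x / m ^+ 2 = (m ^+ 2 - q * x) / (q * m ^+ 2)); last first.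
  by field; rewrite !gt_eqF.
rewrite normrM normfV (gtr0_norm (mulr_gt0 q0 m2)) ltr_pdivrMr ?mulr_gt0 //.
have em : 8 * m < eps * m ^+ 2.
  by rewrite expr2 mulrA ltr_pM2r //; apply: lt_le_trans Keps _; rewrite mulrC ler_pM2l.
have km2 : 3 * m ^+ 2 < (eps * m ^+ 2) * k.
  by rewrite mulrAC ltr_pM2r // (mulrC eps); apply: lt_trans Keps; rewrite ltr_nat.
have lo : m ^+ 2 - q * x < eps * m ^+ 2.
  by rewrite -(ltr_pM2r Kp); lra.
have hi : q * x - m ^+ 2 < q * (eps * m ^+ 2).
  apply: le_lt_trans (_ : q * (8 * m) < _); first by rewrite expr2; lra.
  by rewrite ltr_pM2l.
rewrite mulrCA ltr_norml; apply/andP; split; first by lra.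
by apply: lt_le_trans lo _; rewrite ler_peMl // mulr_ge0 // ltW.
Qed.
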